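(* Let $D$ be a bounded non-pseudoconvex domain in $\mathbb{C}^n$ with $\mathcal{C}^1$ boundary. Then there exists a sequence $(z_j)_j\subset D$ such that $$\lim_{j\to\infty}K_D(z_j)\,V^A_D(z_j)=0.$$
   Context: For a domain $D\subset\mathbb{C}^n$, $z\in D$ and $X\in\mathbb{C}^n$: The Bergman kernel (on the diagonal) is $K_D(z):=\sup\{|f(z)|^2 : f \text{ holomorphic on } D,\ \|f\|_{L^2(D)}\le 1\}$. The pluricomplex Green function with pole at $z$ is $g_D(z,w):=\sup\{u(w)\}$, where the supremum is over all plurisubharmonic functions $u$ on $D$ with $u<0$ and $u<\log\|\cdot-z\|+C$ on $D$ for some constant $C$ (depending on $u$). The Azukawa metric is $A_D(z;X):=\limsup_{\lambda\to 0}\dfrac{\exp g_D(z,z+\lambda X)}{|\lambda|}$, with $\lambda\in\mathbb{C}\setminus\{0\}$. $V^A_D(z)$ is the volume (Lebesgue measure in $\mathbb{C}^n\cong\mathbb{R}^{2n}$) of the indicatrix $\{X\in\mathbb{C}^n : A_D(z;X)<1\}$. *)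

(* Defs.v *)
From HB Require Import structures.
From mathcomp Require Import all_boot all_order all_algebra.
From mathcomp Require Import all_classical all_reals all_analysis.
From mathcomp Require Import complex.

Set Implicit Arguments.
Unset Strict Implicit.
Unset Printing Implicit Defensive.

Import Order.TTheory GRing.Theory Num.Theory.
Import numFieldNormedType.Exports.

Local Open Scope classical_set_scope.
Local Open Scope ring_scope.
Local Open Scope complex_scope.

(* The usual topology of the complex numbers R[i], as a normed space over
   themselves; C^n is 'rV[R[i]]_n with its library topology. *)
HB.instance Definition _ (R : rcfType) := NormedModule.copy R[i] R[i]^o.

(* The library's sigma-finite instance of the product measure is shadowed by
   its subprobability instance. *)
Lemma sigma_finite_prod d1 d2 (T1 : measurableType d1) (T2 : measurableType d2)
    (R : realType) (m1 : {sigma_finite_measure set T1 -> \bar R})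
    (m2 : {sigma_finite_measure set T2 -> \bar R}) :
  sigma_finite setT (m1 \x m2)%E.
Proof.
have /sigma_finiteP[F [TF ndF Foo]] := sigma_finiteT m1.
have /sigma_finiteP[G [TG ndG Goo]] := sigma_finiteT m2.
exists (fun n => F n `*` G n).
  rewrite -setXTT TF TG predeqE => -[x y]; split.
    move=> [/= [n _ Fnx] [k _ Gky]]; exists (maxn n k) => //; split.
    - by move: x Fnx; exact/subsetPset/ndF/leq_maxl.
    - by move: y Gky; exact/subsetPset/ndG/leq_maxr.
  by move=> [n _ []/= ? ?]; split; exists n.
move=> k; have [? ?] := Foo k; have [? ?] := Goo k.
split; first exact: measurableX.
by rewrite product_measure1E// lte_mul_pinfty// ge0_fin_numE.
Qed.

(* The product measure as a measure on tuples *)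
Section lebesgue_cons.
Context d (T : measurableType d) (R : realType) (n : nat).
Variables (mu : {sigma_finite_measure set T -> \bar R})
          (nu : {sigma_finite_measure set (n.-tuple T) -> \bar R}).

Definition tcons (x : T * n.-tuple T) : n.+1.-tuple T :=
  [the n.+1.-tuple T of x.1 :: x.2].

Lemma measurable_tcons : measurable_fun [set: T * n.-tuple T] tcons.
Proof. exact: measurable_cons. Qed.

Definition cons_measure : set (n.+1.-tuple T) -> \bar R :=
  pushforward (mu \x nu)%E tcons.

Let cons_measure0 : cons_measure set0 = 0%E.
Proof. by rewrite /cons_measure /pushforward preimage_set0 measure0. Qed.

Let cons_measure_ge0 A : (0 <= cons_measure A)%E.
Proof. exact: (measure_ge0 (mu \x nu)%E). Qed.

Let preimage_tcons A : measurable A -> measurable (tcons @^-1` A).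
Proof. by move=> mA; rewrite -[X in measurable X]setTI; exact: measurable_tcons. Qed.

Let cons_measure_sigma_additive : semi_sigma_additive cons_measure.
Proof.
move=> F mF tF mUF; rewrite /cons_measure /pushforward preimage_bigcup.
apply: measure_semi_sigma_additive.
- by move=> k; exact: preimage_tcons.
- apply/trivIsetP => i j _ _ ij; rewrite -preimage_setI.
  by move/trivIsetP : tF => /(_ _ _ _ _ ij) ->//; rewrite preimage_set0.
- by rewrite -preimage_bigcup; exact: preimage_tcons.
Qed.

HB.instance Definition _ := isMeasure.Build _ _ _ cons_measure
  cons_measure0 cons_measure_ge0 cons_measure_sigma_additive.

Let cons_measure_sigma_finite : sigma_finite setT cons_measure.
Proof.
have [F FT Foo] := sigma_finite_prod mu nu.
pose h (t : n.+1.-tuple T) := (thead t, [tuple of behead t]).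
have mh : measurable_fun [set: n.+1.-tuple T] h.
  apply/measurable_fun_pair => /=; last exact: measurable_behead.
  exact: measurable_tnth.
have hK x : h (tcons x) = x.
  by case: x => x y; rewrite /h /tcons; congr (_, _); exact: val_inj.
exists (fun k => h @^-1` F k).
  by rewrite -preimage_bigcup -FT preimage_setT.
move=> k; have [mFk Fkoo] := Foo k; split.
  by rewrite -[X in measurable X]setTI; exact: mh.
rewrite /cons_measure /pushforward -comp_preimage.
by rewrite (_ : h \o tcons = id) ?preimage_id//; apply/funext.
Qed.

HB.instance Definition _ := Measure_isSigmaFinite.Build _ _ _ cons_measure
  cons_measure_sigma_finite.

End lebesgue_cons.

Section lebesgue_Cn.
Context {R : realType}.
Local Notation C := (measurableTypeR R * measurableTypeR R)%type.

Definition lebesgue_C : set C -> \bar R :=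
  (@lebesgue_measure R \x @lebesgue_measure R)%E.

HB.instance Definition _ := Measure.on lebesgue_C.
HB.instance Definition _ := Measure_isSigmaFinite.Build _ _ _ lebesgue_C
  (sigma_finite_prod (@lebesgue_measure R) (@lebesgue_measure R)).

Fixpoint lebesgue_Cn (n : nat) :
    {sigma_finite_measure set (n.-tuple C) -> \bar R} :=
  match n with
  | 0 => \d_([tuple] : 0.-tuple C)
  | m.+1 => cons_measure lebesgue_C (lebesgue_Cn m)
  end.

End lebesgue_Cn.

Section several_complex_variables.
Context {R : realType} {n : nat}.
Local Notation C := (R[i]).
Local Notation Cn := ('rV[R[i]]_n).
Local Notation modulus := (@ComplexField.Normc.normc R).

(* R^2n --> C^n, through which measure and integration are transported *)
Definition toCn (t : n.-tuple (measurableTypeR R * measurableTypeR R)%type) : Cn :=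
  \row_i ((tnth t i).1 +i* (tnth t i).2).

Definition enorm (z : Cn) : R := Num.sqrt (\sum_i modulus (z 0 i) ^+ 2).

(* The outer measure generated by [lebesgue_Cn]: it is Lebesgue measure on
   Lebesgue-measurable sets, and is meaningful without a measurability proof. *)
Definition volume (E : set Cn) : \bar R :=
  ((@lebesgue_Cn R n)^*)%mu (toCn @^-1` E).

Definition domain (D : set Cn) := [/\ open D, connected D & D !=set0].

(* R[i]-linear Frechet differentiability at every point of the open set D *)
Definition holomorphic (D : set Cn) (f : Cn -> C) :=
  forall z, D z -> differentiable f z.

Definition L2norm (D : set Cn) (f : Cn -> C) : \bar R :=
  ((\int[@lebesgue_Cn R n]_(t in toCn @^-1` D) ((modulus (f (toCn t)) ^+ 2)%:E))
    `^ 2^-1)%E.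

Definition bergman_kernel (D : set Cn) (z : Cn) : \bar R :=
  ereal_sup [set (modulus (f z) ^+ 2)%:E | f in
    [set f | holomorphic D f /\ (L2norm D f <= 1)%E]].

End several_complex_variables.

Section psh.
Context {R : realType}.
Local Notation C := (R[i]).
Local Notation modulus := (@ComplexField.Normc.normc R).

(* Used only for open sets D *)
Definition usc_on {T : topologicalType} (D : set T) (u : T -> \bar R) :=
  forall x, D x -> forall a : R, (u x < a%:E)%E ->
    \forall y \near x, (u y < a%:E)%E.

(* The function identically -oo is allowed. *)
Definition subharmonic (G : set C) (v : C -> \bar R) :=
  [/\ forall x, G x -> (v x < +oo)%E,
      usc_on G v &
      forall (c : C) (r : R), 0 < r ->
        [set x | modulus (x - c) <= r] `<=` G ->
        (v c <= ((2 * pi)^-1)%:E *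
          \int[lebesgue_measure]_(t in `[0%R, (2 * pi)%R])
             v (c + (r * cos t +i* (r * sin t)))%R)%E].

Definition plurisubharmonic {n} (D : set 'rV[C]_n) (u : 'rV[C]_n -> \bar R) :=
  [/\ forall z, D z -> (u z < +oo)%E,
      usc_on D u &
      forall a b : 'rV[C]_n,
        subharmonic [set l : C | D (a + l *: b)] (fun l => u (a + l *: b))].

(* u is a continuous plurisubharmonic exhaustion function of D. *)
Definition pseudoconvex {n} (D : set 'rV[C]_n) :=
  exists u : 'rV[C]_n -> R,
    [/\ forall z, D z -> {for z, continuous u},
        plurisubharmonic D (fun z => (u z)%:E) &
        forall c : R, let S := [set z | D z /\ u z < c] in
          compact (closure S) /\ closure S `<=` D].

(* At w = z the right-hand side is -oo, and the condition is understood for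
   w <> z; upper semicontinuity and subharmonicity then force u z = -oo. *)
Definition green {n} (D : set 'rV[C]_n) (z w : 'rV[C]_n) : \bar R :=
  ereal_sup [set u w | u in
    [set u : 'rV[C]_n -> \bar R |
      [/\ plurisubharmonic D u,
          forall x, D x -> (u x < 0)%E &
          exists K : R, forall x, D x -> x != z ->
            (u x < (ln (enorm (x - z)) + K)%:E)%E]]].

Definition azukawa {n} (D : set 'rV[C]_n) (z X : 'rV[C]_n) : \bar R :=
  limf_esup (fun l : C => (expeR (green D z (z + l *: X)) * ((modulus l)^-1)%:E)%E)
    (0 : C)^'.

Definition azukawa_volume {n} (D : set 'rV[C]_n) (z : 'rV[C]_n) : \bar R :=
  volume [set X | (azukawa D z X < 1)%E].

(* derivative of r at z along v, v being a vector of the real space R^2n *)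
Definition real_derive {n} (r : 'rV[C]_n -> R) (z v : 'rV[C]_n) : R :=
  derive1 (fun t : R => r (z + t%:C *: v)) 0.

(* Directional derivatives along all vectors of R^2n exist and are continuous,
   which amounts to the same for the 2n partial derivatives. *)
Definition C1_on {n} (U : set 'rV[C]_n) (r : 'rV[C]_n -> R) :=
  forall (v z : 'rV[C]_n), U z ->
    derivable (fun t : R => r (z + t%:C *: v)) 0 1 /\
    {for z, continuous (fun w => real_derive r w v)}.

Definition C1_boundary {n} (D : set 'rV[C]_n) :=
  forall p, (closure D `\` interior D) p ->
    exists U (r : 'rV[C]_n -> R),
      [/\ open_nbhs p U, C1_on U r,
          (forall z, U z -> exists v, real_derive r z v != 0) &
          D `&` U = [set z | U z /\ r z < 0]].

End psh.

(* Main.v *)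
(* Suppose that K V is bounded below by c > 0 on D.  Near a boundary point, at every
   z in D and at a small scale rho, the C^1 boundary confines D to a half space
   {w | Re L(w - z) < 2 eta rho}.  There L(w - z) / (4 eta rho - L(w - z)) is holomorphic
   and bounded by 3; the logarithm of a multiple of its modulus, glued to log |w - z|,
   is a competitor for the Green function with pole z.  It places the Azukawa
   indicatrix at z in a bounded slab of width O(eta), hence V(z) -> 0 and K(z) -> +oo
   as z tends to the boundary.  Then log (1 + K) is a continuous plurisubharmonic
   exhaustion function, and D is pseudoconvex.

   The submean inequalities for the logarithm of a function E rest on a maximum
   principle for functions which, at every point, are touched from below by the modulus
   of a holomorphic function: it applies to the product of E over N rotations of a
   circle, and N -> oo gives the circular mean of log E. *)
Require Import Defs.
From mathcomp Require Import all_boot all_order all_algebra.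
From mathcomp Require Import all_classical all_reals all_analysis.
From mathcomp Require Import complex measurable_realfun.
From mathcomp Require Import ring lra.

Set Implicit Arguments.
Unset Strict Implicit.
Unset Printing Implicit Defensive.

Import Order.TTheory GRing.Theory Num.Theory.
Import numFieldNormedType.Exports.

Local Open Scope classical_set_scope.
Local Open Scope ring_scope.

Local Open Scope complex_scope.

(** * Goursat's theorem for differential forms *)

(** All the function theory rests on one weak estimate, [cauchy_square], which bounds |f(c)|^2 by
    the mean of |f|^2 over the boundary of a square, up to a constant factor. Where an exact
    inequality is required, as in the maximum principle, the factor is removed by applying the
    estimate to the powers f^k; where only finiteness counts, as for K, it is kept.

    The smallness of V must not depend on the scale rho at which the boundary looks flat, since rho
    shrinks with eta in an uncontrolled way. The quotient in the competitor has derivative L / (4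
    eta rho) at z, and gluing costs a factor proportional to rho, so rho cancels in the bound on L
    X. Only the direction of L is squeezed; the others are bounded by the diameter of D. A complex
    direction counts twice, hence V = O(eta^2).

    The 1 in log (1 + K) keeps the function finite where K vanishes. Its submean inequality follows
    from those of log (1 + |f|^2), all bounded by the same circular mean, and its continuity from
    the equicontinuity of the unit ball of the Bergman space. *)

Section interval_integral.
Context {R : realType}.
Implicit Types (f g : R -> R) (a b c : R).

Definition cint a b f : R := \int[lebesgue_measure]_(x in `[a, b]) f x.

Lemma cint_integrable a b f : {in `[a, b], continuous f} ->
  (@lebesgue_measure R).-integrable `[a, b] (EFin \o f).
Proof.
move=> cf; apply: continuous_compact_integrable; first exact: segment_compact.
by apply: continuous_in_subspaceT => x; rewrite inE/=; exact: cf.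
Qed.

Lemma cintD a b f g : {in `[a, b], continuous f} -> {in `[a, b], continuous g} ->
  cint a b (fun x => f x + g x) = cint a b f + cint a b g.
Proof. by move=> cf cg; rewrite /cint RintegralD//; exact: cint_integrable. Qed.

Lemma cintB a b f g : {in `[a, b], continuous f} -> {in `[a, b], continuous g} ->
  cint a b (fun x => f x - g x) = cint a b f - cint a b g.
Proof. by move=> cf cg; rewrite /cint RintegralB//; exact: cint_integrable. Qed.

Lemma cintZ a b k f : {in `[a, b], continuous f} ->
  cint a b (fun x => k * f x) = k * cint a b f.
Proof. by move=> cf; rewrite /cint RintegralZl//; exact: cint_integrable. Qed.

Lemma cint_cst a b k : a <= b -> cint a b (fun=> k) = k * (b - a).
Proof.
move=> ab; rewrite /cint Rintegral_cst//= lebesgue_measure_itv/= lte_fin.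
by case: ltgtP ab => [ab|ab|->] abl; rewrite ?subrr ?mulr0 -?EFinB.
Qed.

Lemma le_cint a b f g : {in `[a, b], continuous f} -> {in `[a, b], continuous g} ->
  (forall x, a <= x <= b -> f x <= g x) -> cint a b f <= cint a b g.
Proof.
by move=> cf cg fg; apply: le_Rintegral => //; exact: cint_integrable.
Qed.

Lemma cint_split a m b f : {in `[a, b], continuous f} -> a <= m -> m <= b ->
  cint a b f = cint a m f + cint m b f.
Proof.
move=> cf am mb; have it := cint_integrable cf.
have := @Rintegral_itvB R f (BLeft a) (BRight b) m it am mb.
rewrite /cint Rintegral_itv_obnd_cbnd.
  by move=> <-; rewrite addrC subrK.
apply: integrableS it => //; apply: subset_itvr; rewrite bnd_simp.
by [].
Qed.

Lemma cint_norm_le a b f k : a <= b -> {in `[a, b], continuous f} ->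
  (forall x, a <= x <= b -> `|f x| <= k) -> `|cint a b f| <= k * (b - a).
Proof.
move=> ab cf fk; have ck r : {in `[a, b], continuous (fun=> r : R)}.
  by move=> x _; exact: cst_continuous.
rewrite ler_norml -mulNr -!cint_cst//; apply/andP; split; apply: le_cint => // x.
  by move=> /fk; rewrite ler_norml => /andP[].
by move=> /fk; rewrite ler_norml => /andP[].
Qed.

End interval_integral.

Section goursat.
Context {R : realType}.
Implicit Types (U W : R -> R -> R) (a c l : R).

(** Differentiability at one point of both coefficients of U dx + W dy; the shared [be] is the
    equation U_y = W_x. The condition is pointwise, as in Goursat's setting. *)
Definition closed_form_at U W x0 y0 := exists al be ga : R,
  forall e, 0 < e -> exists2 d, 0 < d & forall x y, `|x - x0| < d -> `|y - y0| < d ->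
    `|U x y - U x0 y0 - (al * (x - x0) + be * (y - y0))|
       <= e * (`|x - x0| + `|y - y0|) /\
    `|W x y - W x0 y0 - (be * (x - x0) + ga * (y - y0))|
       <= e * (`|x - x0| + `|y - y0|).

Lemma near_dist (x d : R) : 0 < d -> \forall y \near x, `|y - x| < d.
Proof. by move=> d0; apply/nbhs_normP; exists d => // y /=; rewrite distrC. Qed.

Lemma continuous_of_linear_approx (f : R -> R) x0 al :
  (exists2 d, 0 < d & forall x, `|x - x0| < d ->
    `|f x - f x0 - al * (x - x0)| <= `|x - x0|) -> {for x0, continuous f}.
Proof.
move=> [d d0 H]; apply/cvgrPdist_lt => e e0.
have k0 : 0 < `|al| + 1 by rewrite ltr_wpDl.
near=> x.
have xd : `|x - x0| < d by near: x; exact: near_dist.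
have xe : `|x - x0| < e / (`|al| + 1).
  by near: x; apply: near_dist; rewrite divr_gt0.
rewrite distrC (_ : f x - f x0 = (f x - f x0 - al * (x - x0)) + al * (x - x0)).
  rewrite (le_lt_trans (ler_normD _ _))// normrM.
  rewrite (le_lt_trans (lerD (H _ xd) (lexx _)))//.
  by move: xe; rewrite ltr_pdivlMr// mulrDr mulr1 addrC mulrC.
by rewrite subrK.
Unshelve. all: by end_near. Qed.

Lemma closed_form_continuous U W x0 y0 : closed_form_at U W x0 y0 ->
  [/\ {for x0, continuous (U^~ y0)}, {for y0, continuous (U x0)},
      {for x0, continuous (W^~ y0)} & {for y0, continuous (W x0)}].
Proof.
move=> [al [be [ga /(_ 1 ltr01)[d d0 H]]]]; split.
- apply: (@continuous_of_linear_approx _ _ al); exists d => // x xd.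
  by have := H x y0 xd; rewrite !subrr !mulr0 !addr0 normr0 addr0 mul1r => -[].
- apply: (@continuous_of_linear_approx _ _ be); exists d => // y yd.
  have := H x0 y; rewrite !subrr !mulr0 !add0r normr0 add0r mul1r.
  by move=> [].
- apply: (@continuous_of_linear_approx _ _ be); exists d => // x xd.
  by have := H x y0 xd; rewrite !subrr !mulr0 !addr0 normr0 addr0 mul1r => -[].
- apply: (@continuous_of_linear_approx _ _ ga); exists d => // y yd.
  have := H x0 y; rewrite !subrr !mulr0 !add0r normr0 add0r mul1r.
  by move=> [].
Qed.

(** The integral of U dx + W dy counterclockwise around the square with lower left corner (a, c) and
    side l. Opposite sides share one integrand so that their difference can be estimated
    pointwise. *)
Definition circulation U W a c l : R :=
  cint a (a + l) (fun x => U x c - U x (c + l)) +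
  cint c (c + l) (fun y => W (a + l) y - W a y).

Definition closed_form_on U W a c l := forall x y,
  a <= x <= a + l -> c <= y <= c + l -> closed_form_at U W x y.

Lemma closed_form_onS U W a c l a' c' l' : closed_form_on U W a c l ->
  a <= a' -> a' + l' <= a + l -> c <= c' -> c' + l' <= c + l ->
  closed_form_on U W a' c' l'.
Proof. by move=> H *; move=> x y /andP[? ?] /andP[? ?]; apply: H; lra. Qed.

Section continuity.
Variables (U W : R -> R -> R) (a c l : R).
Hypothesis cUW : closed_form_on U W a c l.

Lemma cfU y : c <= y <= c + l -> {in `[a, a + l], continuous (U^~ y)}.
Proof.
by move=> hy x; rewrite in_itv/= => hx; have [] := closed_form_continuous (cUW hx hy).
Qed.

Lemma cfW x : a <= x <= a + l -> {in `[c, c + l], continuous (W x)}.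
Proof.
by move=> hx y; rewrite in_itv/= => hy; have [] := closed_form_continuous (cUW hx hy).
Qed.

End continuity.

Lemma continuousB_in (f g : R -> R) a b : {in `[a, b], continuous f} ->
  {in `[a, b], continuous g} -> {in `[a, b], continuous (fun x => f x - g x)}.
Proof. by move=> cf cg x xab; apply: continuousB; [exact: cf|exact: cg]. Qed.

Lemma continuousS_in (f : R -> R) a b a' b' : {in `[a, b], continuous f} ->
  a <= a' -> b' <= b -> {in `[a', b'], continuous f}.
Proof.
move=> cf aa bb x; rewrite in_itv/= => /andP[ax xb]; apply: cf.
by rewrite in_itv/= (le_trans aa ax) (le_trans xb bb).
Qed.

(** Each inner side belongs to two quarters, which traverse it in opposite directions. *)
Lemma circulation4 U W a c l : 0 <= l -> closed_form_on U W a c (l + l) ->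
  circulation U W a c (l + l) =
  circulation U W a c l + circulation U W (a + l) c l +
  (circulation U W a (c + l) l + circulation U W (a + l) (c + l) l).
Proof.
move=> l0 cUW; rewrite /circulation !addrA.
have hU y : c <= y <= c + (l + l) -> {in `[a, a + l + l], continuous (U^~ y)}.
  by move=> hy; have := cfU cUW hy; rewrite addrA.
have hW x : a <= x <= a + (l + l) -> {in `[c, c + l + l], continuous (W x)}.
  by move=> hx; have := cfW cUW hx; rewrite addrA.
have hU' y a' b' : c <= y <= c + (l + l) -> a <= a' -> b' <= a + l + l ->
    {in `[a', b'], continuous (U^~ y)}.
  by move=> hy; apply: continuousS_in; exact: hU.
have hW' x a' b' : a <= x <= a + (l + l) -> c <= a' -> b' <= c + l + l ->
    {in `[a', b'], continuous (W x)}.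
  by move=> hy; apply: continuousS_in; exact: hW.
rewrite !cintB; try by [apply: hU'; lra | apply: hW'; lra].
rewrite (@cint_split _ a (a + l) (a + l + l) (U^~ c)); [|apply: hU'; lra|lra..].
rewrite (@cint_split _ a (a + l) (a + l + l) (U^~ (c + l + l))); [|apply: hU'; lra|lra..].
rewrite (@cint_split _ c (c + l) (c + l + l) (W a)); [|apply: hW'; lra|lra..].
rewrite (@cint_split _ c (c + l) (c + l + l) (W (a + l + l))); [|apply: hW'; lra|lra..].
ring.
Qed.

(* Subtracting the linear parts, whose circulation vanishes because of the
   common coefficient [be], leaves a remainder of order [e * l ^ 2]. *)
Lemma circulation_small U W a c l x0 y0 (al be ga e : R) :
  0 <= l -> closed_form_on U W a c l ->
  (forall x y, a <= x <= a + l -> c <= y <= c + l ->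
    `|U x y - U x0 y0 - (al * (x - x0) + be * (y - y0))| <= e /\
    `|W x y - W x0 y0 - (be * (x - x0) + ga * (y - y0))| <= e) ->
  `|circulation U W a c l| <= 4 * e * l.
Proof.
move=> l0 cUW H.
have ka : a <= a <= a + l by lra.
have kal : a <= a + l <= a + l by lra.
have kc : c <= c <= c + l by lra.
have kcl : c <= c + l <= c + l by lra.
have ck (b d r : R) : {in `[b, d], continuous (fun=> r : R)}.
  by move=> x _; exact: cst_continuous.
have {}H1 : `|cint a (a + l) (fun x => U x c - U x (c + l) - (- (be * l)))|
    <= 2 * e * (a + l - a).
  apply: cint_norm_le; first lra.
    by do 2 apply: continuousB_in => //; exact: (cfU cUW).
  move=> x hx; have [+ _] := H x c hx kc; have [+ _] := H x (c + l) hx kcl.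
  rewrite !ler_norml => /andP[? ?] /andP[? ?]; apply/andP; split; lra.
have {}H2 : `|cint c (c + l) (fun y => W (a + l) y - W a y - be * l)|
    <= 2 * e * (c + l - c).
  apply: cint_norm_le; first lra.
    by do 2 apply: continuousB_in => //; exact: (cfW cUW).
  move=> y hy; have [_] := H a y ka hy; have [_] := H (a + l) y kal hy.
  rewrite !ler_norml => /andP[? ?] /andP[? ?]; apply/andP; split; lra.
have [cU1 cU2] := (cfU cUW kc, cfU cUW kcl).
have [cW1 cW2] := (cfW cUW ka, cfW cUW kal).
move: H1 H2; rewrite /circulation !cintB//; try exact: continuousB_in.
rewrite !cint_cst; [|lra..].
rewrite !ler_norml => /andP[? ?] /andP[? ?]; apply/andP; split; lra.
Qed.

Lemma nested_intervals (u v : nat -> R) : (forall n, u n <= u n.+1) ->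
  (forall n, v n.+1 <= v n) -> (forall n, u n <= v n) ->
  exists x, forall n, u n <= x <= v n.
Proof.
move=> uS vS uv.
have uvm n m : u n <= v m.
  rewrite (@le_trans _ _ (u (n + m)%N))//.
    by elim: m => [|m IH]; [rewrite addn0|rewrite addnS (le_trans IH)].
  rewrite (le_trans (uv _))//.
  by elim: n => [|n IH]; [rewrite add0n|rewrite addSn (le_trans (vS _))].
have ne : range u !=set0 by exists (u 0%N), 0%N.
exists (sup (range u)) => n; apply/andP; split.
  apply: ub_le_sup; last by exists n.
  by exists (v 0%N) => _ [m _ <-].
by apply: ge_sup => // _ [m _ <-].
Qed.

Lemma small_dyadic (l d : R) : 0 < d -> exists n, l / 2 ^+ n < d.
Proof.
move=> d0; exists (Num.bound `|l / d|).
rewrite ltr_pdivrMr ?exprn_gt0// mulrC -ltr_pdivrMr//.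
rewrite (le_lt_trans (ler_norm _))// (lt_le_trans (archi_boundP (normr_ge0 _)))//.
by rewrite -natrX ler_nat; exact: ltnW (ltn_expl _ _).
Qed.

(** [good] asks that a quarter keep at least a fourth of the circulation. The last quarter is taken
    untested: if the other three fail, the triangle inequality makes it pass. *)
Definition quarter U W (q : R * R * R) :=
  let: (a, c, l) := q in let h := l / 2 in
  let good x y := `|circulation U W a c l| <= 4 * `|circulation U W x y h| in
  if good a c then (a, c, h) else if good (a + h) c then (a + h, c, h)
  else if good a (c + h) then (a, c + h, h) else (a + h, c + h, h).

Definition subsquare (q q' : R * R * R) :=
  [/\ q.1.1 <= q'.1.1, q'.1.1 + q'.2 <= q.1.1 + q.2,
      q.1.2 <= q'.1.2 & q'.1.2 + q'.2 <= q.1.2 + q.2].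

Lemma subsquare_trans q1 q2 q3 : subsquare q1 q2 -> subsquare q2 q3 ->
  subsquare q1 q3.
Proof.
move: q1 q2 q3 => [[? ?] ?] [[? ?] ?] [[? ?] ?] [/= ? ? ? ?] [/= ? ? ? ?].
by split => /=; lra.
Qed.

Lemma quarterP U W a c l (q := quarter U W (a, c, l)) :
  0 <= l -> closed_form_on U W a c l ->
  [/\ subsquare (a, c, l) q, q.2 = l / 2 &
    `|circulation U W a c l| <= 4 * `|circulation U W q.1.1 q.1.2 q.2|].
Proof.
move=> l0 cUW; rewrite {}/q /quarter; set h := l / 2.
have h0 : 0 <= h by rewrite divr_ge0.
have lh : l = h + h by rewrite /h; lra.
have [?|/negbTE H1] := boolP (`|_| <= 4 * `|circulation U W a c h|).
  by split=> //; split => /=; lra.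
have [?|/negbTE H2] := boolP (`|_| <= 4 * `|circulation U W (a + h) c h|).
  by split=> //; split => /=; lra.
have [?|/negbTE H3] := boolP (`|_| <= 4 * `|circulation U W a (c + h) h|).
  by split=> //; split => /=; lra.
split=> //=; first by split => /=; lra.
have := circulation4 h0; rewrite -lh => /(_ _ _ _ _ cUW) E.
have : `|circulation U W a c l| <=
    `|circulation U W a c h| + `|circulation U W (a + h) c h| +
    (`|circulation U W a (c + h) h| + `|circulation U W (a + h) (c + h) h|).
  rewrite E (le_trans (ler_normD _ _))// lerD//; exact: ler_normD.
by move: H1 H2 H3 => /negbT + /negbT + /negbT; rewrite -!ltNge; lra.
Qed.

Theorem goursat U W a c l : 0 <= l -> closed_form_on U W a c l ->
  circulation U W a c l = 0.
Proof.
move=> l0 cUW; apply/eqP; rewrite -normr_eq0 eq_le normr_ge0 andbT leNgt.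
apply/negP; set C := `|circulation U W a c l| => C0.
pose q n := iter n (quarter U W) (a, c, l).
have qP n : [/\ subsquare (a, c, l) (q n), subsquare (q n) (q n.+1),
    (q n).2 = l / 2 ^+ n &
    C <= 4 ^+ n * `|circulation U W (q n).1.1 (q n).1.2 (q n).2|].
  have qS m : subsquare (a, c, l) (q m) -> (q m).2 = l / 2 ^+ m ->
      [/\ subsquare (q m) (q m.+1), (q m.+1).2 = (q m).2 / 2 &
       `|circulation U W (q m).1.1 (q m).1.2 (q m).2| <=
         4 * `|circulation U W (q m.+1).1.1 (q m.+1).1.2 (q m.+1).2|].
    rewrite -[q m.+1]/(quarter U W (q m)); case: (q m) => [[a' c'] l'].
    move=> [/= ? ? ? ?] El; apply: quarterP.
      by rewrite El divr_ge0// exprn_ge0.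
    exact: closed_form_onS cUW _ _ _ _.
  elim: n => [|n [H1 H2 H3 H4]].
    have H : subsquare (a, c, l) (q 0%N) by split => /=.
    have E : (q 0%N).2 = l / 2 ^+ 0 by rewrite expr0 divr1.
    by have [] := qS _ H E; split => //; rewrite expr0 mul1r.
  have H : subsquare (a, c, l) (q n.+1) := subsquare_trans H1 H2.
  have [_ E1 E2] := qS _ H1 H3.
  have E : (q n.+1).2 = l / 2 ^+ n.+1 by rewrite E1 H3 exprS invfM; ring.
  have [? ? ?] := qS _ H E; split => //.
  by rewrite (le_trans H4)// exprSr -mulrA ler_wpM2l ?exprn_ge0//.
have ln0 n : 0 <= (q n).2 by have [_ _ -> _] := qP n; rewrite divr_ge0 ?exprn_ge0.
have [x0 hx0] : exists x, forall n, (q n).1.1 <= x <= (q n).1.1 + (q n).2.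
  by apply: nested_intervals => n; have [_ []] := qP n => //; have := ln0 n; lra.
have [y0 hy0] : exists x, forall n, (q n).1.2 <= x <= (q n).1.2 + (q n).2.
  by apply: nested_intervals => n; have [_ []] := qP n => //; have := ln0 n; lra.
(* At stage n the circulation is at least C / 4 ^ n by the choice of quarters and at most 8 e (l / 2
   ^ n) ^ 2 by [circulation_small]; this [e] makes 8 e l ^ 2 < C. The added 1 covers l = 0. *)
pose e := C / (8 * l ^+ 2 + 1).
have k0 : 0 < 8 * l ^+ 2 + 1 by rewrite ltr_wpDl// mulr_ge0// exprn_ge0.
have e0 : 0 < e by rewrite divr_gt0.
have [al [be [ga /(_ e e0)[d d0 H]]]] := cUW x0 y0 (hx0 0%N) (hy0 0%N).
have [n nd] := small_dyadic l d0.
have [[/= ? ? ? ?] _ ln Cn] := qP n.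
have ll := ln0 n; rewrite ln in ll.
move: (hx0 n) (hy0 n) Cn; rewrite ln => hx hy Cn.
have cq : closed_form_on U W (q n).1.1 (q n).1.2 (l / 2 ^+ n).
  by apply: closed_form_onS cUW _ _ _ _ => //; rewrite -ln.
have : `|circulation U W (q n).1.1 (q n).1.2 (l / 2 ^+ n)|
    <= 4 * (e * (2 * (l / 2 ^+ n))) * (l / 2 ^+ n).
  apply: (@circulation_small _ _ _ _ _ x0 y0 al be ga) => // x y hx' hy'.
  have xx : `|x - x0| <= l / 2 ^+ n by rewrite ler_norml; lra.
  have yy : `|y - y0| <= l / 2 ^+ n by rewrite ler_norml; lra.
  have [H1 H2] := H x y (le_lt_trans xx nd) (le_lt_trans yy nd).
  split; [apply: le_trans H1 _|apply: le_trans H2 _]; rewrite ler_pM2l//; lra.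
apply/negP; rewrite -ltNge.
rewrite -(@ltr_pM2l _ (4 ^+ n)) ?exprn_gt0// (lt_le_trans _ Cn)//.
have -> : 4 ^+ n * (4 * (e * (2 * (l / 2 ^+ n))) * (l / 2 ^+ n)) = C * (8 * l ^+ 2 / (8 * l ^+ 2 + 1)).
  have -> : 4 ^+ n = (2 ^+ n) ^+ 2 :> R by rewrite -exprM mulnC exprM; congr (_ ^+ n); ring.
  rewrite /e; field; rewrite gt_eqF//=; exact: expf_neq0.
by rewrite gtr_pMr// ltr_pdivrMr// mul1r ltrDl.
Qed.

End goursat.

(** * Complex derivatives *)

Section complex_modulus.
Context {R : realType}.
Local Notation C := (R[i]).
Local Notation N := (@ComplexField.Normc.normc R).
Local Notation Re := (@complex.Re R).
Local Notation Im := (@complex.Im R).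
Implicit Types x y z : C.

Lemma normrcE z : `|z| = (N z)%:C. Proof. by []. Qed.

Lemma N_ge0 z : 0 <= N z. Proof. by rewrite -ler0c -normrcE normr_ge0. Qed.

Lemma N0 : N 0 = 0. Proof. exact: ComplexField.Normc.normc0. Qed.

Lemma N1 : N 1 = 1. Proof. exact: ComplexField.Normc.normc1. Qed.

Lemma N_eq0 z : (N z == 0) = (z == 0).
Proof. by apply/eqP/eqP => [/ComplexField.Normc.eq0_normc//|->]; exact: N0. Qed.

Lemma N_gt0 z : (0 < N z) = (z != 0).
Proof. by rewrite lt_neqAle N_ge0 andbT eq_sym N_eq0. Qed.

Lemma NM x y : N (x * y) = N x * N y.
Proof. exact: ComplexField.Normc.normcM. Qed.

Lemma NV x : N x^-1 = (N x)^-1.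
Proof. exact: ComplexField.Normc.normcV. Qed.

Lemma NX x k : N (x ^+ k) = N x ^+ k.
Proof. by elim: k => [|k IH]; rewrite ?expr0 ?N1// !exprS NM IH. Qed.

Lemma NN x : N (- x) = N x.
Proof. by apply: complexI; rewrite -!normrcE normrN. Qed.

Lemma Ndist x y : N (x - y) = N (y - x).
Proof. by rewrite -opprB NN. Qed.

Lemma ND x y : N (x + y) <= N x + N y.
Proof. by rewrite -lecR rmorphD -!normrcE ler_normD. Qed.

Lemma NB x y : N x - N y <= N (x - y).
Proof. by rewrite lerBlDr -{1}(subrK y x) ND. Qed.

Lemma Nreal (r : R) : N r%:C = `|r|.
Proof. by rewrite /= expr0n/= addr0 sqrtr_sqr. Qed.

Lemma N_sqr z : N z ^+ 2 = Re z ^+ 2 + Im z ^+ 2.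
Proof. by case: z => a b /=; rewrite sqr_sqrtr// addr_ge0 ?sqr_ge0. Qed.

Lemma ReD x y : Re (x + y) = Re x + Re y.
Proof. by case: x y => [? ?] []. Qed.

Lemma Re_le z : `|Re z| <= N z.
Proof.
by rewrite -ler_sqr ?nnegrE ?N_ge0// N_sqr real_normK ?num_real// lerDl sqr_ge0.
Qed.

Lemma Im_le z : `|Im z| <= N z.
Proof.
by rewrite -ler_sqr ?nnegrE ?N_ge0// N_sqr real_normK ?num_real// lerDr sqr_ge0.
Qed.

Lemma N_le z : N z <= `|Re z| + `|Im z|.
Proof.
rewrite -ler_sqr ?nnegrE ?N_ge0 ?addr_ge0// N_sqr sqrrD !real_normK ?num_real//.
by rewrite -addrA lerD2l lerDr mulrn_wge0// mulr_ge0.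
Qed.

Lemma nbhs_NP x (P : set C) :
  nbhs x P <-> exists2 d : R, 0 < d & forall y, N (y - x) < d -> P y.
Proof.
split.
  move=> /nbhs_normP[e /= e0 H]; exists (Re e).
    by move: e0; rewrite ltcE => /andP[].
  move=> y yx; apply: H => /=; rewrite distrC normrcE.
  by rewrite -(RRe_real (gtr0_real e0)) ltcR.
move=> [d d0 H]; apply/nbhs_normP; exists d%:C => /=; first by rewrite ltcR.
by move=> y /=; rewrite distrC normrcE ltcR; exact: H.
Qed.

Lemma continuous_N_lipschitz (g : C -> R) :
  (forall x y, `|g y - g x| <= N (y - x)) -> continuous g.
Proof.
move=> H x; apply/(@cvgrPdist_lt _ _ _ _ (nbhs_filter (x : C))) => e e0; apply/nbhs_NP; exists e => // y yx.
by rewrite distrC (le_lt_trans (H _ _)).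
Qed.

Lemma continuous_N : continuous N.
Proof.
apply: continuous_N_lipschitz => x y.
by rewrite ler_norml NB andbT lerNl opprB Ndist NB.
Qed.

End complex_modulus.

Section complex_derivative.
Context {R : realType}.
Local Notation C := (R[i]).
Local Notation N := (@ComplexField.Normc.normc R).
Local Notation Re := (@complex.Re R).
Local Notation Im := (@complex.Im R).
Implicit Types (f g : C -> C) (x y : C).

Fact cdiff_key : unit. Proof. by []. Qed.

Definition cdiff : (C -> C) -> C -> Prop :=
  locked_with cdiff_key (fun f x => derivable f x 1).

Lemma cdiffE f x : cdiff f x = derivable f x 1.
Proof. by rewrite /cdiff unlock. Qed.

Lemma cdiffP f x : cdiff f x <-> exists A, forall e : R, 0 < e ->
  exists2 d, 0 < d & forall y, N (y - x) < d ->
    N (f y - f x - A * (y - x)) <= e * N (y - x).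
Proof.
rewrite cdiffE; split.
  move=> /cvg_ex[A /cvgrPdist_lt H]; exists A => e e0.
  have /H /nbhs_NP[d d0 K] : 0 < e%:C by rewrite ltcR.
  exists d => // y yx; have [->|yNx] := eqVneq y x.
    by rewrite !subrr mulr0 subrr !N0 mulr0.
  have yx0 : y - x != 0 by rewrite subr_eq0.
  have := K (y - x); rewrite subr0 => /(_ yx yx0).
  rewrite /= normrcE ltcR => /ltW L.
  have E (t u : C) : t != 0 -> u - (A : C) * t = - (t * (A - t^-1 * u)).
    by move=> t0; field.
  rewrite (E _ _ yx0).
  move: L; rewrite (_ : (y - x) *: 1 = y - x); last exact: mulr1.
  rewrite subrK => L.
  by rewrite NN NM mulrC ler_wpM2r// N_ge0.
move=> [A H]; apply/cvg_ex; exists A; apply/cvgrPdist_le => e e0.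
have [d d0 K] : exists2 d, 0 < d & forall y, N (y - x) < d ->
    N (f y - f x - A * (y - x)) <= Re e * N (y - x).
  by apply: H; move: e0; rewrite ltcE => /andP[].
apply/nbhs_NP; exists d => // h; rewrite subr0 => hd h0 /=.
have := K (h + x); rewrite addrK => /(_ hd) L.
rewrite normrcE -(RRe_real (gtr0_real e0)) lecR.
rewrite (_ : h *: 1 = h); last exact: mulr1.
have E (t u : C) : t != 0 -> (A : C) - t^-1 * u = - (t^-1 * (u - A * t)).
  by move=> t0; field.
rewrite [X in N X](E _ _ h0).
rewrite NN NM NV mulrC ler_pdivrMr//.
by rewrite N_gt0.
Qed.

Lemma cdiff_cst (k : C) x : cdiff (fun=> k) x.
Proof. rewrite !cdiffE; exact: derivable_cst. Qed.

Lemma cdiff_id x : cdiff id x.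
Proof. rewrite !cdiffE; exact: derivable_id. Qed.

Lemma cdiffD f g x : cdiff f x -> cdiff g x -> cdiff (fun y => f y + g y) x.
Proof. rewrite !cdiffE; exact: derivableD. Qed.

Lemma cdiffB f g x : cdiff f x -> cdiff g x -> cdiff (fun y => f y - g y) x.
Proof. rewrite !cdiffE; exact: derivableB. Qed.

Lemma cdiffM f g x : cdiff f x -> cdiff g x -> cdiff (fun y => f y * g y) x.
Proof. rewrite !cdiffE; exact: derivableM. Qed.

Lemma cdiffV f x : f x != 0 -> cdiff f x -> cdiff (fun y => (f y)^-1) x.
Proof. rewrite !cdiffE; exact: derivableV. Qed.

Lemma cdiffX f x k : cdiff f x -> cdiff (fun y => f y ^+ k) x.
Proof.
move=> cf; elim: k => [|k IH].
  by under eq_fun do rewrite expr0; exact: cdiff_cst.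
by under eq_fun do rewrite exprS; exact: cdiffM.
Qed.

Lemma cdiff_affine f (a b x : C) : cdiff f (a + b * x) -> cdiff (fun y => f (a + b * y)) x.
Proof.
have [->|b0] := eqVneq b 0.
  by rewrite (_ : (fun _ => _) = fun=> f a) => [_|]; [exact: cdiff_cst|
    apply/funext => y; rewrite mul0r addr0].
have Nb0 : 0 < N b by rewrite N_gt0.
move=> /cdiffP[A H]; apply/cdiffP; exists (A * b) => e e0.
have /H[d d0 K] : 0 < e / N b by rewrite divr_gt0.
exists (d / N b); first by rewrite divr_gt0.
move=> y; rewrite ltr_pdivlMr// => yx.
have := K (a + b * y); rewrite opprD addrACA subrr add0r -mulrBr NM [N b * _]mulrC.
move=> /(_ yx); rewrite !mulrA.
have -> : e / N b * N (y - x) * N b = e * N (y - x) by field; rewrite gt_eqF.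
by [].
Qed.

Lemma cdiff_continuous f x : cdiff f x -> {for x, continuous f}.
Proof.
rewrite cdiffE => /derivable1_diffP; exact: differentiable_continuous.
Qed.

End complex_derivative.

(** * A Cauchy estimate on squares *)

Section cauchy_square.
Context {R : realType}.
Local Notation C := (R[i]).
Local Notation N := (@ComplexField.Normc.normc R).
Local Notation Re := (@complex.Re R).
Local Notation Im := (@complex.Im R).
Implicit Types (f g : C -> C) (c w z : C).

(* The square of the difference quotient times [w - c] is differentiable at the
   pole itself, which avoids removing the singularity. *)
Lemma cdiff_sqr_quotient f c w : cdiff f c -> cdiff f w ->
  cdiff (fun w => (f w - f c) ^+ 2 / (w - c)) w.
Proof.
move=> fc fw; have [->|wc] := eqVneq w c; last first.
  apply: (@cdiffM _ (fun w => (f w - f c) ^+ 2) (fun w => (w - c)^-1)).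
    apply: (@cdiffX _ (fun w => f w - f c)).
    by apply: cdiffB => //; exact: cdiff_cst.
  apply: (@cdiffV _ (fun w => w - c)); first by rewrite subr_eq0.
  by apply: cdiffB; [exact: cdiff_id|exact: cdiff_cst].
move/cdiffP : fc => [B H]; apply/cdiffP; exists (B ^+ 2) => e e0.
have k0 : 0 < 1 + 2 * N B by rewrite ltr_pwDl// mulr_ge0// N_ge0.
have [|d d0 K] := H (Num.min 1 (e / (1 + 2 * N B))).
  by rewrite lt_min ltr01 divr_gt0.
exists d => // y yd; rewrite !subrr expr0n/= mul0r subr0.
have [->|yc] := eqVneq y c; first by rewrite !subrr invr0 !mulr0 subrr N0 mulr0.
have t0 : y - c != 0 by rewrite subr_eq0.
have := K _ yd; set t := y - c in t0 *; set u := f y - f c => L.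
have -> : u ^+ 2 / t - B ^+ 2 * t = (u - B * t) * ((u - B * t) + 2 * B * t) / t.
  by field.
have Nt0 : 0 < N t by rewrite N_gt0.
rewrite !NM NV ler_pdivrMr//.
have L1 : N (u - B * t) <= N t.
  by rewrite (le_trans L)// ler_piMl ?N_ge0// ge_min lexx.
have L2 : N (u - B * t) <= e / (1 + 2 * N B) * N t.
  by rewrite (le_trans L)// ler_wpM2r ?N_ge0// ge_min lexx orbT.
have L3 : N (u - B * t + 2 * B * t) <= (1 + 2 * N B) * N t.
  rewrite (le_trans (ND _ _))// [leRHS]mulrDl mul1r; apply: lerD => //.
  by rewrite !NM (_ : N 2 = 2)// -[2 in LHS](rmorph_nat (real_complex R)) Nreal ger0_norm.
rewrite (le_trans (ler_pM _ _ L2 L3)) ?N_ge0//.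
rewrite le_eqVlt; apply/orP; left; apply/eqP; field.
by rewrite gt_eqF.
Qed.

Lemma cdiff_closed_form p c x0 y0 : cdiff p (c + (x0 +i* y0)) ->
  closed_form_at (fun x y => Im (p (c + (x +i* y))))
    (fun x y => Re (p (c + (x +i* y)))) x0 y0.
Proof.
move=> /cdiffP[A H]; exists (Im A), (Re A), (- Im A) => e e0.
have [d d0 K] := H e e0; exists (d / 2); first by rewrite divr_gt0.
move=> x y hx hy.
have E : c + (x +i* y) - (c + (x0 +i* y0)) = (x - x0) +i* (y - y0).
  by rewrite opprD addrACA subrr add0r.
have Nd := N_le ((x - x0) +i* (y - y0)).
have Kd : N ((x - x0) +i* (y - y0)) < d by rewrite (le_lt_trans Nd)//=; lra.
have := K (c + (x +i* y)); rewrite E => /(_ Kd) L.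
have L1 := le_trans L (ler_wpM2l (ltW e0) Nd).
set P := p (c + (x +i* y)) in L1 *; set P0 := p (c + (x0 +i* y0)) in L1 *.
have -> : Im P - Im P0 - (Im A * (x - x0) + Re A * (y - y0)) =
    Im (P - P0 - A * ((x - x0) +i* (y - y0))).
  by move: P P0 A {H K L L1} => [? ?] [? ?] [? ?] /=; ring.
have -> : Re P - Re P0 - (Re A * (x - x0) + - Im A * (y - y0)) =
    Re (P - P0 - A * ((x - x0) +i* (y - y0))).
  by move: P P0 A {H K L L1} => [? ?] [? ?] [? ?] /=; ring.
by split; [exact: le_trans (Im_le _) L1|exact: le_trans (Re_le _) L1].
Qed.

(** Here G stands for f w / f c and s +i* t for w - c. In the expansion (G ^ 2 - 2 G) / z + 1 / z
    the last term has real part s / (s ^ 2 + t ^ 2) >= 1 / (2 s), as |t| <= s. *)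
Lemma side_bound (G : C) (s t : R) : 0 < s -> `|t| <= s ->
  1 / (4 * s) - 5 * N G ^+ 2 / s <= Re ((G - 1) ^+ 2 / (s +i* t)).
Proof.
move=> s0 ts; set z := s +i* t.
have Nz : s <= N z by rewrite (le_trans _ (Re_le _))//= ler_norm.
have Nz0 : 0 < N z := lt_le_trans s0 Nz.
have Re1 : 1 / (2 * s) <= Re (z^-1).
  have st : 0 < s ^+ 2 + t ^+ 2 by rewrite ltr_wpDr ?sqr_ge0// exprn_gt0.
  rewrite /= ler_pdivrMr ?mulr_gt0// mulrAC ler_pdivlMr// mul1r.
  have : t ^+ 2 <= s ^+ 2 by rewrite -(@real_normK _ t) ?num_real// ler_pXn2r// nnegrE ltW.
  by rewrite expr2; lra.
have -> : (G - 1) ^+ 2 / z = (G ^+ 2 - 2 * G) / z + z^-1.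
  by field; rewrite -N_gt0.
have L : - ((N G ^+ 2 + 2 * N G) / s) <= Re ((G ^+ 2 - 2 * G) / z).
  have := Re_le ((G ^+ 2 - 2 * G) / z); rewrite ler_norml => /andP[+ _].
  apply: le_trans; rewrite lerN2 NM NV.
  rewrite ler_pM ?N_ge0 ?invr_ge0 ?N_ge0//; last first.
    by rewrite lef_pV2 ?posrE.
  rewrite (le_trans (ND _ _))// NX lerD2l NN NM ler_wpM2r ?N_ge0//.
  by rewrite -[2 in leLHS](rmorph_nat (real_complex R)) Nreal ger0_norm.
rewrite ReD.
apply: le_trans (lerD L Re1).
(* The slack is a perfect square because 2 |G| <= 4 |G| ^ 2 + 1 / 4; this is the origin of the
   constant 5 = 1 + 4. *)
rewrite -subr_ge0.
have -> : - ((N G ^+ 2 + 2 * N G) / s) + 1 / (2 * s) - (1 / (4 * s) - 5 * N G ^+ 2 / s)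
  = (4 * N G - 1) ^+ 2 / (4 * s).
  by field; rewrite gt_eqF.
by rewrite divr_ge0 ?sqr_ge0// mulr_ge0// ltW.
Qed.

Lemma continuous_path (g : C -> R) (ga : R -> C) (t0 : R) :
  (forall t, N (ga t - ga t0) <= `|t - t0|) -> {for ga t0, continuous g} ->
  {for t0, continuous (g \o ga)}.
Proof.
move=> ga1 cg; apply: (@continuous_comp _ _ _ ga g) => //.
move=> P /nbhs_NP[d d0 dP]; apply/nbhs_normP; exists d => // t /= td.
by apply: dP; rewrite (le_lt_trans (ga1 t))// distrC.
Qed.

Lemma continuous_N2 f w : {for w, continuous f} ->
  {for w, continuous (fun w => N (f w) ^+ 2)}.
Proof.
move=> cf; have cN : {for w, continuous (N \o f)}.
  by apply: continuous_comp => //; exact: continuous_N.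
have -> : (fun w => N (f w) ^+ 2) = (fun w => (N \o f) w * (N \o f) w).
  by apply/funext => z; rewrite expr2.
exact: continuousM.
Qed.

Definition side_sum f c s t : R :=
  N (f (c + (t -i* s))) ^+ 2 + N (f (c + (t +i* s))) ^+ 2 +
  (N (f (c + (s +i* t))) ^+ 2 + N (f (c + ((- s) +i* t))) ^+ 2).

Lemma N_horizontal c (x x' y : R) : N (c + (x +i* y) - (c + (x' +i* y))) = `|x - x'|.
Proof. by rewrite opprD addrACA subrr add0r /= subrr expr0n addr0 sqrtr_sqr. Qed.

Lemma N_vertical c (x y y' : R) : N (c + (x +i* y) - (c + (x +i* y'))) = `|y - y'|.
Proof. by rewrite opprD addrACA subrr add0r /= subrr expr0n add0r sqrtr_sqr. Qed.

Lemma side_continuous f c s t : - s <= t <= s ->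
  (forall x y, - s <= x <= s -> - s <= y <= s -> {for c + (x +i* y), continuous f}) ->
  [/\ {for t, continuous (fun t => N (f (c + (t -i* s))) ^+ 2)},
      {for t, continuous (fun t => N (f (c + (t +i* s))) ^+ 2)},
      {for t, continuous (fun t => N (f (c + (s +i* t))) ^+ 2)} &
      {for t, continuous (fun t => N (f (c + ((- s) +i* t))) ^+ 2)}].
Proof.
move=> ts H.
have h1 : - s <= s <= s by lra.
have h2 : - s <= - s <= s by lra.
have K (ga : R -> C) : {for ga t, continuous f} -> (forall u, N (ga u - ga t) <= `|u - t|) ->
    {for t, continuous (fun t => N (f (ga t)) ^+ 2)}.
  by move=> cf g1; apply: (@continuous_path (fun w => N (f w) ^+ 2) ga) => //;
    exact: continuous_N2.
split.
- by apply: (K (fun t => c + (t -i* s)) (H _ _ ts h2)) => u; rewrite N_horizontal.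
- by apply: (K (fun t => c + (t +i* s)) (H _ _ ts h1)) => u; rewrite N_horizontal.
- by apply: (K (fun t => c + (s +i* t)) (H _ _ h1 ts)) => u; rewrite N_vertical.
- by apply: (K (fun t => c + ((- s) +i* t)) (H _ _ h2 ts)) => u; rewrite N_vertical.
Qed.

Lemma side_sum_continuous f c s :
  (forall x y, - s <= x <= s -> - s <= y <= s -> {for c + (x +i* y), continuous f}) ->
  {in `[- s, s], continuous (side_sum f c s)}.
Proof.
move=> H t; rewrite in_itv/= => ts; have [c1 c2 c3 c4] := side_continuous ts H.
exact: (continuousD (continuousD c1 c2) (continuousD c3 c4)).
Qed.

(* The integrand [(f w - f c) ^+ 2 / (w - c)] has circulation 0 along the square; for
   [f c = 1] the term [1 / (w - c)] of its expansion contributes at least [1 / (2 s)] to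
   the imaginary part on each side, and AM-GM absorbs the cross term. *)
Theorem cauchy_square f c s : 0 < s ->
  (forall x y, - s <= x <= s -> - s <= y <= s -> cdiff f (c + (x +i* y))) ->
  N (f c) ^+ 2 * s <= 5 / 2 * cint (- s) s (side_sum f c s).
Proof.
move=> s0 H.
have h1 : - s <= s <= s by lra.
have h2 : - s <= - s <= s by lra.
have h0 : - s <= 0 <= s by lra.
have ck (k : R) : {in `[- s, s], continuous (fun=> k)}.
  by move=> x _; exact: cst_continuous.
have cS : {in `[- s, s], continuous (side_sum f c s)}.
  by apply: side_sum_continuous => x y hx hy; apply/cdiff_continuous/H.
have [fc0|fc0] := eqVneq (f c) 0.
  rewrite fc0 N0 expr0n mul0r mulr_ge0 ?divr_ge0//; apply: Rintegral_ge0 => t _.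
  by rewrite !addr_ge0 ?sqr_ge0.
pose F w := f w / f c.
have F1 : F c = 1 by rewrite /F divff.
have HF x y : - s <= x <= s -> - s <= y <= s -> cdiff F (c + (x +i* y)).
  by move=> hx hy; apply: cdiffM; [exact: H|exact: cdiff_cst].
pose p w := (F w - F c) ^+ 2 / (w - c).
have Hp x y : - s <= x <= s -> - s <= y <= s -> cdiff p (c + (x +i* y)).
  move=> hx hy; apply: cdiff_sqr_quotient; last exact: HF.
  by have := HF 0 0 h0 h0; rewrite (_ : 0 +i* 0 = 0)// addr0.
have ss : - s + (s + s) = s by ring.
have cl : closed_form_on (fun x y => Im (p (c + (x +i* y))))
    (fun x y => Re (p (c + (x +i* y)))) (- s) (- s) (s + s).
  by move=> x y; rewrite ss => hx hy; apply/cdiff_closed_form/Hp.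
have cU y : - s <= y <= s ->
    {in `[- s, s], continuous (fun x => Im (p (c + (x +i* y))))}.
  by move=> hy; have := cfU cl; rewrite ss; exact.
have cW x : - s <= x <= s ->
    {in `[- s, s], continuous (fun y => Re (p (c + (x +i* y))))}.
  by move=> hx; have := cfW cl; rewrite ss; exact.
have cU' : {in `[- s, s], continuous (fun x => Im (p (c + (x -i* s))) -
    Im (p (c + (x +i* s))))} by apply: continuousB_in; exact: cU.
have cW' : {in `[- s, s], continuous (fun y => Re (p (c + (s +i* y))) -
    Re (p (c + ((- s) +i* y))))} by apply: continuousB_in; exact: cW.
have ss0 : 0 <= s + s by lra.
have := goursat ss0 cl; rewrite /circulation ss -cintD// => E.
(* The four bounds of [side_bound] add up to 1 / s - k * side_sum, whose integral is therefore at
   most the circulation, that is 0. *)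
pose k := 5 / s / N (f c) ^+ 2.
have : cint (- s) s (fun t => 1 / s - k * side_sum f c s t) <= 0.
  rewrite -[leRHS]E; apply: le_cint.
  - apply: continuousB_in => // x hx.
    by apply: (@continuousM _ _ (fun=> k)); [exact: cst_continuous|exact: cS].
  - by move=> x hx; exact: (continuousD (cU' x hx) (cW' x hx)).
  move=> t ts.
  have ts' : `|t| <= s by rewrite ler_norml.
  have tsN : `|- t| <= s by rewrite normrN.
  have NFf w : N (F w) ^+ 2 = N (f w) ^+ 2 / N (f c) ^+ 2.
    by rewrite NM NV exprMn exprVn.
  have pE z : p (c + z) = (F (c + z) - 1) ^+ 2 / z by rewrite /p F1 [c + z - c]addrC addKr.
  (* Multiplication by a power of i carries each side of the square to the right-hand one, with
     parameter t or - t, so that [side_bound] serves all four. *)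
  have e1 (Z : C) : Im (Z / (t -i* s)) = Re (Z / (s +i* t)).
    case: Z => a b /=; rewrite sqrrN [s ^+ 2 + _]addrC. ring.
  have e2 (Z : C) : - Im (Z / (t +i* s)) = Re (Z / (s +i* (- t))).
    case: Z => a b /=; rewrite sqrrN [s ^+ 2 + _]addrC. ring.
  have e3 (Z : C) : - Re (Z / ((- s) +i* t)) = Re (Z / (s +i* (- t))).
    case: Z => a b /=; rewrite !sqrrN. ring.
  rewrite !pE e1 e2 e3.
  have := side_bound (F (c + (t -i* s))) s0 ts'.
  have := side_bound (F (c + (t +i* s))) s0 tsN.
  have := side_bound (F (c + ((- s) +i* t))) s0 tsN.
  have := side_bound (F (c + (s +i* t))) s0 ts'.
  rewrite !NFf /side_sum /k => b4 b3 b2 b1.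
  apply: le_trans (lerD (lerD b1 b2) (lerD b4 b3)).
  rewrite le_eqVlt; apply/orP; left; apply/eqP.
  have Nfc : N (f c) != 0 by rewrite N_eq0.
  by field; rewrite gt_eqF.
have cst : {in `[- s, s], continuous (fun=> 1 / s)} by exact: ck.
rewrite cintB//; last first.
  by move=> x hx; apply: (@continuousM _ _ (fun=> k)); [exact: cst_continuous|exact: cS].
rewrite cint_cst ?cintZ//; last lra.
rewrite subr_le0 (_ : 1 / s * _ = 2); last by field; rewrite gt_eqF.
have Nfc : 0 < N (f c) by rewrite N_gt0.
rewrite /k -[5 / s / _]mulrA -invfM mulrAC ler_pdivlMr ?mulr_gt0//.
lra.
Qed.

End cauchy_square.

(** * The maximum principle *)

Section maximum_principle.
Context {R : realType}.
Local Notation C := (R[i]).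
Local Notation N := (@ComplexField.Normc.normc R).
Local Notation Re := (@complex.Re R).
Local Notation Im := (@complex.Im R).
Implicit Types (f g : C -> C) (E : C -> R) (c w z : C).

(** By Bernoulli's inequality (a / b) ^ k outgrows every K when a > b > 0. This is the device that
    removes multiplicative constants. *)
Lemma le_of_exp_bound (a b K : R) : 0 <= b ->
  (forall k, a ^+ k <= K * b ^+ k) -> a <= b.
Proof.
move=> b0 H; rewrite leNgt; apply/negP => ba.
have [b00|bn0] := eqVneq b 0.
  by have := H 1%N; rewrite b00 !expr1 mulr0 leNgt -{1}b00 ba.
have {bn0}b0 : 0 < b by rewrite lt_neqAle eq_sym bn0.
pose q := a / b - 1.
have q0 : 0 < q by rewrite subr_gt0 ltr_pdivlMr// mul1r.
have B k : 1 + k%:R * q <= (a / b) ^+ k.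
  elim: k => [|k IH]; first by rewrite mul0r addr0 expr0.
  have -> : a / b = 1 + q by rewrite /q; ring.
  have -> : 1 + q = a / b by rewrite /q; ring.
  rewrite exprS; apply: le_trans (_ : a / b * (1 + k%:R * q) <= _).
    rewrite (_ : a / b = 1 + q); last by rewrite /q; ring.
    rewrite -natr1 -subr_ge0.
    have -> : (1 + q) * (1 + k%:R * q) - (1 + (k%:R + 1) * q) = k%:R * q ^+ 2 by ring.
    by rewrite mulr_ge0// sqr_ge0.
  by rewrite ler_pM2l// divr_gt0// (lt_trans b0).
have := archi_boundP (normr_ge0 (K / q)); set k := Num.bound _ => Kk.
have := le_trans (B k); rewrite expr_div_n => /(_ K).
rewrite ler_pdivrMr ?exprn_gt0// => /(_ (H k)).
apply/negP; rewrite -ltNge -ltrBlDl (@lt_trans _ _ K)//; first lra.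
by rewrite -ltr_pdivrMr// (le_lt_trans (ler_norm _)).
Qed.

(** Applied to f ^ k, [cauchy_square] gives the inequality up to a factor independent of k, which
    [le_of_exp_bound] removes. The 20 is 5 / 2 * 4 * 2: four sides, integrated over an interval of
    length 2 s. *)
Lemma square_max f c s M : 0 < s ->
  (forall x y, - s <= x <= s -> - s <= y <= s -> cdiff f (c + (x +i* y))) ->
  (forall x y, - s <= x <= s -> - s <= y <= s -> `|x| = s \/ `|y| = s ->
    N (f (c + (x +i* y))) <= M) -> N (f c) <= M.
Proof.
move=> s0 cf HM.
have h1 : - s <= s <= s by lra.
have h2 : - s <= - s <= s by lra.
have as1 : `|s| = s by rewrite ger0_norm// ltW.
have as2 : `|- s| = s by rewrite normrN.
have M0 : 0 <= M by rewrite (le_trans (N_ge0 _) (HM s s h1 h1 _))//; left.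
rewrite -(@ler_pXn2r _ 2) ?nnegrE ?N_ge0//.
apply: (@le_of_exp_bound _ _ 20); first by rewrite sqr_ge0.
move=> k; pose g w := f w ^+ k.
have cg x y : - s <= x <= s -> - s <= y <= s -> cdiff g (c + (x +i* y)).
  by move=> hx hy; apply: cdiffX; exact: cf.
have := cauchy_square s0 cg.
have B x y : - s <= x <= s -> - s <= y <= s -> `|x| = s \/ `|y| = s ->
    N (g (c + (x +i* y))) ^+ 2 <= (M ^+ 2) ^+ k.
  move=> hx hy hxy; rewrite NX exprAC; apply: lerXn2r; rewrite ?nnegrE ?sqr_ge0//.
  by apply: lerXn2r; rewrite ?nnegrE ?N_ge0//; exact: HM.
have : cint (- s) s (side_sum g c s) <= cint (- s) s (fun=> 4 * (M ^+ 2) ^+ k).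
  apply: le_cint.
  - by apply: side_sum_continuous => // x y hx hy; apply: cdiff_continuous; exact: cg.
  - by move=> x _; exact: cst_continuous.
  move=> t ht; rewrite /side_sum.
  have b1 := B t (- s) ht h2 (or_intror as2).
  have b2 := B t s ht h1 (or_intror as1).
  have b3 := B s t h1 ht (or_introl as1).
  have b4 := B (- s) t h2 ht (or_introl as2).
  by apply: le_trans (lerD (lerD b1 b2) (lerD b3 b4)) _; lra.
rewrite cint_cst; last lra.
move=> I1 I2; rewrite -(@ler_pM2r _ s)// exprAC -NX.
by apply: le_trans I2 _; lra.
Qed.

Lemma continuous_exprn (T : topologicalType) (g : T -> R) x k :
  {for x, continuous g} -> {for x, continuous (fun y => g y ^+ k)}.
Proof.
move=> cg; elim: k => [|k IH]; first exact: cst_continuous.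
rewrite (_ : (fun _ => _) = (fun y => g y * g y ^+ k)); last first.
  by apply/funext => y; rewrite exprS.
exact: (continuousM cg IH).
Qed.

(* At [x], [E] is touched from below by the modulus of a holomorphic function.
   This passes at once to products, rotations and maxima, and it suffices for the
   maximum principle. *)
Definition hol_supported E x := exists f d, [/\ 0 < d, N (f x) = E x &
  forall y, N (y - x) < d -> cdiff f y /\ N (f y) <= E y].

Lemma compact_disc c r : compact [set z | N (z - c) <= r].
Proof.
pose sq : set (R * R) := `[- r, r] `*` `[- r, r].
have csq : compact sq by apply: compact_setX; exact: segment_compact.
pose h (p : R * R) : C := c + (p.1 +i* p.2).
have ch : continuous h.
  move=> p P /nbhs_NP[d d0 dP].
  have d2 : 0 < d / 2 by rewrite divr_gt0.
  apply/nbhs_ballP; exists (d / 2) => // q [/= q1 q2]; apply: dP.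
  rewrite /h opprD addrACA subrr add0r (le_lt_trans (N_le _))//=.
  by rewrite [d](splitr d) ltrD// distrC.
apply: (subclosed_compact _ (continuous_compact (continuous_subspaceT ch) csq)).
  apply: (@closed_comp _ _ (fun z => N (z - c)) [set x : R | x <= r]).
    move=> z _; apply: (@continuous_comp _ _ _ (fun z => z - c) N).
      by move=> P /nbhs_NP[d d0 dP]; apply/nbhs_NP; exists d => // y yz;
        apply: dP; rewrite opprD addrACA opprK addrA addrNK.
    exact: continuous_N.
  exact: closed_le.
move=> z /= zr; exists (Re (z - c), Im (z - c)).
  have := le_trans (Re_le _) zr; have := le_trans (Im_le _) zr.
  by rewrite !ler_norml => ? ?; split => /=; rewrite in_itv.
by rewrite /h /=; case: (z) (c) => [? ?] [? ?] /=; congr (_ +i* _); ring.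
Qed.

(* Lagrange's identity for the vectors (1, a) and (1, x). *)
Lemma cauchy_schwarz_1 (a x : C) :
  N (1 + a^* * x) ^+ 2 + N (x - a) ^+ 2 = (1 + N a ^+ 2) * (1 + N x ^+ 2).
Proof. by rewrite !N_sqr; case: a x => [a1 a2] [x1 x2] /=; ring. Qed.

Lemma square_in_disc y (x1 x2 s d : R) : 2 * s < d -> - s <= x1 <= s -> - s <= x2 <= s ->
  N (y + (x1 +i* x2) - y) < d.
Proof.
move=> sd h1 h2; rewrite addrC addKr (le_lt_trans (N_le _))//=.
apply: le_lt_trans sd; rewrite mulr_natl mulr2n lerD// ler_norml//.
Qed.

(** A perturbation is required, since E may be constant. Were E c ^ k > (1 + r ^ 2) * E x0 ^ k for
    the maximum point x0 on the circle, W z = E z ^ k * (1 + |z - c| ^ 2) would attain its maximum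
    over the disc at an interior point y. A holomorphic function whose modulus touches a multiple of
    W from below at y, and is strictly smaller on a square around y, then contradicts [square_max].
    The powers remove the factor 1 + r ^ 2. *)
Lemma hol_supported_max E c r : 0 <= r ->
  (forall x, N (x - c) <= r -> {for x, continuous E} /\ hol_supported E x) ->
  exists2 x, N (x - c) = r & E c <= E x.
Proof.
move=> r0 HE.
have E0 x : N (x - c) <= r -> 0 <= E x.
  by move=> /HE[_ [f [d [_ <- _]]]]; exact: N_ge0.
pose D := [set z | N (z - c) <= r]; pose S := [set z | N (z - c) = r].
have cD : compact D := @compact_disc c r.
have cN (z : C) : {for z, continuous (fun z => N (z - c))}.
  apply: (@continuous_comp _ _ _ (fun z => z - c) N); last exact: continuous_N.
  move=> P /nbhs_NP[d d0 dP]; apply/nbhs_NP; exists d => // y yz.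
  by apply: dP; rewrite opprD addrACA opprK addrA addrNK.
have cS : compact S.
  apply: (subclosed_compact _ cD); last by move=> z /= zr; rewrite /D /= zr.
  apply: (@closed_comp _ _ (fun z => N (z - c)) [set x : R | x = r]).
    by move=> z _; exact: cN.
  exact: closed_eq.
have cED : {within D, continuous E}.
  by apply: continuous_in_subspaceT => z; rewrite inE => /HE[].
have cES : {within S, continuous E}.
  apply: continuous_in_subspaceT => z; rewrite inE => zS.
  by have [] : {for z, continuous E} /\ hol_supported E z by apply: HE; rewrite zS.
have S0 : S !=set0.
  by exists (c + r%:C); rewrite /S /= addrC addKr Nreal ger0_norm.
have [x0 + x0max] := compact_EVT_max S0 cS cES; rewrite inE => Sx0.
exists x0 => //; apply: (@le_of_exp_bound _ _ (1 + r ^+ 2)).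
  by apply: E0; rewrite Sx0.
move=> k; rewrite leNgt; apply/negP => Ek.
pose W z := E z ^+ k * (1 + N (z - c) ^+ 2).
have cW : {within D, continuous W}.
  apply: continuous_in_subspaceT => z; rewrite inE => /HE[cE _].
  apply: (@continuousM _ _ (fun z => E z ^+ k)); first exact: continuous_exprn.
  apply: (@continuousD _ _ _ (fun=> 1 : R) (fun z => N (z - c) ^+ 2)).
    exact: cst_continuous.
  by apply: continuous_exprn; exact: cN.
have Dc : D c by rewrite /D /= subrr N0.
have [y + ymax] := compact_EVT_max (ex_intro _ c Dc) cD cW; rewrite inE => Dy.
have Wc : E c ^+ k <= W y.
  have := ymax c; rewrite inE => /(_ Dc).
  by rewrite {1}/W subrr N0 expr0n addr0 mulr1.
have Wy0 : 0 < W y.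
  apply: lt_le_trans Wc; apply: le_lt_trans Ek.
  by rewrite mulr_ge0 ?addr_ge0 ?sqr_ge0 ?exprn_ge0// E0// Sx0.
have yr : N (y - c) < r.
  rewrite lt_neqAle Dy andbT; apply/eqP => yr.
  have : W y < E c ^+ k.
    apply: le_lt_trans Ek; rewrite /W yr mulrC ler_wpM2l ?addr_ge0 ?sqr_ge0//.
    rewrite lerXn2r ?nnegrE ?E0// ?Sx0//.
    by apply: x0max; rewrite inE.
  by apply/negP; rewrite -leNgt.
have [_ [f [d [d0 fy Hf]]]] := HE y Dy.
(* The square of half-side [s] around y stays inside the domain of the support f and inside the
   disc. *)
pose s := Num.min 1 (Num.min d (r - N (y - c)) / 4).
have s0 : 0 < s by rewrite !lt_min ltr01 divr_gt0// lt_min d0 subr_gt0.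
have sd : 2 * s < Num.min d (r - N (y - c)).
  have m0 : 0 < Num.min d (r - N (y - c)) by rewrite lt_min d0 subr_gt0.
  have : s <= Num.min d (r - N (y - c)) / 4 by rewrite /s ge_min lexx orbT.
  by lra.
have {}sd x1 x2 : - s <= x1 <= s -> - s <= x2 <= s ->
    N (y + (x1 +i* x2) - y) < d /\ N (y + (x1 +i* x2) - c) <= r.
  move=> h1 h2; have := square_in_disc y sd h1 h2; rewrite lt_min => /andP[-> L].
  split=> //; rewrite (_ : _ - c = (y + (x1 +i* x2) - y) + (y - c)); last by ring.
  by rewrite (le_trans (ND _ _))//; lra.
pose a := y - c.
(* By [cauchy_schwarz_1], |1 + a^* (z - c)| ^ 2 equals (1 + |a| ^ 2) (1 + |z - c| ^ 2) - |z - y| ^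
   2. So |g| <= (1 + |a| ^ 2) W, with equality at y and a definite loss at distance at least s from
   y. *)
pose g z := f z ^+ k * (1 + a^* * (z - c)) ^+ 2.
have gy : N (g y) = W y * (1 + N a ^+ 2).
  rewrite NM !NX fy /W -mulrA -expr2; congr (_ * _).
  have := cauchy_schwarz_1 a a; rewrite subrr N0 expr0n addr0 => ->.
  by rewrite expr2.
have a1 : 1 <= 1 + N a ^+ 2 by rewrite lerDl sqr_ge0.
have r1 : 0 < 1 + r ^+ 2 by rewrite ltr_pwDl// sqr_ge0.
have : N (g y) <= W y * (1 + N a ^+ 2 - s ^+ 2 / (1 + r ^+ 2)).
  apply: (@square_max _ _ s) => //.
    move=> x1 x2 h1 h2; have [h3 _] := sd _ _ h1 h2; have [cf _] := Hf _ h3.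
    apply: (@cdiffM _ (fun z => f z ^+ k)); first exact: cdiffX.
    apply: (@cdiffX _ (fun z => 1 + a^* * (z - c))).
    apply: cdiffD; first exact: cdiff_cst.
    apply: cdiffM; first exact: cdiff_cst.
    by apply: cdiffB; [exact: cdiff_id|exact: cdiff_cst].
  move=> x1 x2 h1 h2 h12; have [h3 h4] := sd _ _ h1 h2; have [_ fE] := Hf _ h3.
  set z := y + _ in h3 h4 fE *.
  have X1 : 1 <= 1 + N (z - c) ^+ 2 by rewrite lerDl sqr_ge0.
  have Xr : 1 + N (z - c) ^+ 2 <= 1 + r ^+ 2.
    by rewrite lerD2l lerXn2r// ?nnegrE ?N_ge0.
  have sz : s <= N (z - c - a).
    rewrite (_ : z - c - a = x1 +i* x2); last by rewrite /z /a; ring.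
    by case: h12 => <-; [exact: (Re_le (x1 +i* x2))|exact: (Im_le (x1 +i* x2))].
  rewrite NM !NX.
  have -> : N (1 + a^* * (z - c)) ^+ 2 =
      (1 + N (z - c) ^+ 2) * ((1 + N a ^+ 2) - N (z - c - a) ^+ 2 / (1 + N (z - c) ^+ 2)).
    have := cauchy_schwarz_1 a (z - c); set X := 1 + N (z - c) ^+ 2.
    move=> /(canRL (addrK _)) ->; field; rewrite gt_eqF//.
    by apply: lt_le_trans X1.
  rewrite mulrA; apply: ler_pM.
  - by rewrite mulr_ge0 ?addr_ge0 ?sqr_ge0// exprn_ge0// N_ge0.
  - rewrite subr_ge0 ler_pdivrMr; last by apply: lt_le_trans X1.
    by rewrite -cauchy_schwarz_1 lerDr sqr_ge0.
  - apply: le_trans (_ : W z <= _); last by apply: ymax; rewrite inE.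
    rewrite /W ler_wpM2r ?(le_trans ler01)// lerXn2r ?nnegrE ?N_ge0//.
    exact: E0.
  rewrite lerD2l lerN2; apply: ler_pM; rewrite ?sqr_ge0 ?invr_ge0 ?(ltW r1)//.
    by rewrite lerXn2r ?nnegrE ?N_ge0// ltW.
  by rewrite lef_pV2 ?posrE// (lt_le_trans ltr01 X1).
apply/negP; rewrite -ltNge gy ltr_pM2l// gtrBl divr_gt0// exprn_gt0//.
Qed.

End maximum_principle.

(** * The submean inequality *)

Section riemann_sum.
Context {R : realType}.
Implicit Types (f : R -> R) (a b : R).

Lemma uniform_continuity f a b e : {in `[a, b], continuous f} -> 0 < e ->
  exists2 d, 0 < d & forall x y, a <= x <= b -> `|y - x| < d -> `|f y - f x| <= e.
Proof.
move=> cf e0.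
have := @segment_compact R a b => /compact_near_coveringP H.
have {H} := H R (0^'+) (fun d x => forall y, `|y - x| < d -> `|f y - f x| <= e) _.
case.
  move=> x /= xab.
  have e2 : 0 < e / 2 by rewrite divr_gt0.
  have /cvgrPdist_lt/(_ _ e2) := cf x xab.
  move=> /nbhs_normP[d /= d0 dP].
  exists ([set x' | `|x' - x| < d / 2], [set i | i < d / 2]) => /=.
    split; first by apply: near_dist; rewrite divr_gt0.
    by apply: nbhs_right_lt; rewrite divr_gt0.
  move=> [x' i] [/= hx' hi] y hy.
  have k1 : `|f x - f x'| < e / 2.
    by apply: dP => /=; rewrite distrC (lt_trans hx')//; lra.
  have k2 : `|f x - f y| < e / 2.
    apply: dP => /=; rewrite distrC.
    rewrite (_ : y - x = (y - x') + (x' - x)); last by ring.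
    by rewrite (le_lt_trans (ler_normD _ _))//; lra.
  rewrite (_ : f y - f x' = (f x - f x') - (f x - f y)); last by ring.
  by rewrite (le_trans (ler_normB _ _))//; lra.
move=> d /= d0 H; exists (d / 2); first by rewrite divr_gt0.
move=> x y xab xy; apply: (H (d / 2)) => //=.
- by rewrite sub0r normrN gtr0_norm ?divr_gt0//; lra.
- by rewrite divr_gt0.
Qed.

Lemma riemann_sum_le f h e (tag : nat -> R) n : 0 <= h ->
  {in `[0, n%:R * h], continuous f} ->
  (forall k x, (k < n)%N -> k%:R * h <= x <= k.+1%:R * h -> f (tag k) <= f x + e) ->
  (\sum_(k < n) f (tag k)) * h <= cint 0 (n%:R * h) f + e * (n%:R * h).
Proof.
move=> h0; elim: n => [|n IH] cf H.
  rewrite big_ord0 !mul0r mulr0 addr0 /cint set_itv1 Rintegral_set1.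
  by [].
have nh : n%:R * h <= n.+1%:R * h by rewrite ler_wpM2r// ler_nat.
have nh0 : 0 <= n%:R * h by rewrite mulr_ge0.
rewrite big_ord_recr/= (cint_split cf nh0 nh).
have cf1 : {in `[n%:R * h, n.+1%:R * h], continuous f} by apply: continuousS_in cf _ _.
have cf0 : {in `[0, n%:R * h], continuous f} by apply: continuousS_in cf _ _.
have {}IH := IH cf0 (fun k x kn => H k x (ltnW kn)).
have ck k : {in `[n%:R * h, n.+1%:R * h], continuous (fun=> k : R)}.
  by move=> x _; exact: cst_continuous.
have : cint (n%:R * h) (n.+1%:R * h) (fun=> f (tag n) - e) <=
       cint (n%:R * h) (n.+1%:R * h) f.
  by apply: le_cint => // x hx; rewrite lerBlDr; exact: H hx.
rewrite cint_cst// -mulrBl -natrB// subSnn mul1r mulrBl => L.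
rewrite mulrDl -natr1 [(n%:R + 1) * h]mulrDl mul1r mulrDr.
move: L IH; rewrite -natr1 mulrDl mul1r.
lra.
Qed.

End riemann_sum.

Section submean.
Context {R : realType}.
Local Notation C := (R[i]).
Local Notation N := (@ComplexField.Normc.normc R).
Local Notation Re := (@complex.Re R).
Local Notation Im := (@complex.Im R).
Implicit Types (v : C -> R) (c w z : C) (r t : R).

Definition expi t : C := cos t +i* sin t.

Lemma expiD t u : expi (t + u) = expi t * expi u.
Proof. by rewrite /expi cosD sinD; apply/eqP; rewrite eq_complex/=; apply/andP; split; apply/eqP; ring. Qed.

Lemma expi0 : expi 0 = 1.
Proof. by rewrite /expi cos0 sin0. Qed.

Lemma expi2pi : expi (2 * pi) = 1.
Proof. by rewrite /expi mulr_natl cos2pi sin2pi. Qed.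

Lemma expiX t k : expi (k%:R * t) = expi t ^+ k.
Proof.
elim: k => [|k IH]; first by rewrite mul0r expi0.
by rewrite -natr1 mulrDl mul1r expiD IH exprSr.
Qed.

Lemma N_expi t : N (expi t) = 1.
Proof. by rewrite /= cos2Dsin2 sqrtr1. Qed.

Lemma expi_surj z : N z = 1 -> exists2 t, 0 <= t <= 2 * pi & z = expi t.
Proof.
move=> z1; have := N_sqr z; rewrite z1 expr1n; case: z {z1} => a b /= ab.
have a1 : -1 <= a <= 1.
  rewrite -ler_norml -(@ler_pXn2r _ 2) ?nnegrE// real_normK ?num_real// expr1n ab.
  by rewrite lerDl sqr_ge0.
have := acosK a1; have := sin_acos a1; have := acos_ge0 a1; have := acos_lepi a1.
have -> : 1 - a ^+ 2 = b ^+ 2 by rewrite ab; ring.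
rewrite sqrtr_sqr; set u := acos a => upi u0 su cu.
have pi0 := pi_gt0 R.
have [b0|b0] := leP 0 b.
  exists u; first by lra.
  by rewrite /expi cu su ger0_norm.
exists (2 * pi - u); first by lra.
rewrite /expi cosB sinB mulr_natl cos2pi sin2pi cu su ltr0_norm//.
by apply/eqP; rewrite eq_complex/=; apply/andP; split; apply/eqP; ring.
Qed.

Definition hol_good E (x : C) := {for x, continuous E} /\ hol_supported E x.

Lemma hol_good_cst (k : R) x : 0 <= k -> hol_good (fun=> k) x.
Proof.
move=> k0; split; first exact: cst_continuous.
exists (fun=> k%:C), 1; split => //; first by rewrite Nreal ger0_norm.
by move=> y _; split; [exact: cdiff_cst|rewrite Nreal ger0_norm].
Qed.

Lemma hol_goodM (E F : C -> R) x : hol_good E x -> hol_good F x ->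
  hol_good (fun z => E z * F z) x.
Proof.
move=> [cE [f [d [d0 fx Hf]]]] [cF [g [d' [d'0 gx Hg]]]].
split; first exact: (continuousM cE cF).
exists (fun z => f z * g z), (Num.min d d'); split.
- by rewrite lt_min d0.
- by rewrite NM fx gx.
move=> y; rewrite lt_min => /andP[/Hf[cf fy] /Hg[cg gy]].
by split; [exact: cdiffM|rewrite NM ler_pM ?N_ge0].
Qed.

Lemma hol_good_prod (F : nat -> C -> R) n x : (forall k, (k < n)%N -> hol_good (F k) x) ->
  hol_good (fun z => \prod_(k < n) F k z) x.
Proof.
elim: n => [|n IH] H.
  rewrite (_ : (fun _ => _) = fun=> 1); first exact: hol_good_cst.
  by apply/funext => z; rewrite big_ord0.
rewrite (_ : (fun _ => _) = fun z => (\prod_(k < n) F k z) * F n z).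
  by apply: hol_goodM; [apply: IH => k kn; exact/H/ltnW|exact: H].
by apply/funext => z; rewrite big_ord_recr.
Qed.

Lemma hol_good_rot E c (om x : C) : N om = 1 -> hol_good E (c + om * (x - c)) ->
  hol_good (fun z => E (c + om * (z - c))) x.
Proof.
move=> om1 [cE [f [d [d0 fx Hf]]]].
have rotE (y y' : C) : N (c + om * (y - c) - (c + om * (y' - c))) = N (y - y').
  rewrite opprD addrACA subrr add0r -mulrBr NM om1 mul1r; congr N; ring.
split.
  apply: (@continuous_comp _ _ _ (fun z => c + om * (z - c)) E) => // P.
  move=> /nbhs_NP[e e0 eP]; apply/nbhs_NP; exists e => // y yx; apply: eP.
  by rewrite rotE.
exists (fun z => f (c + om * (z - c))), d; split => // y yx.
have := Hf (c + om * (y - c)); rewrite rotE => /(_ yx)[cf fy]; split => //.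
have E' z : c + om * (z - c) = (c - om * c) + om * z by ring.
rewrite (_ : (fun _ => _) = fun z => f ((c - om * c) + om * z)).
  by apply: cdiff_affine; rewrite -E'.
by apply/funext => z; rewrite E'.
Qed.

Definition circ c r t : C := c + (r * cos t +i* (r * sin t)).

Lemma circE c r t : circ c r t = c + r%:C * expi t.
Proof. by rewrite /circ /expi; simpc. Qed.

Lemma circ_in c r t : 0 <= r -> N (circ c r t - c) = r.
Proof. by move=> r0; rewrite circE addrC addKr NM N_expi mulr1 Nreal ger0_norm. Qed.

Lemma continuous_circ c r : continuous (circ c r).
Proof.
move=> t P /nbhs_NP[d d0 dP].
pose g (u : R) := `|r| * (`|cos u - cos t| + `|sin u - sin t|).
have cg : {for t, continuous g}.
  apply: (@continuousM _ _ (fun=> `|r|)); first exact: cst_continuous.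
  have k (q : R -> R) : {for t, continuous q} ->
      {for t, continuous (fun u => `|q u - q t|)}.
    move=> cq; apply: (@continuous_comp _ _ _ (fun u => q u - q t) Num.norm).
      by apply: (@continuousB _ _ _ q) => //; exact: cst_continuous.
    exact: norm_continuous.
  by apply: (continuousD (k _ (@continuous_cos R t)) (k _ (@continuous_sin R t))).
have gt0 : g t = 0 by rewrite /g !subrr normr0 addr0 mulr0.
move: cg => /cvgrPdist_lt/(_ _ d0); rewrite gt0; apply: filterS => u.
rewrite sub0r normrN => gd; apply: dP.
rewrite /circ opprD addrACA subrr add0r (le_lt_trans (N_le _))//=.
by rewrite -!mulrBr !normrM -mulrDr (le_lt_trans (ler_norm _)).
Qed.

(* The product of [expR \o v] over its rotations by the powers of a root of unity is
   still supported by holomorphic functions; the maximum principle bounds its value at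
   [c] by a product over an equidistributed subset of the circle, that is, by the
   exponential of a Riemann sum. *)
Theorem submean v c r : 0 <= r ->
  (forall x, N (x - c) <= r -> {for x, continuous v} /\ hol_supported (expR \o v) x) ->
  2 * pi * v c <= cint 0 (2 * pi) (v \o circ c r).
Proof.
move=> r0 H.
have pi0 := pi_gt0 R.
have good x : N (x - c) <= r -> hol_good (expR \o v) x.
  move=> /H[cv hv]; split => //.
  by apply: continuous_comp => //; exact: continuous_expR.
have cphi t : {for t, continuous (v \o circ c r)}.
  apply: continuous_comp; first exact: continuous_circ.
  by apply: (H _ _).1; rewrite circ_in.
apply/ler_addgt0Pr => e' e'0.
have [e e0 ee'] : exists2 e, 0 < e & e * (2 * pi) = e'.
  exists (e' / (2 * pi)); first by rewrite divr_gt0 ?mulr_gt0.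
  by rewrite divfK// gt_eqF// mulr_gt0.
have [d d0 Hd] : exists2 d, 0 < d & forall x y, 0 <= x <= 2 * pi -> `|y - x| < d ->
    `|(v \o circ c r) y - (v \o circ c r) x| <= e.
  by apply: uniform_continuity => // t _; exact: cphi.
pose n := Num.bound `|2 * pi / d|; pose h := 2 * pi / n.+1%:R :> R.
have h0 : 0 < h by rewrite divr_gt0// mulr_gt0.
have hd : h < d.
  rewrite ltr_pdivrMr// [d * _]mulrC -ltr_pdivrMr// (le_lt_trans (ler_norm _))//.
  by rewrite (lt_trans (archi_boundP (normr_ge0 _)))// ltr_nat.
have nh : n.+1%:R * h = 2 * pi by rewrite /h mulrC divfK.
pose om := expi h.
have om1 k : N (om ^+ k) = 1 by rewrite NX N_expi expr1n.
have omn : om ^+ n.+1 = 1 by rewrite -expiX nh expi2pi.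
have [x xr] : exists2 x, N (x - c) = r &
    \prod_(k < n.+1) expR (v (c + om ^+ k * (c - c))) <=
    \prod_(k < n.+1) expR (v (c + om ^+ k * (x - c))).
  apply: (@hol_supported_max _
    (fun z => \prod_(k < n.+1) expR (v (c + om ^+ k * (z - c))))) => // x xr.
  apply: (@hol_good_prod (fun k z => expR (v (c + om ^+ k * (z - c))))) => k _.
  apply: (@hol_good_rot (expR \o v)) => //; apply: good.
  by rewrite addrC addKr NM om1 mul1r.
under eq_bigr do rewrite subrr mulr0 addr0.
rewrite -!expR_sum ler_expR sumr_const card_ord => Hx.
have [th [th0 xE]] : exists th, 0 <= th /\ x = c + r%:C * expi th.
  have [r00|rn0] := eqVneq r 0.
    exists 0; split => //; rewrite r00 mul0r addr0.
    by move: xr; rewrite r00 => /eqP; rewrite N_eq0 subr_eq0 => /eqP.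
  have rC : r%:C != 0 by rewrite -(rmorph0 (real_complex R)) (inj_eq (@complexI R)).
  have [|th /andP[th0 _] E] := @expi_surj (r%:C^-1 * (x - c)).
    by rewrite NM NV xr Nreal ger0_norm// mulVf.
  by exists th; split => //; rewrite -E mulVKf// addrC subrK.
(* With th = j h + th' and 0 <= th' <= h, the rotated copies of x are the points of angle k h + th',
   one for each cell of the subdivision, up to a shift of the indices by j modulo n + 1. *)
pose j := Num.truncn (th / h); pose th' := th - j%:R * h.
have /andP[th'0 th'h] : 0 <= th' <= h.
  have := @truncn_itv R (th / h); rewrite divr_ge0 ?(ltW h0)// => /(_ isT).
  rewrite -/j ler_pdivlMr// ltr_pdivrMr// -natr1 mulrDl mul1r /th'.
  by move=> /andP[? ?]; apply/andP; split; lra.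
have thE : expi th = om ^+ j * expi th'.
  by rewrite -expiX -expiD /th' addrC subrK.
have SE : \sum_(k < n.+1) v (c + om ^+ k * (x - c)) =
    \sum_(k < n.+1) (v \o circ c r) (k%:R * h + th').
  pose G (k : 'I_n.+1) := (v \o circ c r) (k%:R * h + th').
  rewrite -[RHS]/(\sum_(k < n.+1) G k) [RHS](reindex_inj (addIr (inZp j : 'I_n.+1))).
  apply: eq_bigr => k _; rewrite /G /= circE expiD expiX expr_mod//.
  rewrite xE [c + _ - c]addrC addKr thE exprD expr_mod//.
  by congr (v (_ + _)); rewrite -/om; ring.
have := @riemann_sum_le _ (v \o circ c r) h e (fun k => k%:R * h + th') n.+1 (ltW h0).
rewrite nh -SE ee' => L.
have {}L := L (fun t _ => cphi t).
apply: le_trans (L _).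
  rewrite -nh -mulrA mulrC -mulrA mulrC ler_wpM2r ?(ltW h0)//.
  by rewrite mulr_natr.
move=> k t kn /andP[t1 t2].
have : t <= n.+1%:R * h by rewrite (le_trans t2)// ler_pM2r// ler_nat.
rewrite nh => t3.
have k1 : 0 <= t <= 2 * pi by rewrite t3 (le_trans _ t1)// mulr_ge0// ltW.
have k2 : `|k%:R * h + th' - t| < d.
  move: t2; rewrite -natr1 mulrDl mul1r => t2; rewrite ltr_norml.
  by apply/andP; split; lra.
by have := Hd _ _ k1 k2; rewrite ler_norml => /andP[]; lra.
Qed.

End submean.

(** * Square-integrable holomorphic functions *)

Section measure_tools.
Context {R : realType}.
Local Notation mR := (measurableTypeR R).
Local Notation mu := (@lebesgue_measure R).

Lemma floor_itvE (x : R) (m : int) : (Num.floor x == m) = (m%:~R <= x < (m + 1)%:~R).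
Proof.
apply/eqP/idP => [<-|/floor_def//]; exact: floor_itv.
Qed.

(* A function continuous in its first variable and measurable in the second is
   the limit of functions that are locally constant in the first variable. *)
Lemma caratheodory_measurable d (T : measurableType d) (g : mR * T -> R) :
  (forall t x, {for x, continuous (fun x : R => g (x, t))}) ->
  (forall x, measurable_fun setT (fun t => g (x, t))) ->
  measurable_fun setT g.
Proof.
move=> cg mg.
pose phi (k : nat) (x : R) : R := (Num.floor (k.+1%:R * x))%:~R / k.+1%:R.
apply: (@measurable_fun_cvg _ _ _ _ (fun k p => g (phi k p.1, p.2))) => //.
  move=> k _ Y mY; rewrite setTI.
  pose A (m : int) : set mR := `[m%:~R / k.+1%:R, (m + 1)%:~R / k.+1%:R[%classic.
  pose B (m : int) := (fun t => g (m%:~R / k.+1%:R, t)) @^-1` Y.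
  rewrite (_ : _ @^-1` Y = \bigcup_m (A m `*` B m)).
    apply: countable_bigcupT_measurable => // m; apply: measurableX.
      exact: measurable_itv.
    by rewrite /B -[X in measurable X]setTI; exact: mg.
  have AP m x : A m x <-> Num.floor (k.+1%:R * x) = m.
    rewrite /A /= in_itv/= ler_pdivrMr// ltr_pdivlMr// mulrC -floor_itvE.
    by split => /eqP.
  apply/seteqP; split => -[x t] /=.
    move=> gY; exists (Num.floor (k.+1%:R * x)) => //.
    by split => /=; [exact/AP|].
  by move=> [m _ [/= /AP Am]]; rewrite /B /= /phi Am.
move=> [x t] _ /=.
suff phix : phi^~ x @ \oo --> x.
  exact: (@cvg_comp _ _ _ (phi^~ x) (fun x => g (x, t)) _ _ _ phix (cg t x)).
apply/cvgrPdist_lt => e e0; exists (Num.bound e^-1) => // k /= ek.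
have k0 : 0 < k.+1%:R :> R by [].
have : (Num.floor (k.+1%:R * x))%:~R <= k.+1%:R * x < (Num.floor (k.+1%:R * x) + 1)%:~R.
  exact: floor_itv.
rewrite intrD /phi => /andP[h1 h2].
have h3 : 1 < e * k.+1%:R.
  rewrite -ltr_pdivrMl// mulr1.
  apply: lt_le_trans (archi_boundP _) _; first by rewrite invr_ge0 ltW.
  by rewrite ler_nat (leq_trans ek).
set F := (Num.floor _)%:~R in h1 h2 *.
have -> : x - F / k.+1%:R = (k.+1%:R * x - F) / k.+1%:R by field.
rewrite normrM normfV (gtr0_norm k0) ltr_pdivrMr// ltr_norml.
by apply/andP; split; lra.
Qed.

Lemma integral_translation (c : R) (g : mR -> \bar R) :
  measurable_fun [set: mR] g ->
  (forall x, 0 <= g x)%E ->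
  (\int[mu]_s g (c + s)%R = \int[mu]_s g s)%E.
Proof.
move=> mg g0.
have mphi : measurable_fun [set: mR] ((fun s => c + s) : mR -> mR).
  by apply: measurable_funD.
have := ge0_integral_pushforward mphi mu (@measurableT _ mR) mg (fun x _ => g0 x).
rewrite preimage_setT => <-; apply: eq_measure_integral => A mA _.
apply/esym; apply: lebesgue_measure_unique => //= X.
move=> [[a b] _ <-]; rewrite /pushforward /=.
have -> : ((fun s => c + s) @^-1` `]a, b]%classic) = `]a - c, b - c]%classic.
  by apply/seteqP; split => x /=; rewrite !in_itv/=; lra.
by rewrite !lebesgue_measure_itv/= !lte_fin ltrD2r -!EFinD; case: ifP => // _; congr EFin; ring.
Qed.

Lemma integral_reflection (c : R) (g : mR -> \bar R) :
  measurable_fun [set: mR] g ->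
  (forall x, 0 <= g x)%E ->
  (\int[mu]_s g (c - s)%R = \int[mu]_s g s)%E.
Proof.
move=> mg g0.
have mphi : measurable_fun [set: mR] ((fun s => c - s) : mR -> mR).
  by apply: measurable_funB.
have := ge0_integral_pushforward mphi mu (@measurableT _ mR) mg (fun x _ => g0 x).
rewrite preimage_setT => <-; apply: eq_measure_integral => A mA _.
apply/esym; apply: lebesgue_measure_unique => //= X.
move=> [[a b] _ <-]; rewrite /pushforward /=.
have -> : ((fun s => c - s) @^-1` `]a, b]%classic) = `[c - b, c - a[%classic.
  by apply/seteqP; split => x /=; rewrite !in_itv/=; lra.
rewrite !lebesgue_measure_itv/= !lte_fin ltrD2l ltrN2 -!EFinD.
by case: ifP => // _; congr EFin; ring.
Qed.

End measure_tools.

(** * From boundary integrals to area integrals *)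

Section frames.
Context {R : realType}.
Local Notation mR := (measurableTypeR R).
Local Notation mu := (@lebesgue_measure R).
Local Open Scope ereal_scope.

(** The hypothesis bounds from below the integrals along the lines carrying the sides of the square
    of half-side s. When s runs through [rho / 2, rho], each of the four families of lines sweeps at
    most the whole plane once, by Tonelli; whence the 4. *)
Lemma integral_frames (U : mR * mR -> \bar R) (c1 c2 rho a : R) :
  measurable_fun [set: mR * mR] U -> (forall p, 0 <= U p) -> (0 < rho)%R ->
  (forall s : R, (rho / 2 <= s <= rho)%R ->
    a%:E <= (\int[mu]_t U ((c1 + t)%R, (c2 - s)%R) + \int[mu]_t U ((c1 + t)%R, (c2 + s)%R)) +
      (\int[mu]_t U ((c1 + s)%R, (c2 + t)%R) + \int[mu]_t U ((c1 - s)%R, (c2 + t)%R))) ->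
  (a * (rho / 2))%:E <= 4%:E * \int[mu \x mu]_p U p.
Proof.
move=> mU U0 rho0 H.
pose F (x : mR) := \int[mu]_y U (x, y).
pose G (y : mR) := \int[mu]_x U (x, y).
have mF : measurable_fun [set: mR] F := measurable_fun_fubini_tonelli_F U mU U0.
have mG : measurable_fun [set: mR] G := measurable_fun_fubini_tonelli_G U mU U0.
have F0 x : 0 <= F x by apply: integral_ge0.
have G0 x : 0 <= G x by apply: integral_ge0.
have IF : \int[mu]_x F x = \int[mu \x mu]_p U p by rewrite (fubini_tonelli1 U).
have IG : \int[mu]_x G x = \int[mu \x mu]_p U p by rewrite (fubini_tonelli2 U).
have tF x : \int[mu]_t U (x, (c2 + t)%R) = F x.
  rewrite (integral_translation c2 (g := fun y => U (x, y)))//.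
  by apply: measurableT_comp => //; exact: measurable_pair1.
have tG y : \int[mu]_t U ((c1 + t)%R, y) = G y.
  rewrite (integral_translation c1 (g := fun x => U (x, y)))//.
  by apply: measurableT_comp => //; exact: measurable_pair2.
clearbody F G.
have madd (c : R) : measurable_fun [set: mR] ((fun s => c + s)%R : mR -> mR).
  exact: measurable_funD.
have msub (c : R) : measurable_fun [set: mR] ((fun s => c - s)%R : mR -> mR).
  exact: measurable_funB.
pose S (s : mR) := (G (c2 - s)%R + G (c2 + s)%R) + (F (c1 + s)%R + F (c1 - s)%R).
have m1 : measurable_fun [set: mR] (fun s => G (c2 - s)%R) by exact: measurableT_comp (msub c2).
have m2 : measurable_fun [set: mR] (fun s => G (c2 + s)%R) by exact: measurableT_comp (madd c2).
have m3 : measurable_fun [set: mR] (fun s => F (c1 + s)%R) by exact: measurableT_comp (madd c1).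
have m4 : measurable_fun [set: mR] (fun s => F (c1 - s)%R) by exact: measurableT_comp (msub c1).
have mS : measurable_fun [set: mR] S.
  by apply: emeasurable_funD; exact: emeasurable_funD.
have S0 s : 0 <= S s by rewrite /S !adde_ge0.
have -> : 4%:E * \int[mu \x mu]_p U p = \int[mu]_s S s.
  rewrite /S ge0_integralD//; [|by move=> ? _; rewrite adde_ge0|exact: emeasurable_funD
    |by move=> ? _; rewrite adde_ge0|exact: emeasurable_funD].
  rewrite !ge0_integralD//.
  rewrite (integral_reflection c2 mG)// (integral_translation c2 mG)//.
  rewrite (integral_translation c1 mF)// (integral_reflection c1 mF)// IF IG.
  have I0 : 0 <= \int[mu \x mu]_p U p by apply: integral_ge0.
  rewrite (_ : 4%R = (1 + 1 + (1 + 1))%R :> R); last by ring.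
  by rewrite !EFinD !ge0_muleDl ?adde_ge0 ?lee_fin// !mul1e.
apply: (@le_trans _ _ (\int[mu]_(s in `[(rho / 2)%R, rho]) S s)); last first.
  exact: ge0_subset_integral.
apply: (@le_trans _ _ (\int[mu]_(s in `[(rho / 2)%R, rho]) (cst a%:E) s)).
  rewrite integral_cst//= lebesgue_measure_itv/= lte_fin.
  rewrite ifT ?ltr_pdivrMr//; last by lra.
  by rewrite -EFinB -EFinM lee_fin; lra.
have [a0|a0] := leP 0%R a.
  apply: ge0_le_integral => //.
  - exact: measurable_funTS.
  - by move=> s /=; rewrite in_itv/= => /H; rewrite !tF !tG.
apply: (@le_trans _ _ 0); last exact: integral_ge0.
by rewrite integral_cst//= mule_le0_ge0// lee_fin ltW.
Qed.

Lemma cint_le_integral (g : R -> R) (V : mR -> \bar R) (a b : R) :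
  {in `[a, b]%R, continuous g} -> measurable_fun [set: mR] V ->
  (forall t, 0 <= V t) -> (forall t, (0 <= g t)%R) ->
  (forall t : R, (a <= t <= b)%R -> (g t)%:E <= V t) ->
  (cint a b g)%:E <= \int[mu]_t V t.
Proof.
move=> cg mV V0 g0 gV; have ig := cint_integrable cg.
rewrite /cint /Rintegral fineK; last exact: integrable_fin_num.
apply: (@le_trans _ _ (\int[mu]_(t in `[a, b]) V t)); last exact: ge0_subset_integral.
apply: ge0_le_integral => //.
- by move=> t _; rewrite lee_fin.
- exact: (measurable_int mu).
- exact: measurable_funTS.
Qed.

End frames.

Section area_estimate.
Context {R : realType}.
Local Notation C := (R[i]).
Local Notation N := (@ComplexField.Normc.normc R).
Local Notation Re := (@complex.Re R).
Local Notation Im := (@complex.Im R).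
Local Notation mR := (measurableTypeR R).
Local Notation mu := (@lebesgue_measure R).
Implicit Types (f : C -> C) (c w z : C) (rho : R).

(** The values of f are controlled only on a square. Precomposition with the projection onto it
    gives a function on the whole plane that is continuous in each variable, hence measurable by
    [caratheodory_measurable]. *)
Definition clamp (a rho x : R) : R := Num.max (a - rho) (Num.min (a + rho) x).

Lemma clamp_itv a rho x : 0 <= rho -> a - rho <= clamp a rho x <= a + rho.
Proof.
move=> r0; rewrite /clamp le_max lexx/= ge_max ge_min lexx/= andbT.
by rewrite lerD2l (le_trans _ r0)// oppr_le0.
Qed.

Lemma clamp_id a rho x : a - rho <= x <= a + rho -> clamp a rho x = x.
Proof. by move=> /andP[h1 h2]; rewrite /clamp (min_idPr h2) (max_idPr h1). Qed.

Lemma clamp_lip a rho x y : `|clamp a rho x - clamp a rho y| <= `|x - y|.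
Proof.
have lipmax b u v : `|Num.max b u - Num.max b v| <= `|u - v| :> R.
  rewrite !maxElt; have := ler_norm (u - v); have := ler_norm (v - u); rewrite distrC.
  have := normr_ge0 (u - v); set d := `|u - v| => d0 h1 h2.
  by rewrite ler_norml; do ![case: ltP => ?]; apply/andP; split; lra.
have minE b u : Num.min b u = - Num.max (- b) (- u) :> R.
  by rewrite minElt maxElt ltrN2; case: ltgtP => // *; rewrite opprK.
have lipmin b u v : `|Num.min b u - Num.min b v| <= `|u - v| :> R.
  by rewrite !minE -opprD normrN (le_trans (lipmax _ _ _))// -opprD normrN.
exact: le_trans (lipmax _ _ _) (lipmin _ _ _).
Qed.

Definition csquare c rho : set C :=
  [set z | Re c - rho <= Re z <= Re c + rho /\ Im c - rho <= Im z <= Im c + rho].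

Definition clampC c rho (p : mR * mR) : C :=
  clamp (Re c) rho p.1 +i* clamp (Im c) rho p.2.

Definition rsquare c rho : set (mR * mR) :=
  `[Re c - rho, Re c + rho]%classic `*` `[Im c - rho, Im c + rho]%classic.

Lemma clampC_csquare c rho p : 0 <= rho -> csquare c rho (clampC c rho p).
Proof. by move=> r0; split; exact: clamp_itv. Qed.

Lemma clampC_id c rho p : rsquare c rho p -> clampC c rho p = p.1 +i* p.2.
Proof.
by case: p => x y [/=]; rewrite !in_itv/= => h1 h2; rewrite /clampC/= !clamp_id.
Qed.

Lemma measurable_rsquare c rho : measurable (rsquare c rho).
Proof. by apply: measurableX; exact: measurable_itv. Qed.

Lemma clampC_continuous1 f c rho (x y : R) : 0 <= rho ->
  (forall z, csquare c rho z -> {for z, continuous f}) ->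
  {for x, continuous (fun x : R => N (f (clampC c rho (x, y))) ^+ 2)}.
Proof.
move=> r0 cf; apply: (@continuous_path _ (fun z => N (f z) ^+ 2)
    (fun x => clampC c rho (x, y))).
  move=> t; rewrite (le_trans (N_le _))//= subrr normr0 addr0; exact: clamp_lip.
by apply: continuous_N2; apply: cf; exact: clampC_csquare.
Qed.

Lemma clampC_continuous2 f c rho (x y : R) : 0 <= rho ->
  (forall z, csquare c rho z -> {for z, continuous f}) ->
  {for y, continuous (fun y : R => N (f (clampC c rho (x, y))) ^+ 2)}.
Proof.
move=> r0 cf; apply: (@continuous_path _ (fun z => N (f z) ^+ 2)
    (fun y => clampC c rho (x, y))).
  move=> t; rewrite (le_trans (N_le _))//= subrr normr0 add0r; exact: clamp_lip.
by apply: continuous_N2; apply: cf; exact: clampC_csquare.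
Qed.

(** For every s in [rho / 2, rho], [cauchy_square] bounds the frame integral from below by 2 / 5 *
    |f c| ^ 2 * rho / 2. Integration over s yields |f c| ^ 2 * rho ^ 2 / 10, and the 4 of
    [integral_frames] turns 10 into 40. *)
Theorem area_estimate f c rho : 0 < rho ->
  (forall z, csquare c rho z -> cdiff f z) ->
  ((N (f c) ^+ 2 * rho ^+ 2)%:E <= 40%:E *
    \int[mu \x mu]_p (N (f (clampC c rho p)) ^+ 2 * \1_(rsquare c rho) p)%:E)%E.
Proof.
move=> r0 cf; pose g p := N (f (clampC c rho p)) ^+ 2.
have cnf z : csquare c rho z -> {for z, continuous f} by move=> /cf/cdiff_continuous.
have mg : measurable_fun [set: mR * mR] g.
  apply: caratheodory_measurable => [y x|x].
    by apply: clampC_continuous1 => //; exact: ltW.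
  apply: continuous_measurable_fun => y.
  by apply: clampC_continuous2 => //; exact: ltW.
pose U (p : mR * mR) := (g p * \1_(rsquare c rho) p)%:E.
have U0 p : (0 <= U p)%E by rewrite lee_fin mulr_ge0 ?sqr_ge0.
have mU : measurable_fun [set: mR * mR] U.
  apply/measurable_EFinP; apply: measurable_funM => //.
  by apply: measurable_indic; exact: measurable_rsquare.
have := @integral_frames _ U (Re c) (Im c) rho (N (f c) ^+ 2 * (rho / 2) * (2 / 5)) mU U0 r0.
move=> H; have {}H : ((N (f c) ^+ 2 * (rho / 2) * (2 / 5) * (rho / 2))%:E <=
    4%:E * \int[mu \x mu]_p U p)%E.
  apply: H => s /andP[s1 s2].
  have s0 : 0 < s by lra.
  have sq x y : - s <= x <= s -> - s <= y <= s -> csquare c rho (c + (x +i* y)).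
    by case: (c) => a b h1 h2; split => /=; lra.
  have cfs x y : - s <= x <= s -> - s <= y <= s -> cdiff f (c + (x +i* y)).
    by move=> h1 h2; apply: cf; exact: sq.
  have cts x y : - s <= x <= s -> - s <= y <= s -> {for c + (x +i* y), continuous f}.
    by move=> h1 h2; apply: cnf; exact: sq.
  have UE x y : - s <= x <= s -> - s <= y <= s ->
      U (Re c + x, Im c + y) = (N (f (c + (x +i* y))) ^+ 2)%:E.
    move=> h1 h2; rewrite /U /g.
    have rsq : rsquare c rho (Re c + x, Im c + y) by split => /=; rewrite in_itv/=; lra.
    rewrite clampC_id// indicE mem_set// mulr1 /=.
    by congr (N (f _) ^+ 2)%:E; case: (c).
  have h1 : - s <= s <= s by lra.
  have h2 : - s <= - s <= s by lra.
  have k1 : {in `[- s, s], continuous (fun t => N (f (c + (t -i* s))) ^+ 2)}.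
    by move=> t; rewrite in_itv/= => ts; have [] := side_continuous ts cts.
  have k2 : {in `[- s, s], continuous (fun t => N (f (c + (t +i* s))) ^+ 2)}.
    by move=> t; rewrite in_itv/= => ts; have [] := side_continuous ts cts.
  have k3 : {in `[- s, s], continuous (fun t => N (f (c + (s +i* t))) ^+ 2)}.
    by move=> t; rewrite in_itv/= => ts; have [] := side_continuous ts cts.
  have k4 : {in `[- s, s], continuous (fun t => N (f (c + ((- s) +i* t))) ^+ 2)}.
    by move=> t; rewrite in_itv/= => ts; have [] := side_continuous ts cts.
  have := cauchy_square s0 cfs; rewrite /side_sum.
  have k12 : {in `[- s, s], continuous (fun t => N (f (c + (t -i* s))) ^+ 2 +
      N (f (c + (t +i* s))) ^+ 2)}.
    by move=> t ts; exact: (continuousD (k1 t ts) (k2 t ts)).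
  have k34 : {in `[- s, s], continuous (fun t => N (f (c + (s +i* t))) ^+ 2 +
      N (f (c + ((- s) +i* t))) ^+ 2)}.
    by move=> t ts; exact: (continuousD (k3 t ts) (k4 t ts)).
  rewrite (cintD k12 k34) (cintD k1 k2) (cintD k3 k4) => L.
  have add1 (b : R) : measurable_fun [set: mR] ((fun t => b + t) : mR -> mR).
    exact: measurable_funD.
  have mUx (x : R) : measurable_fun [set: mR] (fun t => U (x, Im c + t)).
    by apply: (measurableT_comp mU); apply/measurable_fun_pair => //=; exact: add1.
  have mUy (y : R) : measurable_fun [set: mR] (fun t => U (Re c + t, y)).
    by apply: (measurableT_comp mU); apply/measurable_fun_pair => //=; exact: add1.
  have b1 := @cint_le_integral _ _ (fun t => U (Re c + t, Im c - s)) _ _ k1 (mUy _)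
     (fun=> U0 _) (fun=> sqr_ge0 _).
  have b2 := @cint_le_integral _ _ (fun t => U (Re c + t, Im c + s)) _ _ k2 (mUy _)
     (fun=> U0 _) (fun=> sqr_ge0 _).
  have b3 := @cint_le_integral _ _ (fun t => U (Re c + s, Im c + t)) _ _ k3 (mUx _)
     (fun=> U0 _) (fun=> sqr_ge0 _).
  have b4 := @cint_le_integral _ _ (fun t => U (Re c - s, Im c + t)) _ _ k4 (mUx _)
     (fun=> U0 _) (fun=> sqr_ge0 _).
  apply: le_trans (leeD (leeD (b1 _) (b2 _)) (leeD (b3 _) (b4 _)));
    try by move=> t ts; rewrite UE.
  rewrite -!EFinD lee_fin; apply: le_trans (_ : N (f c) ^+ 2 * s * (2 / 5) <= _).
    by rewrite ler_pM2r// ler_wpM2l ?sqr_ge0.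
  by lra.
have -> : (40%:E = 10%:E * 4%:E :> \bar R)%E by rewrite -EFinM; congr EFin; ring.
rewrite -muleA; apply: le_trans (lee_wpmul2l _ H); last by rewrite lee_fin.
by rewrite -EFinM lee_fin; lra.
Qed.

End area_estimate.

(** * The local L2 estimate in several variables *)

Section polydisc_estimate.
Context {R : realType}.
Local Notation C := (R[i]).
Local Notation N := (@ComplexField.Normc.normc R).
Local Notation Re := (@complex.Re R).
Local Notation Im := (@complex.Im R).
Local Notation mR := (measurableTypeR R).
Local Notation mu := (@lebesgue_measure R).

(** The counterpart on rows of [tcons], along which [lebesgue_Cn] is defined by recursion. *)
Definition consr n (a : C) (w : 'rV[C]_n) : 'rV[C]_n.+1 :=
  \row_i oapp (w 0) a (unlift ord0 i).

Lemma consr0 n (a : C) (w : 'rV[C]_n) : consr a w 0 ord0 = a.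
Proof. by rewrite mxE unlift_none. Qed.

Lemma consrS n (a : C) (w : 'rV[C]_n) j : consr a w 0 (lift ord0 j) = w 0 j.
Proof. by rewrite mxE liftK. Qed.

Lemma rowVP n (v w : 'rV[C]_n.+1) : v 0 ord0 = w 0 ord0 ->
  (forall j, v 0 (lift ord0 j) = w 0 (lift ord0 j)) -> v = w.
Proof.
by move=> h0 hS; apply/rowP => i; case: (unliftP ord0 i) => [j|] ->.
Qed.

Lemma consr_line n (a b l : C) (w v : 'rV[C]_n) :
  consr a w + l *: consr b v = consr (a + l * b) (w + l *: v).
Proof.
by apply: rowVP => [|j]; rewrite !(consr0, consrS, mxE) ?unlift_none ?liftK/= ?mxE.
Qed.

Lemma consr_eta n (z : 'rV[C]_n.+1) : z = consr (z 0 0) (\row_j z 0 (lift ord0 j)).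
Proof. by apply: rowVP => [|j]; rewrite ?consr0 ?consrS// mxE. Qed.

(** Holomorphy along complex lines survives the freezing of the first coordinate, as the inductions
    on the dimension require. *)
Definition line_hol n (f : 'rV[C]_n -> C) (D : set 'rV[C]_n) :=
  forall a b (l : C), D (a + l *: b) -> cdiff (fun l => f (a + l *: b)) l.

Definition cbox n (z : 'rV[C]_n) (rho : R) : set 'rV[C]_n :=
  [set w | forall j, csquare (z 0 j) rho (w 0 j)].

Lemma cbox_consr n a (z : 'rV[C]_n) rho b w : csquare a rho b -> cbox z rho w ->
  cbox (consr a z) rho (consr b w).
Proof. by move=> h1 h2 j; case: (unliftP ord0 j) => [k|] ->; rewrite !(consr0, consrS). Qed.

Lemma line_hol_tail n f a (z : 'rV[C]_n) rho b : line_hol f (cbox (consr a z) rho) ->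
  csquare a rho b -> line_hol (f \o consr b) (cbox z rho).
Proof.
move=> lf ab w v l h.
have E k : consr b (w + k *: v) = consr b w + k *: consr 0 v.
  by rewrite consr_line mulr0 addr0.
rewrite (_ : (fun _ => _) = fun l => f (consr b w + l *: consr 0 v)).
  by apply: lf; rewrite -E; exact: cbox_consr.
by apply/funext => k /=; rewrite E.
Qed.

Lemma line_hol_head n f a (z : 'rV[C]_n) rho w : line_hol f (cbox (consr a z) rho) ->
  cbox z rho w -> forall b, csquare a rho b -> cdiff (fun b => f (consr b w)) b.
Proof.
move=> lf zw b ab.
have E k : consr k w = consr 0 w + k *: consr 1 0.
  by rewrite consr_line mulr1 add0r scaler0 addr0.
rewrite (_ : (fun _ => _) = fun l => f (consr 0 w + l *: consr 1 0)).
  by apply: lf; rewrite -E; exact: cbox_consr.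
by apply/funext => k /=; rewrite E.
Qed.

Definition clampn n (z : 'rV[C]_n) rho (t : n.-tuple (mR * mR)) : 'rV[C]_n :=
  \row_i clampC (z 0 i) rho (tnth t i).

Definition rbox n (z : 'rV[C]_n) rho : set (n.-tuple (mR * mR)) :=
  [set t | forall i, rsquare (z 0 i) rho (tnth t i)].

Lemma clampn_cbox n (z : 'rV[C]_n) rho t : 0 <= rho -> cbox z rho (clampn z rho t).
Proof. by move=> r0 j; rewrite mxE; exact: clampC_csquare. Qed.

Lemma clampn_tcons n a (z : 'rV[C]_n) rho p t :
  clampn (consr a z) rho (tcons (p, t)) = consr (clampC a rho p) (clampn z rho t).
Proof.
by apply: rowVP => [|j]; rewrite ?consr0 ?consrS !mxE ?tnth0 ?tnthS ?unlift_none ?liftK.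
Qed.

Lemma rbox_tcons n a (z : 'rV[C]_n) rho p t :
  rbox (consr a z) rho (tcons (p, t)) <-> rsquare a rho p /\ rbox z rho t.
Proof.
split=> [h|[h1 h2] i].
  split; first by have := h ord0; rewrite consr0 tnth0.
  by move=> j; have := h (lift ord0 j); rewrite consrS tnthS.
by case: (unliftP ord0 i) => [j|] ->; rewrite ?consr0 ?consrS ?tnth0 ?tnthS.
Qed.

Lemma clampn_id n (z : 'rV[C]_n) rho t : rbox z rho t -> clampn z rho t = toCn t.
Proof. by move=> h; apply/rowP => i; rewrite !mxE clampC_id. Qed.

Lemma measurable_rbox n (z : 'rV[C]_n) rho : measurable (rbox z rho).
Proof.
rewrite (_ : rbox z rho = \bigcap_(i in [set: 'I_n]) ((@tnth n (mR * mR))^~ i @^-1` rsquare (z 0 i) rho)).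
  apply: fin_bigcap_measurable => // i _.
  rewrite -[X in measurable X]setTI; apply: measurable_tnth => //.
  exact: measurable_rsquare.
by apply/seteqP; split => [t h i _|t h i]; exact: h.
Qed.

(** The real and imaginary parts of the first coordinate are two continuous variables, and the
    remaining coordinates enter measurably by induction: two applications of
    [caratheodory_measurable]. *)
Lemma measurable_clampn n f (z : 'rV[C]_n) rho : 0 <= rho -> line_hol f (cbox z rho) ->
  measurable_fun [set: n.-tuple (mR * mR)] (fun t => N (f (clampn z rho t)) ^+ 2).
Proof.
move=> r0; elim: n => [|n IH] in f z *.
  move=> _; rewrite (_ : (fun _ => _) = cst (N (f 0) ^+ 2)); first exact: measurable_cst.
  by apply/funext => t /=; congr (N (f _) ^+ 2); apply/rowP => -[].
rewrite [z]consr_eta; set a := z 0 0; set z' := \row_j _ => lf.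
pose G (p : mR * (mR * n.-tuple (mR * mR))) :=
  N (f (consr (clampC a rho (p.1, p.2.1)) (clampn z' rho p.2.2))) ^+ 2.
have hd t b : csquare a rho b -> {for b, continuous (fun b => f (consr b (clampn z' rho t)))}.
  move=> ab; apply: cdiff_continuous; apply: (line_hol_head lf) => //.
  exact: clampn_cbox.
have mG : measurable_fun [set: mR * (mR * n.-tuple (mR * mR))] G.
  apply: caratheodory_measurable => [[y t] x|x].
    exact: (@clampC_continuous1 _ (fun b => f (consr b (clampn z' rho t))) a rho x y r0 (hd t)).
  apply: (@caratheodory_measurable _ _ _ (fun p => G (x, p))) => [t y|y].
    exact: (@clampC_continuous2 _ (fun b => f (consr b (clampn z' rho t))) a rho x y r0 (hd t)).
  apply: (IH (f \o consr (clampC a rho (x, y)))).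
  by apply: (line_hol_tail lf); exact: clampC_csquare.
pose h (t : n.+1.-tuple (mR * mR)) :=
  ((thead t).1, ((thead t).2, [tuple of behead t])).
have mh : measurable_fun [set: n.+1.-tuple (mR * mR)] h.
  have mt : measurable_fun [set: n.+1.-tuple (mR * mR)] (@thead n (mR * mR)).
    exact: measurable_tnth.
  apply/measurable_fun_pair => /=; first exact: (measurableT_comp measurable_fst mt).
  apply/measurable_fun_pair => /=; first exact: (measurableT_comp measurable_snd mt).
  exact: measurable_behead.
rewrite (_ : (fun _ => _) = G \o h); first exact: measurableT_comp.
apply/funext => t; rewrite /G/h/= -clampn_tcons; congr (N (f (clampn _ _ _)) ^+ 2).
by rewrite [LHS]tuple_eta; apply/val_inj; rewrite /= -surjective_pairing.
Qed.

Definition box_density n (f : 'rV[C]_n -> C) (z : 'rV[C]_n) rho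
    (t : n.-tuple (mR * mR)) : \bar R :=
  (N (f (clampn z rho t)) ^+ 2 * \1_(rbox z rho) t)%:E.

Lemma box_density_ge0 n f (z : 'rV[C]_n) rho t : (0 <= box_density f z rho t)%E.
Proof. by rewrite lee_fin mulr_ge0 ?sqr_ge0. Qed.

Lemma measurable_box_density n f (z : 'rV[C]_n) rho : 0 <= rho ->
  line_hol f (cbox z rho) ->
  measurable_fun [set: n.-tuple (mR * mR)] (box_density f z rho).
Proof.
move=> r0 lf; apply/measurable_EFinP; apply: measurable_funM.
  exact: measurable_clampn.
by apply: measurable_indic; exact: measurable_rbox.
Qed.

Lemma integral_lebesgue_CnS n (V : n.+1.-tuple (mR * mR) -> \bar R) :
  measurable_fun [set: n.+1.-tuple (mR * mR)] V -> (forall t, 0 <= V t)%E ->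
  (\int[@lebesgue_Cn R n.+1]_t V t =
   \int[@lebesgue_C R]_p \int[@lebesgue_Cn R n]_t V (tcons (p, t)))%E.
Proof.
move=> mV V0.
have mt := @measurable_tcons _ (mR * mR)%type n.
have := ge0_integral_pushforward mt (@lebesgue_C R \x @lebesgue_Cn R n)%E
  (@measurableT _ (n.+1.-tuple (mR * mR))) mV (fun t _ => V0 t).
rewrite preimage_setT => E.
have <- := @fubini_tonelli1 _ _ _ _ _ (@lebesgue_C R) (@lebesgue_Cn R n)
  (V \o @tcons _ (mR * mR)%type n) (measurableT_comp mV mt) (fun q => V0 _).
by rewrite -E; exact: eq_measure_integral.
Qed.

(** Induction on the dimension: with the first coordinate frozen the inductive bound applies to the
    tail, and the result is integrated over the first coordinate, where [area_estimate] applies. In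
    dimension 0 the measure is a point mass. *)
Theorem polydisc_estimate n f (z : 'rV[C]_n) rho : 0 < rho -> line_hol f (cbox z rho) ->
  ((N (f z) ^+ 2 * (rho ^+ 2) ^+ n)%:E <= (40 ^+ n)%:E *
    \int[@lebesgue_Cn R n]_t box_density f z rho t)%E.
Proof.
move=> r0; elim: n => [|n IH] in f z *.
  move=> lf; rewrite !expr0 mulr1 mul1e /lebesgue_Cn integral_dirac//; last first.
    by apply: measurable_box_density => //; exact: ltW.
  rewrite diracE mem_set// mul1e /box_density indicE mem_set ?mulr1; last by case.
  by rewrite lee_fin (_ : clampn _ _ _ = z)//; apply/rowP => -[].
rewrite [z]consr_eta; set a := z 0 0; set z' := \row_j _ => lf.
have mV := measurable_box_density (ltW r0) lf.
rewrite integral_lebesgue_CnS//; last by move=> t; exact: box_density_ge0.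
have tail p : line_hol (f \o consr (clampC a rho p)) (cbox z' rho).
  by apply: (line_hol_tail lf); apply: clampC_csquare; exact: ltW.
have VE p t : box_density f (consr a z') rho (tcons (p, t)) =
    ((\1_(rsquare a rho) p)%:E * box_density (f \o consr (clampC a rho p)) z' rho t)%E.
  rewrite /box_density clampn_tcons -EFinM mulrCA; congr (_ * _)%:E.
  rewrite !indicE -natrM mulnb; congr (nat_of_bool _)%:R.
  apply/idP/andP; rewrite !inE => /rbox_tcons//.
pose W p := (N (f (consr (clampC a rho p) z')) ^+ 2 * \1_(rsquare a rho) p)%:E.
have z'box : cbox z' rho z'.
  by move=> j; split; apply/andP; split; lra.
have hd := line_hol_head lf z'box.
have mW : measurable_fun [set: mR * mR] W.
  have cn b : csquare a rho b -> {for b, continuous (fun b => f (consr b z'))}.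
    by move=> /hd/cdiff_continuous.
  apply/measurable_EFinP; apply: measurable_funM; last first.
    by apply: measurable_indic; exact: measurable_rsquare.
  apply: caratheodory_measurable => [y x|x].
    exact: (@clampC_continuous1 _ (fun b => f (consr b z')) a rho x y (ltW r0) cn).
  apply: continuous_measurable_fun => y.
  exact: (@clampC_continuous2 _ (fun b => f (consr b z')) a rho x y (ltW r0) cn).
have W0 p : (0 <= W p)%E by rewrite lee_fin mulr_ge0 ?sqr_ge0.
have mVt : measurable_fun [set: (mR * mR) * n.-tuple (mR * mR)]
    (box_density f (consr a z') rho \o tcons (n := n)).
  by apply: measurableT_comp => //; exact: measurable_tcons.
have V0 q : (0 <= (box_density f (consr a z') rho \o tcons (n := n)) q)%E.
  exact: box_density_ge0.
have mF := measurable_fun_fubini_tonelli_F (m2 := @lebesgue_Cn R n) _ mVt V0.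
have step : (((rho ^+ 2) ^+ n)%:E * \int[@lebesgue_C R]_p W p <=
    (40 ^+ n)%:E * \int[@lebesgue_C R]_p \int[@lebesgue_Cn R n]_t
      box_density f (consr a z') rho (tcons (p, t)))%E.
  have r2 : 0 <= (rho ^+ 2) ^+ n by rewrite exprn_ge0 ?sqr_ge0.
  have k40 : 0 <= 40 ^+ n :> R by rewrite exprn_ge0.
  have In0 p : (0 <= \int[@lebesgue_Cn R n]_t box_density f (consr a z') rho (tcons (p, t)))%E.
    by apply: integral_ge0 => t _; exact: box_density_ge0.
  rewrite -!ge0_integralZl_EFin//.
  apply: ge0_le_integral => //.
  - by move=> p _; rewrite mule_ge0// lee_fin exprn_ge0 ?sqr_ge0.
  - by apply: measurable_funeM.
  - by apply: measurable_funeM.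
  move=> p _; under eq_integral do rewrite VE.
  rewrite ge0_integralZl_EFin//; last 2 first.
  - by move=> t _; exact: box_density_ge0.
  - by apply: measurable_box_density (tail p); exact: ltW.
  rewrite /W indicE; case: (p \in _); last by rewrite mulr0 mule0 mul0e mule0.
  by rewrite mulr1 mul1e -EFinM mulrC; exact: IH.
have area := area_estimate r0 hd.
rewrite [40 ^+ n.+1]exprS EFinM -muleA.
apply: le_trans (lee_wpmul2l _ step); last by rewrite lee_fin.
rewrite muleCA.
have -> : N (f (consr a z')) ^+ 2 * (rho ^+ 2) ^+ n.+1 =
  (rho ^+ 2) ^+ n * (N (f (consr a z')) ^+ 2 * rho ^+ 2) by rewrite [_ ^+ n.+1]exprS; ring.
rewrite EFinM lee_wpmul2l//.
by rewrite lee_fin exprn_ge0 ?sqr_ge0.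
Qed.

End polydisc_estimate.

(** * The Bergman kernel *)

(** The integral of a nonnegative function is a supremum over the simple functions below it, hence
    monotone for arbitrary integrands. This handles the integral over D in [L2norm] directly. *)
Lemma ge0_le_integral_nonmeasurable d (T : measurableType d) (R : realType)
    (mu : {measure set T -> \bar R}) (D : set T) (f g : T -> \bar R) :
  (forall x, 0 <= f x)%E -> (forall x, D x -> 0 <= g x)%E ->
  (forall x, f x <= (g \_ D) x)%E -> (\int[mu]_x f x <= \int[mu]_(x in D) g x)%E.
Proof.
move=> f0 g0 fg; rewrite !ge0_integralE//; apply: ereal_sup_le => _ [h hf <-].
exists h => // x; apply: le_trans (hf x) _; rewrite patch_setT; exact: fg.
Qed.

Section bergman.
Context {R : realType} {n : nat}.
Local Notation C := (R[i]).
Local Notation Cn := ('rV[C]_n).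
Local Notation N := (@ComplexField.Normc.normc R).
Local Notation Re := (@complex.Re R).
Local Notation Im := (@complex.Im R).
Implicit Types (f : Cn -> C) (D : set Cn) (z w : Cn) (rho : R).

Definition near_box z d : set Cn := [set w | forall j, N (w 0 j - z 0 j) < d].

Lemma nbhs_rVP z (P : set Cn) : nbhs z P <-> exists2 d : R, 0 < d & near_box z d `<=` P.
Proof.
split.
  move=> /nbhs_ballP[e /= e0 H]; exists (Re e).
    by move: e0; rewrite ltcE => /andP[].
  move=> w wz; apply: H; split => // i j; rewrite (ord1 i).
  rewrite -ball_normE /= distrC normrcE -(RRe_real (gtr0_real e0)) ltcR.
  exact: wz.
move=> [d d0 H]; apply/nbhs_ballP; exists d%:C => /=; first by rewrite ltcR.
move=> w [_ wz]; apply: H => j; have := wz 0 j.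
by rewrite -ball_normE /= distrC normrcE ltcR.
Qed.

Lemma cbox_near z rho d : 2 * rho < d -> cbox z rho `<=` near_box z d.
Proof.
move=> rd w wz j; have [h1 h2] := wz j.
apply: le_lt_trans (N_le _) _; apply: le_lt_trans rd.
rewrite mulr_natl mulr2n lerD// ler_norml.
  by move: h1; case: (w 0 j) (z 0 j) => a b [a' b'] /= ?; lra.
by move: h2; case: (w 0 j) (z 0 j) => a b [a' b'] /= ?; lra.
Qed.

Lemma open_cbox D z : open D -> D z -> exists2 rho, 0 < rho & cbox z rho `<=` D.
Proof.
rewrite openE => oD /oD /nbhs_rVP[d d0 dD]; exists (d / 3); first by rewrite divr_gt0.
by apply: subset_trans dD; apply: cbox_near; lra.
Qed.

Lemma holomorphic_line D f : holomorphic D f -> line_hol f D.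
Proof.
move=> hf a b l /hf /(diff_derivable (v := b)); rewrite cdiffE /derivable.
set g1 := (X in cvg (X @ _) -> _); set g2 := (X in _ -> cvg (X @ _)).
suff -> : g1 = g2 by [].
apply/funext => h; rewrite /g1 /g2 /=; congr (_ *: (f _ - _)).
rewrite (_ : h *: 1 = h); last exact: mulr1.
by rewrite scalerDl addrCA.
Qed.

Lemma line_holS D1 D2 f : D1 `<=` D2 -> line_hol f D2 -> line_hol f D1.
Proof. by move=> D12 hf a b l /D12; exact: hf. Qed.

Definition bergman_ball D : set (Cn -> C) :=
  [set f | holomorphic D f /\ (L2norm D f <= 1)%E].

(** The bound depends on the point only through the size of a box inside D, so it is uniform near
    each point and over the whole unit ball. *)
Lemma bergman_ball_le D f z rho : bergman_ball D f -> 0 < rho -> cbox z rho `<=` D ->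
  N (f z) ^+ 2 <= (40 / rho ^+ 2) ^+ n.
Proof.
move=> [hf f1] r0 zD.
have lf : line_hol f (cbox z rho) by apply: line_holS zD _; exact: holomorphic_line.
have I0 : (0 <= \int[@lebesgue_Cn R n]_(t in toCn @^-1` D) (N (f (toCn t)) ^+ 2)%:E)%E.
  by apply: integral_ge0 => t _; rewrite lee_fin sqr_ge0.
have I1 : (\int[@lebesgue_Cn R n]_(t in toCn @^-1` D) (N (f (toCn t)) ^+ 2)%:E <= 1)%E.
  move: f1; rewrite /L2norm; set I := integral _ _ _ in I0 *.
  rewrite leNgt => I1; rewrite leNgt; apply: contra I1.
  case: I I0 => [r|_ _|//]; last by rewrite poweRyr ?invr_eq0// ltry.
  rewrite lee_fin !lte_fin => r0' r1; rewrite powR12_sqrt// -sqrtr1 ltr_sqrt//.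
  exact: lt_trans r1.
have r2 : 0 < rho ^+ 2 by rewrite exprn_gt0.
have := polydisc_estimate r0 lf.
move=> /le_trans/(_ (_ : _ <= (40 ^+ n)%:E)%E) L.
rewrite expr_div_n ler_pdivlMr ?exprn_gt0// -lee_fin; apply: L.
rewrite -[leRHS]mule1 lee_wpmul2l ?lee_fin ?exprn_ge0//.
apply: le_trans I1; apply: ge0_le_integral_nonmeasurable.
- by move=> t; exact: box_density_ge0.
- by move=> t _; rewrite lee_fin sqr_ge0.
move=> t; rewrite /box_density indicE patchE.
have [tz|_] := boolP (t \in rbox z rho); last first.
  by rewrite mulr0; case: ifP => // _; rewrite lee_fin sqr_ge0.
move: tz; rewrite inE => tz; rewrite mulr1 clampn_id//.
rewrite mem_set//; apply: zD; rewrite -(clampn_id tz).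
by apply: clampn_cbox; exact: ltW.
Qed.

End bergman.

Section bergman_psh.
Context {R : realType} {n : nat}.
Local Notation C := (R[i]).
Local Notation Cn := ('rV[C]_n).
Local Notation N := (@ComplexField.Normc.normc R).
Local Notation Re := (@complex.Re R).
Local Notation Im := (@complex.Im R).
Implicit Types (f : Cn -> C) (D : set Cn) (z w : Cn) (rho : R).

Lemma continuous_line (a b : Cn) : continuous (fun l : C => a + l *: b).
Proof.
move=> l P /nbhs_rVP[d d0 dP]; apply/nbhs_NP.
pose B := 1 + \sum_j N (b 0 j).
have B0 : 0 < B by rewrite ltr_pwDl// sumr_ge0// => j _; exact: N_ge0.
exists (d / B); first by rewrite divr_gt0.
move=> k kl; apply: dP => j; rewrite !mxE opprD addrACA subrr add0r -mulrBl NM.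
apply: le_lt_trans (_ : N (k - l) * B < _); last by rewrite -ltr_pdivlMr.
rewrite ler_wpM2l ?N_ge0// /B (bigD1 j)//= addrCA lerDl.
by rewrite addr_ge0// sumr_ge0// => i _; exact: N_ge0.
Qed.

Lemma open_slice D (a b : Cn) x : open D -> D (a + x *: b) ->
  exists2 d : R, 0 < d & forall y, N (y - x) < d -> D (a + y *: b).
Proof.
by rewrite openE => oD /oD Dx; have /nbhs_NP := continuous_line Dx.
Qed.

Lemma N_sqr_dist_le (a b : C) (M : R) : N a ^+ 2 <= M -> N b ^+ 2 <= M ->
  N (a - b) ^+ 2 <= 4 * M.
Proof.
move=> aM bM; have := ND a (- b); rewrite NN => ab.
have h (s t : R) : (s + t) ^+ 2 <= 2 * s ^+ 2 + 2 * t ^+ 2.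
  by rewrite -subr_ge0 (_ : _ - _ = (s - t) ^+ 2) ?sqr_ge0//; ring.
apply: (@le_trans _ _ ((N a + N b) ^+ 2)).
  by rewrite ler_pXn2r ?nnegrE ?addr_ge0 ?N_ge0.
by apply: le_trans (h _ _) _; lra.
Qed.

(** A variant of the Schwarz lemma. On the line l |-> z + l v with v = w - z, the function (g l - g
    0) ^ 2 / l is holomorphic also at l = 0, by [cdiff_sqr_quotient]. The maximum principle on a
    large square centred at l = 1 bounds |f w - f z| ^ 2 by 4 M / (s - 1). *)
Lemma bergman_equicontinuous D z e : open D -> D z -> 0 < e ->
  exists2 d, 0 < d & forall f w, bergman_ball D f -> near_box z d w -> N (f w - f z) <= e.
Proof.
move=> oD Dz e0; have [rho0 r0 zD] := open_cbox oD Dz.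
pose rho := rho0 / 2; have rho_gt0 : 0 < rho by rewrite divr_gt0.
pose M := (40 / rho ^+ 2) ^+ n.
have M0 : 0 <= M by rewrite exprn_ge0// divr_ge0// sqr_ge0.
have fM f w : bergman_ball D f -> cbox z rho w -> N (f w) ^+ 2 <= M.
  move=> bf zw; apply: bergman_ball_le bf rho_gt0 _; apply: subset_trans zD.
  move=> w' ww' j; have [a1 a2] := zw j; have [b1 b2] := ww' j.
  by move: a1 a2 b1 b2; rewrite /rho => ? ? ? ?; split; lra.
have zrD : cbox z rho `<=` D.
  apply: subset_trans zD => w zw j; have [a1 a2] := zw j.
  by move: a1 a2; rewrite /rho => ? ?; split; lra.
(* The choice makes e ^ 2 * (s - 1) >= 4 M. Points l of the square satisfy |l| <= 1 + 2 s, and [h]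
   is such that z + l v then stays in the box of radius rho. *)
pose s := 2 + 4 * M / e ^+ 2.
have e2 : 0 < e ^+ 2 by rewrite exprn_gt0.
have s2 : 2 <= s by rewrite lerDl divr_ge0 ?mulr_ge0// ltW.
have k0 : 0 < 1 + 2 * s by lra.
pose h := rho / (1 + 2 * s).
have h0 : 0 < h by rewrite divr_gt0.
exists h => // f w bf zw; pose v := w - z.
have lineD (l : C) : N l <= 1 + 2 * s -> cbox z rho (z + l *: v).
  move=> ls j; have : N (l * v 0 j) <= rho.
    rewrite NM (_ : rho = (1 + 2 * s) * h); last by rewrite /h mulrC divfK// gt_eqF.
    apply: ler_pM; rewrite ?N_ge0// !mxE; exact: ltW (zw j).
  move=> lv; have := le_trans (Re_le _) lv; have := le_trans (Im_le _) lv.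
  rewrite !mxE; set u := l * _.
  by rewrite !ler_norml; case: (z 0 j) u => ? ? [? ?] /= *; split=> /=; lra.
pose g l := f (z + l *: v).
have cg l : N l <= 1 + 2 * s -> cdiff g l.
  move=> ls; have [hf _] := bf; apply: (holomorphic_line hf).
  exact/zrD/lineD.
have gM l : N l <= 1 + 2 * s -> N (g l) ^+ 2 <= M by move=> ls; apply: fM => //; exact: lineD.
have c0 : cdiff g 0 by apply: cg; rewrite N0; lra.
have sq x y : - s <= x <= s -> - s <= y <= s -> N (1 + (x +i* y)) <= 1 + 2 * s.
  move=> hx hy; rewrite (le_trans (ND _ _))// N1 lerD2l (le_trans (N_le _))//=.
  by rewrite mulr_natl mulr2n lerD// ler_norml.
suff main : N ((g 1 - g 0) ^+ 2 / (1 - 0)) <= e ^+ 2.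
  move: main; rewrite NM NV subr0 N1 invr1 mulr1 NX ler_pXn2r ?nnegrE ?N_ge0 ?(ltW e0)//.
  by rewrite /g scale0r addr0 scale1r /v [z + _]addrC subrK.
apply: (@square_max _ (fun l => (g l - g 0) ^+ 2 / (l - 0)) 1 s).
- by lra.
- by move=> x y hx hy; apply: cdiff_sqr_quotient => //; apply: cg; exact: sq.
move=> x y hx hy hxy; set l := 1 + _.
have ls : N l <= 1 + 2 * s := sq _ _ hx hy.
have sl : s - 1 <= N l.
  have : s <= N (x +i* y).
    by case: hxy => <-; [exact: (Re_le (x +i* y))|exact: (Im_le (x +i* y))].
  have := ND l (-1); rewrite NN N1 (_ : l - 1 = x +i* y); last by rewrite /l addrC addKr.
  by lra.
have g4 : N (g l - g 0) ^+ 2 <= 4 * M.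
  by apply: N_sqr_dist_le; apply: gM => //; rewrite N0; lra.
rewrite subr0 NM NV NX ler_pdivrMr; last by lra.
apply: le_trans g4 _; apply: le_trans (_ : e ^+ 2 * (s - 1) <= _); last first.
  by rewrite ler_wpM2l// ltW.
rewrite /s mulrBr mulrDr mulrCA divff ?gt_eqF// mulr1; lra.
Qed.

Lemma bergman_ball0 D : bergman_ball D (fun=> 0).
Proof.
split; first by move=> z _; exact: differentiable_cst.
rewrite /L2norm (_ : integral _ _ _ = 0%E) ?poweR0r ?lee_fin// ?invr_eq0//.
by apply: integral0_eq => t _; rewrite N0 expr0n.
Qed.

Definition bergman_fun D z : R := fine (bergman_kernel D z).

Lemma bergman_kernel_fin D z : open D -> D z -> (bergman_kernel D z \is a fin_num)%E.
Proof.
move=> oD Dz; have [rho r0 zD] := open_cbox oD Dz.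
rewrite ge0_fin_numE.
  apply: (@le_lt_trans _ _ ((40 / rho ^+ 2) ^+ n)%:E); last exact: ltry.
  apply: ge_ereal_sup => _ [f bf <-]; rewrite lee_fin.
  exact: bergman_ball_le bf r0 zD.
apply: le_ereal_sup_tmp; exists 0%E => //; exists (fun=> 0); first exact: bergman_ball0.
by rewrite N0 expr0n.
Qed.

Lemma bergman_funE D z : open D -> D z -> bergman_kernel D z = (bergman_fun D z)%:E.
Proof. by move=> oD Dz; rewrite fineK//; exact: bergman_kernel_fin. Qed.

Lemma le_bergman_fun D f z : open D -> D z -> bergman_ball D f ->
  N (f z) ^+ 2 <= bergman_fun D z.
Proof.
move=> oD Dz bf; rewrite -lee_fin -bergman_funE//.
by apply: ereal_sup_ubound; exists f.
Qed.

Lemma bergman_fun_le D z (k : R) : open D -> D z ->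
  (forall f, bergman_ball D f -> N (f z) ^+ 2 <= k) -> bergman_fun D z <= k.
Proof.
move=> oD Dz H; rewrite -lee_fin -bergman_funE//.
by apply: ge_ereal_sup => _ [f bf <-]; rewrite lee_fin; exact: H.
Qed.

Lemma bergman_fun_ge0 D z : open D -> D z -> 0 <= bergman_fun D z.
Proof.
by move=> oD Dz; have := le_bergman_fun oD Dz (bergman_ball0 D); rewrite N0 expr0n.
Qed.

Lemma bergman_fun_continuous D z : open D -> D z -> {for z, continuous (bergman_fun D)}.
Proof.
move=> oD Dz; apply/(@cvgrPdist_le _ _ _ _ (nbhs_filter z)) => e e0.
(* Since x <= 1 + x ^ 2, the bound K on |f z| ^ 2 gives the bound M on |f z|, and then |f w| + |f z|
   <= 2 M + 1 once f w and f z differ by at most 1. *)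
pose M := 1 + bergman_fun D z; have K0 := bergman_fun_ge0 oD Dz.
have M0 : 0 < 2 * M + 1 by rewrite /M; lra.
have d0 : 0 < Num.min 1 (e / (2 * M + 1)) by rewrite lt_min ltr01 divr_gt0.
have [d dd0 H] := bergman_equicontinuous oD Dz d0.
have [rho r0 zD] := open_cbox oD Dz.
have Dnear : nbhs z D by move: oD; rewrite openE => /(_ _ Dz).
have /nbhs_rVP[d' d'0 Dd'] := Dnear.
apply/nbhs_rVP; exists (Num.min d d'); first by rewrite lt_min dd0.
move=> w wz; have Dw : D w by apply: Dd' => j; have := wz j; rewrite lt_min => /andP[].
have wd : near_box z d w by move=> j; have := wz j; rewrite lt_min => /andP[].
have NM f : bergman_ball D f -> N (f z) <= M.
  move=> bf; have := le_bergman_fun oD Dz bf; rewrite /M.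
  have := sqr_ge0 (N (f z) - 1); rewrite !expr2 mulrBl mulrBr !mulr1 mul1r.
  by have := N_ge0 (f z); lra.
have key f : bergman_ball D f -> `|N (f w) ^+ 2 - N (f z) ^+ 2| <= e.
  move=> bf; have := H f w bf wd; set t := N (f w - f z); rewrite le_min => /andP[t1 te].
  have h1 : `|N (f w) - N (f z)| <= t.
    rewrite ler_norml lerNl opprB; apply/andP; split; last exact: NB.
    by rewrite /t Ndist; exact: NB.
  rewrite subr_sqr normrM; apply: (@le_trans _ _ (e / (2 * M + 1) * (2 * M + 1))).
    apply: ler_pM => //; first exact: le_trans h1 te.
    rewrite ger0_norm ?addr_ge0 ?N_ge0//.
    have := NM f bf; have := le_trans (ler_norm _) h1; lra.
  by rewrite divfK// gt_eqF.
rewrite ler_norml; apply/andP; split.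
  rewrite lerBrDl -lerBrDr; apply: bergman_fun_le => // f bf.
  by have := key f bf; have := le_bergman_fun oD Dz bf; rewrite ler_norml; lra.
rewrite lerBlDl; apply: bergman_fun_le => // f bf.
by have := key f bf; have := le_bergman_fun oD Dw bf; rewrite ler_norml; lra.
Qed.

End bergman_psh.

(** * Subharmonic functions *)

Section subharmonic.
Context {R : realType}.
Local Notation C := (R[i]).
Local Notation N := (@ComplexField.Normc.normc R).
Local Notation mu := (@lebesgue_measure R).
Implicit Types (E v : C -> R) (G : set C) (c x : C).

Lemma hol_supported_max2 E F x : hol_supported E x -> hol_supported F x ->
  hol_supported (fun z => Num.max (E z) (F z)) x.
Proof.
wlog EF : E F / F x <= E x => [H|].
  move=> hE hF; have [EF|EF] := leP (F x) (E x); first exact: H.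
  rewrite (_ : (fun _ => _) = fun z => Num.max (F z) (E z)).
    by apply: H => //; exact: ltW.
  by apply/funext => z; rewrite maxC.
move=> [f [d [d0 fx Hf]]] _; exists f, d; split => //.
  by rewrite fx; apply/esym/max_idPl.
by move=> y /Hf[cf fy]; split => //; rewrite le_max fy.
Qed.

Lemma continuous_max2 (T : topologicalType) (E F : T -> R) (x : T) :
  {for x, continuous E} -> {for x, continuous F} ->
  {for x, continuous (fun z => Num.max (E z) (F z))}.
Proof. by move=> cE cF; exact: (@continuous_max _ _ E F). Qed.

Lemma hol_good_max2 E F x : hol_good E x -> hol_good F x ->
  hol_good (fun z => Num.max (E z) (F z)) x.
Proof.
by move=> [cE hE] [cF hF]; split; [exact: continuous_max2|exact: hol_supported_max2].
Qed.

Lemma continuous_ln_comp (T : topologicalType) (E : T -> R) (x : T) : 0 < E x ->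
  {for x, continuous E} -> {for x, continuous (fun z => ln (E z))}.
Proof.
move=> E0 cE; apply: (@continuous_comp _ _ _ E (@ln R)) => //; exact: continuous_ln.
Qed.

Lemma submean_ln E c r : 0 <= r ->
  (forall x, N (x - c) <= r -> 0 < E x /\ hol_good E x) ->
  2 * pi * ln (E c) <= cint 0 (2 * pi) (fun t => ln (E (circ c r t))).
Proof.
move=> r0 H; apply: (@submean _ (fun x => ln (E x))) => // x xr.
have [E0 [cE [f [d [d0 fx Hf]]]]] := H x xr; split; first exact: continuous_ln_comp.
pose d' := d; have cE' := cE.
(* On the smaller neighbourhood E stays positive, so that expR (ln (E y)) is E y there. *)
move: cE => /(@cvgrPdist_lt _ _ _ _ (nbhs_filter x))/(_ _ E0)/nbhs_NP[d2 d20 Hd2].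
exists f, (Num.min d d2); split.
- by rewrite lt_min d0.
- by rewrite fx /= lnK.
move=> y; rewrite lt_min => /andP[/Hf[cf fy] /Hd2]; rewrite ltr_norml => /andP[_ yE].
by split => //; rewrite /= lnK// posrE; lra.
Qed.

Lemma circle_continuous E c r (t : R) : 0 <= r ->
  (forall x, N (x - c) <= r -> {for x, continuous E}) ->
  {for t, continuous (fun t => E (circ c r t))}.
Proof.
move=> r0 cE; apply: (@continuous_comp _ _ _ (circ c r) E); first exact: continuous_circ.
by apply: cE; rewrite circ_in.
Qed.

Lemma integral_cint (g : R -> R) a b : {in `[a, b], continuous g} ->
  (\int[mu]_(t in `[a, b]) (g t)%:E = (cint a b g)%:E)%E.
Proof.
by move=> cg; rewrite /cint /Rintegral fineK//; apply: integrable_fin_num => //;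
  exact: cint_integrable.
Qed.

Lemma subharmonic_real G v :
  (forall x, G x -> {for x, continuous v}) ->
  (forall c r, 0 < r -> (forall x, N (x - c) <= r -> G x) ->
    2 * pi * v c <= cint 0 (2 * pi) (fun t => v (circ c r t))) ->
  subharmonic G (fun x => (v x)%:E).
Proof.
move=> cv H; split.
- by move=> x _; exact: ltry.
- move=> x /cv cvx a; rewrite lte_fin => va.
  move: cvx => /(@cvgrPdist_lt _ _ _ _ (nbhs_filter x))/(_ (a - v x)).
  rewrite subr_gt0 => /(_ va); apply: filterS => y.
  by rewrite lte_fin ltr_norml => /andP[+ _]; lra.
move=> c r r0 rG.
have rG' x : N (x - c) <= r -> G x by exact: rG.
rewrite integral_cint; last first.
  by move=> t _; apply: circle_continuous (ltW r0) _ => x /rG'; exact: cv.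
rewrite -EFinM lee_fin mulrC ler_pdivlMr; last by rewrite mulr_gt0// pi_gt0.
by rewrite mulrC; exact: H.
Qed.

Lemma near_lne_lt (T : topologicalType) (E : T -> R) (x : T) (a : R) : {for x, continuous E} ->
  (lne (E x)%:E < a%:E)%E -> \forall y \near x, (lne (E y)%:E < a%:E)%E.
Proof.
move=> cE Ea; have {}Ea : E x < expR a.
  have [Ex0|Ex0] := leP (E x) 0; first by rewrite (le_lt_trans Ex0)// expR_gt0.
  by move: Ea; rewrite lne_EFin// lte_fin => Ea; rewrite -(lnK Ex0) ltr_expR.
move: cE => /(@cvgrPdist_lt _ _ _ _ (nbhs_filter x))/(_ (expR a - E x)).
rewrite subr_gt0 => /(_ Ea); apply: filterS => y.
rewrite ltr_norml => /andP[+ _] => yE; have {}yE : E y < expR a by lra.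
have [Ey0|Ey0] := leP (E y) 0; first by rewrite le0_lneNy// ltNyr.
by rewrite lne_EFin// lte_fin -(ltr_expR) lnK.
Qed.

(** The logarithm may take the value -oo, so [submean_ln] is applied to the truncations max (E, 1 /
    (k + 2)). As E < 1, the negated logarithms of the truncations are nonnegative and increase with
    k, and monotone convergence yields the integral of - lne E. *)
Lemma subharmonic_lne G E : (forall x, G x -> hol_good E x) ->
  (forall x, G x -> E x < 1) -> subharmonic G (fun x => lne (E x)%:E).
Proof.
move=> gE E1; have E0 x : G x -> 0 <= E x.
  by move=> /gE[_ [f [d [_ <- _]]]]; exact: N_ge0.
split.
- by move=> x /E1 Ex; rewrite (lt_trans (_ : _ < 0%E)%E) ?lne_lt0 ?lte_fin// ltry.
- by move=> x Gx a; have [cE _] := gE x Gx; exact: near_lne_lt.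
move=> c r r0 rG.
have rG' x : N (x - c) <= r -> G x by exact: rG.
have Gc : G c by apply: rG'; rewrite subrr N0 ltW.
have [Ec|Ec] := leP (E c) 0; first by rewrite le0_lneNy// leNye.
pose Ek k x := Num.max (E x) k.+2%:R^-1.
have Ek0 k x : 0 < Ek k x by rewrite lt_max invr_gt0 ltr0n orbT.
have gEk k x : N (x - c) <= r -> hol_good (Ek k) x.
  move=> /rG' Gx; apply: hol_good_max2; first exact: gE.
  by apply: hol_good_cst; rewrite invr_ge0.
have cEk k t : {for t, continuous (fun t => ln (Ek k (circ c r t)))}.
  apply: (@circle_continuous (fun x => ln (Ek k x)) c r t (ltW r0)) => x xr.
  by apply: continuous_ln_comp => //; have [] := gEk k x xr.
have Gcirc t : G (circ c r t) by apply: rG'; rewrite circ_in// ltW.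
pose g (k : nat) (t : R) : \bar R := (- ln (Ek k (circ c r t)))%:E.
have mg k : measurable_fun `[0, 2 * pi] (g k).
  apply/measurable_EFinP; apply: measurable_funTS; apply: continuous_measurable_fun => t.
  exact: (continuousN (cEk k t)).
have g0 k t : `[0, 2 * pi]%classic t -> (0 <= g k t)%E.
  move=> _; rewrite lee_fin oppr_ge0 ln_le0// ge_max ltW ?E1//=.
  by rewrite invf_le1// ler1n.
have gmono t : `[0, 2 * pi]%classic t -> {homo g ^~ t : a b / (a <= b)%N >-> (a <= b)%E}.
  move=> _ a b ab; rewrite lee_fin lerN2 ler_ln ?posrE// /Ek.
  by rewrite ge_max !le_max lexx/= lef_pV2 ?posrE// ler_nat !ltnS ab orbT.
have glim t : g ^~ t @ \oo --> (- lne (E (circ c r t))%:E)%E.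
  have [Ex|Ex] := leP (E (circ c r t)) 0.
    rewrite le0_lneNy//=; apply/cvgeyPge => A.
    exists (Num.bound (expR A)) => // k /= Ak; rewrite lee_fin /Ek (max_idPr _).
      rewrite lnV ?posrE// opprK -[A]expRK ler_ln ?posrE ?expR_gt0//.
      rewrite ltW// (lt_trans (archi_boundP (expR_ge0 _)))// ltr_nat.
      by rewrite ltnS (leq_trans Ak).
    by rewrite (le_trans Ex)// invr_ge0.
  rewrite lne_EFin//; apply: cvg_near_cst.
  exists (Num.bound (E (circ c r t))^-1) => // k /= Ak.
  rewrite /g /Ek (max_idPl _)// -[leRHS]invrK lef_pV2 ?posrE ?invr_gt0//.
  rewrite ltW// (lt_trans (archi_boundP _))// ?invr_ge0 ?(ltW Ex)// ltr_nat.
  by rewrite ltnS (leq_trans Ak).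
have pi0 : 0 < 2 * pi :> R by rewrite mulr_gt0// pi_gt0.
have bound k : (\int[mu]_(t in `[0%R, (2 * pi)%R]) g k t <= (- (2 * pi * ln (E c)))%:E)%E.
  have cg : {in `[0, 2 * pi], continuous (fun t => - ln (Ek k (circ c r t)))}.
    by move=> t _; exact: (continuousN (cEk k t)).
  rewrite /g integral_cint// lee_fin.
  have := @submean_ln (Ek k) c r (ltW r0) (fun x xr => conj (Ek0 k x) (gEk k x xr)).
  have cl : {in `[0, 2 * pi], continuous (fun t => ln (Ek k (circ c r t)))}.
    by move=> t _; exact: cEk.
  have -> : cint 0 (2 * pi) (fun t => - ln (Ek k (circ c r t))) =
      - cint 0 (2 * pi) (fun t => ln (Ek k (circ c r t))).
    by rewrite -mulN1r -cintZ//; congr cint; apply/funext => t; rewrite mulN1r.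
  rewrite lerN2; apply: le_trans; rewrite ler_pM2l// ler_ln ?posrE// /Ek.
  by rewrite le_max lexx.
have mcv := @cvg_monotone_convergence _ _ R mu _ (measurable_itv `[0, 2 * pi]) g mg g0 gmono.
have lim_bound : (\int[mu]_(t in `[0%R, (2 * pi)%R]) - lne (E (circ c r t))%:E <=
    (- (2 * pi * ln (E c)))%:E)%E.
  rewrite (_ : (fun t => - lne _)%E = (fun t => limn (g ^~ t))); last first.
    by apply/funext => t; apply/esym/cvg_lim => //; exact: glim.
  rewrite -(cvg_lim _ mcv)//; apply: lime_le; first by apply/cvg_ex; eexists; exact: mcv.
  by apply: nearW => k; exact: bound.
have {lim_bound}lim_bound : ((2 * pi * ln (E c))%:E <=
    \int[mu]_(t in `[0%R, (2 * pi)%R]) lne (E (circ c r t))%:E)%E.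
  under eq_integral do rewrite -[lne _]oppeK.
  rewrite integral_ge0N; last by move=> t _; rewrite oppe_ge0 lne_le0 lee_fin ltW ?E1.
  by rewrite leeNr -EFinN.
apply: le_trans (lee_wpmul2l _ lim_bound); last by rewrite lee_fin invr_ge0 ltW.
by rewrite -EFinM mulKf ?gt_eqF// lne_EFin.
Qed.

End subharmonic.

(** * The exhaustion function log (1 + K) *)

Section exhaustion.
Context {R : realType} {n : nat}.
Local Notation C := (R[i]).
Local Notation Cn := ('rV[C]_n).
Local Notation N := (@ComplexField.Normc.normc R).
Local Notation Re := (@complex.Re R).
Implicit Types (D : set Cn) (z w : Cn).

(** With a = g x, the inequality |1 + a^* g| ^ 2 <= (1 + |a| ^ 2) (1 + |g| ^ 2) is an equality at x;
    division by 1 + |a| ^ 2 exhibits the supporting holomorphic function. *)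
Lemma hol_good_1DN2 (g : C -> C) x (d : R) : 0 < d ->
  (forall y, N (y - x) < d -> cdiff g y) -> hol_good (fun y => 1 + N (g y) ^+ 2) x.
Proof.
move=> d0 cg; have cgx : cdiff g x by apply: cg; rewrite subrr N0.
split.
  apply: (@continuousD _ _ _ (fun=> 1 : R) (fun y => N (g y) ^+ 2)).
    exact: cst_continuous.
  by apply: continuous_N2; exact: cdiff_continuous.
pose a := g x; pose k := 1 + N a ^+ 2.
have k0 : 0 < k by rewrite ltr_pwDl// sqr_ge0.
exists (fun y => (1 + a^* * g y) ^+ 2 * (k^-1)%:C), d; split => //.
  rewrite NM NX Nreal gtr0_norm ?invr_gt0//.
  have := cauchy_schwarz_1 a a; rewrite subrr N0 expr0n addr0 => ->.
  by rewrite -/k mulfK// gt_eqF.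
move=> y yd; split.
  apply: (@cdiffM _ (fun y => (1 + a^* * g y) ^+ 2)); last exact: cdiff_cst.
  apply: (@cdiffX _ (fun y => 1 + a^* * g y)); apply: cdiffD; first exact: cdiff_cst.
  by apply: cdiffM; [exact: cdiff_cst|exact: cg].
rewrite NM NX Nreal gtr0_norm ?invr_gt0// ler_pdivrMr// [leRHS]mulrC.
by rewrite -cauchy_schwarz_1 lerDl sqr_ge0.
Qed.

Lemma continuous_line_comp (v : Cn -> R) (a b : Cn) (x : C) :
  {for a + x *: b, continuous v} -> {for x, continuous (fun l : C => v (a + l *: b))}.
Proof. by move=> cv P /cv; exact: continuous_line. Qed.

Lemma bergman_psh D : open D ->
  plurisubharmonic D (fun z => (ln (1 + bergman_fun D z))%:E).
Proof.
move=> oD; pose v z := ln (1 + bergman_fun D z).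
have K0 z : D z -> 0 < 1 + bergman_fun D z.
  by move=> Dz; rewrite ltr_pwDl// bergman_fun_ge0.
have cv z : D z -> {for z, continuous v}.
  move=> Dz; apply: continuous_ln_comp; first exact: K0.
  apply: (@continuousD _ _ _ (fun=> 1 : R)); first exact: cst_continuous.
  exact: bergman_fun_continuous.
split.
- by move=> z _; exact: ltry.
- move=> z /cv cvz a; rewrite lte_fin => va.
  move: cvz => /(@cvgrPdist_lt _ _ _ _ (nbhs_filter z))/(_ (a - v z)).
  rewrite subr_gt0 => /(_ va); apply: filterS => y.
  by rewrite lte_fin ltr_norml -/(v y) => /andP[+ _]; lra.
move=> a b; apply: (@subharmonic_real _ _ (fun l => v (a + l *: b))).
  by move=> x Dx; apply: continuous_line_comp; exact: cv.
move=> c r r0 rD; set J := cint _ _ _.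
have pi0 : 0 < 2 * pi :> R by rewrite mulr_gt0// pi_gt0.
have Dc : D (a + c *: b) by apply: rD; rewrite subrr N0 ltW.
(* Solved for K, the submean inequality becomes an upper bound on a supremum, which is verified for
   each f separately. *)
suff : bergman_fun D (a + c *: b) <= expR (J / (2 * pi)) - 1.
  rewrite lerBrDl => L; rewrite mulrC -ler_pdivlMr//.
  by rewrite -(@expRK _ (J / _)) ler_ln// posrE ?expR_gt0// K0.
apply: bergman_fun_le => // f bf; have [hf _] := bf.
pose g l := f (a + l *: b).
have := @submean_ln _ (fun x => 1 + N (g x) ^+ 2) c r (ltW r0) _.
have hg x : N (x - c) <= r -> 0 < 1 + N (g x) ^+ 2 /\ hol_good (fun x => 1 + N (g x) ^+ 2) x.
  move=> /rD Dx; split; first by rewrite ltr_pwDl// sqr_ge0.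
  have [d d0 dD] := open_slice oD Dx; apply: (hol_good_1DN2 d0) => y /dD Dy.
  exact: (holomorphic_line hf).
move=> /(_ hg) L.
have cJ t : {for t, continuous (fun t => v (a + circ c r t *: b))}.
  apply: (@circle_continuous _ (fun x => v (a + x *: b)) _ _ t (ltW r0)) => x /rD Dx.
  by apply: continuous_line_comp; exact: cv.
have cg t : {for t, continuous (fun t => ln (1 + N (g (circ c r t)) ^+ 2))}.
  apply: (@circle_continuous _ (fun x => ln (1 + N (g x) ^+ 2)) _ _ t (ltW r0)) => x xr.
  by have [gx [cgx _]] := hg x xr; exact: continuous_ln_comp.
have gJ : cint 0 (2 * pi) (fun t => ln (1 + N (g (circ c r t)) ^+ 2)) <= J.
  apply: le_cint => [t _|t _|t _]; [exact: cg|exact: cJ|].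
  have Dt : D (a + circ c r t *: b) by apply: rD; rewrite circ_in// ltW.
  rewrite ler_ln ?posrE ?K0//; last by rewrite ltr_pwDl// sqr_ge0.
  by rewrite lerD2l; exact: le_bergman_fun.
have := le_trans L gJ; rewrite mulrC -ler_pdivlMr// => {}L.
rewrite lerBrDl -[leLHS]lnK; last by rewrite posrE ltr_pwDl// sqr_ge0.
by rewrite ler_expR.
Qed.

Lemma bounded_coord D : bounded_set D ->
  exists2 B : R, 0 < B & forall z j, D z -> N (z 0 j) < B.
Proof.
move=> [M [Mreal H]].
have M1 : M < (`|Re M| + 1)%:C.
  rewrite -[X in X < _](RRe_real Mreal) ltcR (le_lt_trans (ler_norm _))// ltrDl//.
have B0 : 0 < `|Re M| + 2 by rewrite ltr_wpDl.
exists (`|Re M| + 2) => // z j Dz.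
have zM : `|z| <= (`|Re M| + 1)%:C by exact: (H _ M1).
have : ball (0 : Cn) (`|Re M| + 2)%:C z.
  by rewrite -ball_normE /= sub0r normrN (le_lt_trans zM)// ltcR; lra.
move=> [_ /(_ 0 j)]; rewrite -ball_normE /= mxE sub0r normrN normrcE ltcR.
by [].
Qed.

(** Sublevel sets are bounded because D is, and a boundary point of D is not a limit of points of
    one of them because K, hence log (1 + K), is large near it. *)
Lemma pseudoconvex_of_bergman_exhaustion D : open D -> bounded_set D ->
  (forall p, closure D p -> ~ D p -> forall M : R,
     exists2 d, 0 < d & forall z, D z -> near_box p d z -> M <= bergman_fun D z) ->
  pseudoconvex D.
Proof.
move=> oD /bounded_coord[B B0 DB] Kp; exists (fun z => ln (1 + bergman_fun D z)).
have K0 z : D z -> 0 < 1 + bergman_fun D z.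
  by move=> Dz; rewrite ltr_pwDl// bergman_fun_ge0.
split; last 1 first.
- move=> c /=; set S := [set z | _].
  have SD : S `<=` D by move=> z [].
  split.
    apply: (subclosed_compact _ (@rV_compact C n (fun=> [set x | N (x - 0) <= B]) _)).
    + exact: closed_closure.
    + by move=> i; exact: compact_disc.
    move=> p Sp i /=; rewrite subr0; apply/ler_addgt0Pr => e e0.
    have [|z [/SD Dz zp]] := Sp (near_box p e); first by apply/nbhs_rVP; exists e.
    have := zp i; have := DB _ i Dz; have := ND (z 0 i) (p 0 i - z 0 i).
    by rewrite addrC subrK Ndist; lra.
  move=> p Sp; have [//|nDp] := pselect (D p).
  have cDp : closure D p by exact: closure_subset SD _ Sp.
  have [d d0 H] := Kp p cDp nDp (expR c).
  have [|z [[Dz zc] zp]] := Sp (near_box p d); first by apply/nbhs_rVP; exists d.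
  have := H z Dz zp => cz; exfalso; move: zc; apply/negP; rewrite -leNgt.
  by rewrite -[c]expRK ler_ln ?posrE ?expR_gt0 ?K0//; lra.
- move=> z Dz; apply: continuous_ln_comp; first exact: K0.
  apply: (@continuousD _ _ _ (fun=> 1 : R)); first exact: cst_continuous.
  exact: bergman_fun_continuous.
- exact: bergman_psh.
Qed.

End exhaustion.

(** * Volumes of slabs *)

Section slab.
Context {R : realType}.
Local Notation C := (R[i]).
Local Notation N := (@ComplexField.Normc.normc R).
Local Notation Re := (@complex.Re R).
Local Notation Im := (@complex.Im R).
Local Notation mR := (measurableTypeR R).

Lemma lebesgue_C_rsquare (c : C) (rho : R) : 0 <= rho ->
  (@lebesgue_C R (rsquare c rho) = (4 * rho ^+ 2)%:E)%E.
Proof.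
move=> r0; rewrite /lebesgue_C product_measure1E//.
have L (x : R) : (@lebesgue_measure R `[(x - rho)%R, (x + rho)%R]%classic = (2 * rho)%:E)%E.
  rewrite lebesgue_measure_itv/= lte_fin; have [lt|le] := ltP.
    by rewrite -EFinB; congr EFin; ring.
  by congr EFin; lra.
apply: (etrans (congr2 (fun u v : \bar R => (u * v)%E) (L (Re c)) (L (Im c)))).
by rewrite -EFinM; congr EFin; ring.
Qed.

Lemma ge0_le_integralT d (T : measurableType d) (m : {measure set T -> \bar R})
    (f g : T -> \bar R) : (forall x, 0 <= f x)%E -> (forall x, f x <= g x)%E ->
  (\int[m]_x f x <= \int[m]_x g x)%E.
Proof.
move=> f0 fg; apply: ge0_le_integral_nonmeasurable => // x.
  by move=> _; exact: le_trans (f0 x) (fg x).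
by rewrite patch_setT.
Qed.

Lemma integral_indicE d (T : measurableType d) (m : {measure set T -> \bar R}) (A : set T) :
  measurable A -> (\int[m]_x (\1_A x)%:E = m A)%E.
Proof. by move=> mA; rewrite integral_indic// setIT. Qed.

Lemma integral_rsquare (c : C) (rho : R) : 0 <= rho ->
  (\int[@lebesgue_C R]_p (\1_(rsquare c rho) p)%:E = (4 * rho ^+ 2)%:E)%E.
Proof.
move=> r0; apply: (etrans _ (lebesgue_C_rsquare c r0)).
by apply: integral_indicE; exact: measurable_rsquare.
Qed.

Lemma integral_rbox n (z : 'rV[C]_n) (rho : R) : 0 <= rho ->
  (\int[@lebesgue_Cn R n]_t (\1_(rbox z rho) t)%:E = ((4 * rho ^+ 2) ^+ n)%:E)%E.
Proof.
move=> r0; elim: n => [|n IH] in z *.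
  rewrite integral_dirac//; last first.
    by apply/measurable_EFinP; apply: measurable_indic; exact: measurable_rbox.
  by rewrite diracE mem_set// mul1e indicE mem_set// => -[].
rewrite [z]consr_eta; set a := z 0 0; set z' := \row_j _.
rewrite integral_lebesgue_CnS; last 2 first.
- by apply/measurable_EFinP; apply: measurable_indic; exact: measurable_rbox.
- by move=> t; rewrite lee_fin.
under eq_integral.
  move=> p _.
  under eq_integral.
    move=> t _.
    have -> : (\1_(rbox (consr a z') rho) (tcons (p, t)))%:E =
        ((\1_(rsquare a rho) p)%:E * (\1_(rbox z' rho) t)%:E)%E :> \bar R.
      rewrite -EFinM !indicE -natrM mulnb; congr (nat_of_bool _)%:R%:E.
      by apply/idP/andP; rewrite !inE => /rbox_tcons.
    over.
  rewrite ge0_integralZl_EFin//; last first.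
    by apply/measurable_EFinP; apply: measurable_indic; exact: measurable_rbox.
  rewrite IH.
  over.
rewrite ge0_integralZr//; last 2 first.
- by apply/measurable_EFinP; apply: measurable_indic; exact: measurable_rsquare.
- by rewrite lee_fin exprn_ge0// mulr_ge0// sqr_ge0.
apply: (etrans (congr1 (fun x => (x * _)%E) (integral_rsquare a r0))).
by rewrite -EFinM [in RHS]exprS.
Qed.

(** The offset [b] makes the induction on the dimension possible: freezing the first coordinate
    moves its contribution into [b]. *)
Definition slab_form n (c : 'rV[C]_n) (b : C) (t : n.-tuple (mR * mR)) : C :=
  b + \sum_j c 0 j * toCn t 0 j.

Definition slab n (c : 'rV[C]_n) (b : C) (a B : R) : set (n.-tuple (mR * mR)) :=
  [set t | csquare 0 a (slab_form c b t)] `&` rbox 0 B.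

Lemma measurable_slab n (c : 'rV[C]_n) b a B : measurable (slab c b a B).
Proof.
apply: measurableI; last exact: measurable_rbox.
have m1 j : measurable_fun [set: n.-tuple (mR * mR)] (fun t => (tnth t j).1 : mR).
  exact: (measurableT_comp measurable_fst (measurable_tnth j)).
have m2 j : measurable_fun [set: n.-tuple (mR * mR)] (fun t => (tnth t j).2 : mR).
  exact: (measurableT_comp measurable_snd (measurable_tnth j)).
have mRe : measurable_fun [set: n.-tuple (mR * mR)] (fun t => Re (slab_form c b t) : mR).
  rewrite (_ : (fun t => _) = (fun t => Re b +
     \sum_j (Re (c 0 j) * (tnth t j).1 - Im (c 0 j) * (tnth t j).2))).
    apply: measurable_funD => //; apply: measurable_sum => j.
    by apply: measurable_funB; (apply: measurable_funM; first exact: measurable_cst);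
      [exact: m1|exact: m2].
  apply/funext => t; rewrite /slab_form raddfD raddf_sum; congr (_ + _).
  by apply: eq_bigr => j _; rewrite mxE; case: (c 0 j) (tnth t j) => [x y] [u v].
have mIm : measurable_fun [set: n.-tuple (mR * mR)] (fun t => Im (slab_form c b t) : mR).
  rewrite (_ : (fun t => _) = (fun t => Im b +
     \sum_j (Re (c 0 j) * (tnth t j).2 + Im (c 0 j) * (tnth t j).1))).
    apply: measurable_funD => //; apply: measurable_sum => j.
    by apply: measurable_funD; (apply: measurable_funM; first exact: measurable_cst);
      [exact: m2|exact: m1].
  apply/funext => t; rewrite /slab_form raddfD raddf_sum; congr (_ + _).
  by apply: eq_bigr => j _; rewrite mxE; case: (c 0 j) (tnth t j) => [x y] [u v].
have mp : measurable_fun [set: n.-tuple (mR * mR)]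
    (fun t => (Re (slab_form c b t), Im (slab_form c b t)) : mR * mR).
  exact/measurable_fun_pair.
have := mp measurableT _ (measurable_rsquare 0 a).
rewrite setTI; congr measurable.
Qed.

Lemma slab_form_tcons n c0 (c : 'rV[C]_n) b p t :
  slab_form (consr c0 c) b (tcons (p, t)) = slab_form c (b + c0 * (p.1 +i* p.2)) t.
Proof.
rewrite /slab_form big_ord_recl consr0 mxE tnth0 addrA; congr (_ + _).
by apply: eq_bigr => j _; rewrite consrS !mxE tnthS.
Qed.

Lemma consr_0 n : (0 : 'rV[C]_n.+1) = consr 0 0.
Proof. by apply: rowVP => [|j]; rewrite ?consr0 ?consrS !mxE. Qed.

(** If [i] is a later coordinate, the first one contributes the area 4 B ^ 2 of a square and
    induction treats the rest. If [i] is the first, the constraint on the form acts on it alone and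
    each later coordinate contributes 4 B ^ 2. *)
Lemma slab_measure n (c : 'rV[C]_n) b a B i : 0 <= a -> 0 <= B -> c 0 i != 0 ->
  (@lebesgue_Cn R n (slab c b a B) <=
    (4 * (2 * a / N (c 0 i)) ^+ 2 * (4 * B ^+ 2) ^+ n.-1)%:E)%E.
Proof.
move=> a0 B0; rewrite -integral_indicE; last exact: measurable_slab.
have mS m (e : 'rV[C]_m) f : measurable_fun [set: m.-tuple (mR * mR)]
    (fun t => (\1_(slab e f a B) t)%:E : \bar R).
  by apply/measurable_EFinP; apply: measurable_indic; exact: measurable_slab.
elim: n => [|n IH] in c b i *; first by case: i.
rewrite [c]consr_eta; set c0 := c 0 0; set c' := \row_j _.
rewrite integral_lebesgue_CnS; [|exact: mS|by move=> t; rewrite lee_fin].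
case: (unliftP ord0 i) => [j|] ->.
  rewrite consrS => cj.
  set M := (4 * _ ^+ 2 * _)%R.
  have M0 : 0 <= 4 * (2 * a / N (c' 0 j)) ^+ 2 * (4 * B ^+ 2) ^+ n.-1.
    by apply: mulr_ge0; [rewrite mulr_ge0// sqr_ge0|rewrite exprn_ge0// mulr_ge0// sqr_ge0].
  have -> : M = (4 * B ^+ 2) * (4 * (2 * a / N (c' 0 j)) ^+ 2 * (4 * B ^+ 2) ^+ n.-1).
    have n0 : (0 < n)%N by exact: leq_ltn_trans (leq0n j) (ltn_ord j).
    have E : (4 * B ^+ 2) ^+ n = (4 * B ^+ 2) * (4 * B ^+ 2) ^+ n.-1.
      by rewrite -[in LHS](prednK n0) [in LHS]exprS.
    by rewrite /M [n.+1.-1]/= E mulrCA.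
  rewrite EFinM -(integral_rsquare 0 B0).
  rewrite -ge0_integralZr//; last first.
    by apply/measurable_EFinP; apply: measurable_indic; exact: measurable_rsquare.
  apply: ge0_le_integralT => p.
    by apply: integral_ge0 => t _; rewrite lee_fin.
  have -> : (\int[@lebesgue_Cn R n]_t (\1_(slab (consr c0 c') b a B) (tcons (p, t)))%:E =
      \int[@lebesgue_Cn R n]_t ((\1_(rsquare 0 B) p)%:E *
         (\1_(slab c' (b + c0 * (p.1 +i* p.2)) a B) t)%:E))%E.
    apply: eq_integral => t _.
    rewrite -EFinM !indicE -natrM mulnb; congr (nat_of_bool _)%:R%:E.
    apply/idP/andP; rewrite !inE /slab/= slab_form_tcons consr_0.
      by move=> [h /rbox_tcons[h1 h2]].
    by move=> [h1 [h h2]]; split => //; apply/rbox_tcons.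
  rewrite ge0_integralZl_EFin//; last exact: mS.
  by apply: lee_wpmul2l; [rewrite lee_fin|exact: IH].
rewrite consr0 => c00.
(* The order of integration is exchanged: for a fixed tail, the first coordinate is confined to a
   square around - s / c0. Its half-side is 2 a / |c0| because points of [csquare 0 a] have modulus
   at most 2 a. *)
have := @fubini_tonelli _ _ _ _ _ (@lebesgue_C R) (@lebesgue_Cn R n)
  ((fun t => (\1_(slab (consr c0 c') b a B) t)%:E) \o @tcons _ (mR * mR)%type n)
  (measurableT_comp (mS _ _ _) (@measurable_tcons _ (mR * mR)%type n))
  (fun q => _ : (0 <= (\1_(slab (consr c0 c') b a B) (tcons q))%:E)%E).
move=> /(_ (fun q => _)) /= ->; last by move=> q; rewrite lee_fin.
rewrite [in leRHS]EFinM -(integral_rbox 0 B0).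
have K0 : (0 <= (4 * (2 * a / N c0) ^+ 2)%:E :> \bar R)%E.
  by rewrite lee_fin mulr_ge0// sqr_ge0.
rewrite -ge0_integralZl//; last first.
  by apply/measurable_EFinP; apply: measurable_indic; exact: measurable_rbox.
apply: ge0_le_integralT => t.
  by apply: integral_ge0 => p _; rewrite lee_fin.
have [tB|tB] := boolP (t \in rbox 0 B); last first.
  rewrite (eq_integral (cst 0%E)); first by rewrite integral0 mule_ge0// lee_fin.
  move=> p _; rewrite indicE memNset// => -[_].
  by rewrite consr_0 => /rbox_tcons[_ h]; move: tB; rewrite (mem_set h).
rewrite [X in (_ <= _ * X)%E](_ : _ = 1%E); last by rewrite indicE tB.
rewrite mule1.
have q0 : 0 <= 2 * a / N c0 by rewrite divr_ge0 ?N_ge0// mulr_ge0.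
pose s := slab_form c' b t.
rewrite -(integral_rsquare (- s / c0) q0).
apply: ge0_le_integralT => p; first by rewrite lee_fin.
rewrite lee_fin !indicE ler_nat.
have [|//] := boolP (tcons (p, t) \in _); rewrite inE => -[/=].
rewrite slab_form_tcons => h _; rewrite mem_set//.
move: h; rewrite [b + _]addrC; set s' := slab_form _ _ _.
have sE : s' = c0 * (p.1 +i* p.2) + s by rewrite /s' /s /slab_form -addrA.
have pE : p.1 +i* p.2 = - s / c0 + s' / c0 by rewrite sE; field.
have := congr1 Re pE; have := congr1 Im pE; rewrite !raddfD.
set u := - s / c0 => e2 e1 [/= h1 h2]; rewrite /= in e1 e2 h1 h2.
have q : N (s' / c0) <= 2 * a / N c0.
  rewrite NM NV ler_wpM2r ?invr_ge0 ?N_ge0//; apply: le_trans (N_le _) _.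
  by rewrite -/s' in h1 h2; rewrite mulrDl !mul1r lerD// ler_norml; lra.
have := le_trans (Re_le _) q; have := le_trans (Im_le _) q.
rewrite !ler_norml /rsquare/= !in_itv/= => /andP[p1 p2] /andP[p3 p4].
by clear -e1 e2 h1 h2 q p1 p2 p3 p4; split; apply/andP; split; lra.
Qed.

(** [volume] is an outer measure, so an inclusion into a measurable slab suffices. *)
Lemma volume_slab n (c : 'rV[C]_n) i a B (E : set 'rV[C]_n) :
  0 <= a -> 0 <= B -> c 0 i != 0 ->
  (forall X, E X -> N (\sum_j c 0 j * X 0 j) <= a /\ forall j, N (X 0 j) <= B) ->
  (volume E <= (4 * (2 * a / N (c 0 i)) ^+ 2 * (4 * B ^+ 2) ^+ n.-1)%:E)%E.
Proof.
move=> a0 B0 ci EX; apply: le_trans (slab_measure 0 a0 B0 ci).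
rewrite -measurable_mu_extE; last exact: measurable_slab.
have itv0 (x r : R) : (`|x| <= r) = (0 - r <= x <= 0 + r).
  by rewrite sub0r add0r ler_norml.
apply: le_mu_ext => t /EX[h1 h2]; split.
  have := le_trans (Re_le _) h1; have := le_trans (Im_le _) h1.
  by rewrite /= /slab_form add0r !itv0; split.
move=> j; have := h2 j; rewrite !mxE => h.
have := le_trans (Re_le _) h; have := le_trans (Im_le _) h.
by rewrite !itv0 /rsquare/= !in_itv/=; split.
Qed.

End slab.

(** * C1 boundaries *)

Section boundary_geometry.
Context {R : realType} {n : nat}.
Local Notation C := (R[i]).
Local Notation Cn := ('rV[C]_n).
Local Notation N := (@ComplexField.Normc.normc R).
Local Notation Re := (@complex.Re R).
Local Notation Im := (@complex.Im R).
Implicit Types (U D : set Cn) (r : Cn -> R) (p w v : Cn).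

Lemma C1_is_derive U r w v (t : R) : C1_on U r -> U (w + t%:C *: v) ->
  is_derive t 1 (fun s : R => r (w + s%:C *: v)) (real_derive r (w + t%:C *: v) v).
Proof.
move=> C1 Uw; have [dr _] := C1 v _ Uw.
have shiftE (h : R) : w + (h * 1 + t)%:C *: v = w + t%:C *: v + (h * 1 + 0)%:C *: v.
  have -> : (h * 1 + t)%:C = t%:C + (h * 1 + 0)%:C by rewrite -rmorphD; congr (_%:C); ring.
  by rewrite scalerDl addrA.
have zeroE : w + t%:C *: v + (0 : R)%:C *: v = w + t%:C *: v.
  by rewrite -[(0 : R)%:C]/(0 : C) scale0r addr0.
have E : (fun h : R => h^-1 *: (((fun s : R => r (w + s%:C *: v)) \o shift t) (h *: 1) - r (w + t%:C *: v))) =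
  (fun h : R => h^-1 *: (((fun s : R => r (w + t%:C *: v + s%:C *: v)) \o shift 0) (h *: 1) -
    r (w + t%:C *: v + (0 : R)%:C *: v))).
  by apply/funext => h; rewrite zeroE /comp /shift shiftE.
split; first by rewrite /derivable E.
by rewrite /real_derive derive1E /derive E.
Qed.

Lemma Re_rmul (t : R) (z : C) : Re (t%:C * z) = t * Re z.
Proof. by case: z => a b /=; rewrite mul0r subr0. Qed.

Lemma Im_rmul (t : R) (z : C) : Im (t%:C * z) = t * Im z.
Proof. by case: z => a b /=; rewrite mul0r addr0. Qed.

Lemma cbox_convex p rho w v (s t : R) : 0 <= t <= s ->
  cbox p rho w -> cbox p rho (w + s%:C *: v) -> cbox p rho (w + t%:C *: v).
Proof.
move=> /andP[t0 ts] h1 h2 j; have := h1 j; have := h2 j; rewrite !mxE.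
have conv (x y a b : R) : a <= x <= b -> a <= x + s * y <= b -> a <= x + t * y <= b.
  move=> /andP[l1 l2] /andP[l3 l4].
  have [y0|/ltW y0] := leP 0 y.
    have := mulr_ge0 t0 y0; have := ler_wpM2r y0 ts.
    by move: l3 l4; move: (t * y) (s * y) => u1 u2 *; apply/andP; split; lra.
  have := mulr_ge0_le0 t0 y0; have := ler_wnM2r y0 ts.
  by move: l3 l4; move: (t * y) (s * y) => u1 u2 *; apply/andP; split; lra.
by rewrite /csquare /= !raddfD/= !Re_rmul !Im_rmul => -[g1 g2] [g3 g4]; split; exact: conv.
Qed.

Lemma C1_segment U r p rho eta v w (s : R) : C1_on U r -> cbox p rho `<=` U ->
  (forall x, cbox p rho x -> `|real_derive r x v - real_derive r p v| <= eta) ->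
  cbox p rho w -> cbox p rho (w + s%:C *: v) ->
  `|r (w + s%:C *: v) - r w - s * real_derive r p v| <= eta * `|s|.
Proof.
move=> C1 pU near_p.
have pos x (u : R) : 0 <= u -> cbox p rho x -> cbox p rho (x + u%:C *: v) ->
    `|r (x + u%:C *: v) - r x - u * real_derive r p v| <= eta * `|u|.
  move=> u0 px pxu.
  have inp t : t \in `[0, u] -> cbox p rho (x + t%:C *: v).
    by rewrite in_itv/= => tu; exact: cbox_convex tu px pxu.
  have [| |t tu] := @MVT_segment R (fun t => r (x + t%:C *: v))
      (fun t => real_derive r (x + t%:C *: v) v) 0 u u0.
  - move=> t tu; apply: C1_is_derive C1 _; apply/pU/inp.
    by move: tu; rewrite !in_itv/= => /andP[/ltW -> /ltW ->].
  - apply: derivable_within_continuous => t tu.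
    by have [] := C1_is_derive C1 (pU _ (inp t tu)).
  rewrite scale0r addr0 subr0 => ->.
  rewrite [u * _]mulrC -mulrBl normrM ler_wpM2r//; apply: near_p; exact: inp.
move=> pw pws; have [s0|/ltW s0] := leP 0 s; first exact: pos.
have := pos (w + s%:C *: v) (- s); rewrite oppr_ge0 => /(_ s0 pws).
have -> : w + s%:C *: v + (- s)%:C *: v = w.
  by rewrite rmorphN scaleNr addrK.
move=> /(_ pw); rewrite normrN; congr (_ <= _).
by rewrite -normrN; congr (`| _ |); ring.
Qed.

(** Twice the (1,0)-part of the differential of r at p: with this covector L, Re (form L v) is the
    real differential applied to v. *)
Definition real_gradient r p : Cn :=
  \row_j (real_derive r p (delta_mx 0 j) +i* - real_derive r p ((0 +i* 1) *: delta_mx 0 j)).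

Definition form (L v : Cn) : C := \sum_j L 0 j * v 0 j.

Lemma combine_increments (A B F d1 d2 eta : R) (c : C) : 0 <= eta ->
  `|A - B - Re c * d1| <= eta * `|Re c| -> `|F - A - Im c * d2| <= eta * `|Im c| ->
  `|F - B - Re ((d1 +i* - d2) * c)| <= 2 * eta * N c.
Proof.
move=> eta0 h1 h2.
have -> : Re ((d1 +i* - d2) * c) = Re c * d1 + Im c * d2.
  by case: (c) => x y /=; ring.
have -> : F - B - (Re c * d1 + Im c * d2) = (F - A - Im c * d2) + (A - B - Re c * d1) by ring.
apply: le_trans (ler_normD _ _) _; apply: le_trans (lerD h2 h1) _.
rewrite -mulrDr -mulrA mulrCA ler_wpM2l// mulr_natl mulr2n lerD ?Re_le ?Im_le//.
Qed.

(** The real part of the coordinate is changed before its imaginary part; the intermediate point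
    remains in the box, which is a product of real intervals. *)
Lemma C1_coordinate U r p rho eta w (c : C) k : C1_on U r -> cbox p rho `<=` U -> 0 <= eta ->
  (forall x j, cbox p rho x ->
    `|real_derive r x (delta_mx 0 j) - real_derive r p (delta_mx 0 j)| <= eta /\
    `|real_derive r x ((0 +i* 1) *: delta_mx 0 j) -
      real_derive r p ((0 +i* 1) *: delta_mx 0 j)| <= eta) ->
  cbox p rho w -> cbox p rho (w + c *: delta_mx 0 k) ->
  `|r (w + c *: delta_mx 0 k) - r w - Re (real_gradient r p 0 k * c)| <= 2 * eta * N c.
Proof.
move=> C1 pU eta0 near_p pw pwc.
have e : w + c *: delta_mx 0 k =
    w + (Re c)%:C *: delta_mx 0 k + (Im c)%:C *: ((0 +i* 1) *: delta_mx 0 k).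
  rewrite -addrA scalerA -scalerDl; congr (_ + _ *: _).
  by rewrite [LHS]complexE mulrC.
have pm : cbox p rho (w + (Re c)%:C *: delta_mx 0 k).
  move=> j; have := pw j; have := pwc j; rewrite !mxE eqxx.
  have [_|_] := eqVneq j k; last by rewrite !mulr0 !addr0.
  rewrite !mulr1 /csquare /= !raddfD/= => -[h1 _] [_ h4].
  by split => //; rewrite addr0.
have h1 := C1_segment C1 pU (fun x px => (near_p x k px).1) pw pm.
rewrite e in pwc *.
have h2 := C1_segment C1 pU (fun x px => (near_p x k px).2) pm pwc.
rewrite mxE; exact: combine_increments eta0 h1 h2.
Qed.

(** Strict differentiability at p: both endpoints vary, because increments are later taken from
    points z near p. Coordinates are exchanged one at a time, through points [mix k] of the same
    box. *)
Lemma C1_strict U r p rho eta delta w w' : C1_on U r -> cbox p rho `<=` U -> 0 <= eta ->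
  (forall x j, cbox p rho x ->
    `|real_derive r x (delta_mx 0 j) - real_derive r p (delta_mx 0 j)| <= eta /\
    `|real_derive r x ((0 +i* 1) *: delta_mx 0 j) -
      real_derive r p ((0 +i* 1) *: delta_mx 0 j)| <= eta) ->
  cbox p rho w -> cbox p rho w' -> (forall j, N (w' 0 j - w 0 j) <= delta) ->
  `|r w' - r w - Re (form (real_gradient r p) (w' - w))| <= n%:R * (2 * eta * delta).
Proof.
move=> C1 pU eta0 near_p pw pw' ww'.
pose mix k : Cn := \row_j (if (j < k)%N then w' 0 j else w 0 j).
have pmix k : cbox p rho (mix k).
  by move=> j; rewrite mxE; case: ifP => _; [exact: pw'|exact: pw].
have mixS (k : 'I_n) : mix k.+1 = mix k + (w' 0 k - w 0 k) *: delta_mx 0 k.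
  apply/rowP => j; rewrite !mxE eqxx /= ltnS leq_eqVlt.
  have [->|jk] := eqVneq j k; first by rewrite eqxx ltnn/= mulr1 addrC subrK.
  by rewrite mulr0 addr0 (negbTE (_ : val j != val k)).
have -> : r w' - r w = \sum_(k < n) (r (mix k.+1) - r (mix k)).
  rewrite -(big_mkord xpredT (fun k => r (mix k.+1) - r (mix k))) telescope_sumr//.
  by congr (r _ - r _); apply/rowP => j; rewrite mxE ?ltn_ord.
rewrite /form raddf_sum -sumrB; apply: le_trans (ler_norm_sum _ _ _) _.
rewrite -[n in n%:R]card_ord -sumr_const mulr_suml.
apply: ler_sum => k _; rewrite mul1r.
have := @C1_coordinate U r p rho eta (mix k) (w' 0 k - w 0 k) k C1 pU eta0 near_p (pmix k).
rewrite -mixS => /(_ (pmix _)); rewrite !mxE => h; apply: le_trans h _.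
by rewrite ler_wpM2l// mulr_ge0.
Qed.

Lemma cbox_center p rho : 0 <= rho -> cbox p rho p.
Proof. by move=> rho0 j; split; apply/andP; split; lra. Qed.

Lemma near_cbox p rho : near_box p rho `<=` cbox p rho.
Proof.
move=> w wp j; have := le_trans (Re_le _) (ltW (wp j)).
have := le_trans (Im_le _) (ltW (wp j)).
rewrite !ler_norml /csquare/= !raddfB/= => /andP[? ?] /andP[? ?].
by split; apply/andP; split; lra.
Qed.

Lemma C1_near U r p eta : open_nbhs p U -> C1_on U r -> 0 < eta ->
  exists rho, [/\ 0 < rho <= 1, cbox p rho `<=` U &
  (forall x j, cbox p rho x ->
    `|real_derive r x (delta_mx 0 j) - real_derive r p (delta_mx 0 j)| <= eta /\
    `|real_derive r x ((0 +i* 1) *: delta_mx 0 j) -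
      real_derive r p ((0 +i* 1) *: delta_mx 0 j)| <= eta)].
Proof.
move=> [oU Up] C1 eta0.
have near_v v : \forall x \near p, `|real_derive r x v - real_derive r p v| <= eta.
  have [_ /(@cvgrPdist_le _ _ _ _ (nbhs_filter p)) /(_ _ eta0)] := C1 v p Up.
  by apply: filterS => x; rewrite distrC.
have H : \forall x \near p, U x /\ forall j : 'I_n,
    `|real_derive r x (delta_mx 0 j) - real_derive r p (delta_mx 0 j)| <= eta /\
    `|real_derive r x ((0 +i* 1) *: delta_mx 0 j) -
      real_derive r p ((0 +i* 1) *: delta_mx 0 j)| <= eta.
  apply: filterI; first exact: open_nbhs_nbhs.
  apply: (@filter_forall Cn 'I_n (fun j x =>
    `|real_derive r x (delta_mx 0 j) - real_derive r p (delta_mx 0 j)| <= eta /\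
    `|real_derive r x ((0 +i* 1) *: delta_mx 0 j) -
      real_derive r p ((0 +i* 1) *: delta_mx 0 j)| <= eta) (nbhs p)) => j.
  by apply: filterI; exact: near_v.
move/nbhs_rVP : H => [d d0 H]; pose rho := Num.min (d / 3) 1; exists rho.
have rd : rho <= d / 3 by rewrite ge_min lexx.
have hd : 2 * rho < d by lra.
have {}H x : cbox p rho x -> _ := fun px => H x (cbox_near hd px).
split.
- by rewrite /rho lt_min divr_gt0// ltr01 ge_min lexx orbT.
- by move=> x /H[].
- by move=> x j /H[_ ].
Qed.

(** The defining function comes with a nonzero derivative along some vector, and [real_derive] is
    not linear in the vector by definition. If the gradient vanished, [C1_strict] would make the
    increments of r along v too small for that derivative. *)
Lemma real_gradient_neq0 U r p v : open_nbhs p U -> C1_on U r -> real_derive r p v != 0 ->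
  exists i, real_gradient r p 0 i != 0.
Proof.
move=> nU C1 dv; apply: contrapT => no.
have L0 w : form (real_gradient r p) w = 0.
  rewrite /form big1// => j _; have [->|L] := eqVneq (real_gradient r p 0 j) 0.
    by rewrite mul0r.
  by case: no; exists j.
pose B := 1 + \sum_j N (v 0 j).
have B0 : 0 < B by rewrite ltr_pwDl// sumr_ge0// => j _; exact: N_ge0.
have vB j : N (v 0 j) <= B.
  rewrite /B (bigD1 j)//= addrCA lerDl addr_ge0// sumr_ge0// => k _; exact: N_ge0.
have n0 : 0 <= n%:R :> R by [].
pose K := n%:R * (2 * B).
have K0 : 0 <= K by rewrite mulr_ge0// mulr_ge0// ltW.
set d := real_derive r p v in dv.
(* With this [eta] the difference quotients along v are at most |d| / 2 in modulus, while
   convergence to d brings them within less than |d| / 2 of d. *)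
pose eta := `|d| / (2 * (K + 1)).
have d0 : 0 < `|d| by rewrite normr_gt0.
have eta0 : 0 < eta by rewrite divr_gt0// mulr_gt0// ltr_wpDl.
have [rho [/andP[rho0 rho1] pU near_p]] := C1_near nU C1 eta0.
have [dr _] := C1 v p nU.2.
have : (fun h : R => h^-1 *: (((fun s : R => r (p + s%:C *: v)) \o shift 0) (h *: 1) -
    r (p + (0 : R)%:C *: v))) h @[h --> 0^'] --> d.
  by rewrite /d /real_derive derive1E; exact: dr.
move=> /cvgrPdist_lt/(_ (`|d| / 2)); rewrite divr_gt0// => /(_ isT).
rewrite /dnbhs /within /= => /nbhs_ballP[e /= e0 He].
pose h := Num.min (e / 2) (rho / (2 * B)).
have h0 : 0 < h by rewrite lt_min !divr_gt0// mulr_gt0.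
have he : h <= e / 2 by rewrite ge_min lexx.
have hB : h * B <= rho / 2.
  by rewrite -ler_pdivlMr// -mulrA -invfM ge_min lexx orbT.
have hin : ball 0 e h by rewrite /ball/= sub0r normrN gtr0_norm//; lra.
have hn : h != 0 by rewrite gt_eqF.
have := He h hin hn.
rewrite /= addr0 -[h *: 1]/(h * 1) mulr1 -[(0 : R)%:C]/(0 : C) scale0r addr0.
have := @C1_strict U r p rho eta (h * B) p (p + h%:C *: v) C1 pU (ltW eta0) near_p.
rewrite L0 subr0 => /(_ _ _ _) S; suff : `|r (p + h%:C *: v) - r p| <= h * (`|d| / 2).
  move: (r _ - r _) => q qh dq; have : `|h^-1 *: q| <= `|d| / 2.
    by rewrite normrZ gtr0_norm ?invr_gt0// ler_pdivrMl.
  have := ler_normD (d - h^-1 *: q) (h^-1 *: q); rewrite subrK; lra.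
apply: le_trans (S _ _ _) _.
- exact/cbox_center/ltW.
- apply: near_cbox => j; rewrite !mxE addrAC subrr add0r NM Nreal gtr0_norm//.
  apply: le_lt_trans (_ : h * B < rho); [by rewrite ler_pM2l|lra].
- by move=> j; rewrite !mxE addrAC subrr add0r NM Nreal gtr0_norm// ler_pM2l.
have -> : n%:R * (2 * eta * (h * B)) = h * (K * eta) by rewrite /K; ring.
rewrite ler_pM2l// /eta mulrA ler_pdivrMr ?mulr_gt0 ?ltr_wpDl//.
have -> : `|d| / 2 * (2 * (K + 1)) = K * `|d| + `|d| by field.
by rewrite lerDl ltW.
Qed.

Lemma form_le (L v : Cn) delta : (forall j, N (v 0 j) <= delta) ->
  N (form L v) <= (\sum_j N (L 0 j)) * delta.
Proof.
move=> h; rewrite /form mulr_suml.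
have : N (\sum_j L 0 j * v 0 j) <= \sum_j N (L 0 j * v 0 j).
  by elim/big_ind2 : _ => [|a b c d ab cd|//]; rewrite ?N0//; apply: le_trans (ND _ _) (lerD _ _).
move/le_trans; apply; apply: ler_sum => j _; by rewrite NM ler_wpM2l// N_ge0.
Qed.

(** Here r p >= 0 and r w < 0. For z close to p, r z >= - eta rho, so r w - r z < eta rho; strict
    differentiability replaces this increment by Re L (w - z) at the cost of another eta rho. [L] is
    fixed before [eta], since a coordinate of [L] occurs in the denominator of the volume bound. *)
Lemma boundary_halfspace D p : open D -> C1_boundary D -> closure D p -> ~ D p ->
  exists2 L : Cn, (exists i, L 0 i != 0) & forall eta : R, 0 < eta ->
    exists rho d : R, [/\ 0 < rho <= 1, 0 < d & forall z w, D z -> near_box p d z -> D w ->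
      near_box z rho w -> Re (form L (w - z)) < 2 * eta * rho].
Proof.
move=> oD C1D cDp nDp; have [|U [r [nU C1 r0 DU]]] := C1D p.
  by split => // /interior_subset.
have [v rv] := r0 p nU.2; exists (real_gradient r p).
  exact: real_gradient_neq0 nU C1 rv.
set L := real_gradient r p => eta eta0.
have n0 : 0 <= n%:R :> R by [].
pose e := eta / (2 * n%:R + 1).
have e0 : 0 < e by rewrite divr_gt0// ltr_wpDl// mulr_ge0.
have [rho [/andP[rho0 rho1] pU near_p]] := C1_near nU C1 e0.
pose s := \sum_j N (L 0 j).
have s0 : 0 <= s by rewrite sumr_ge0// => j _; exact: N_ge0.
(* The second term brings z so close to p that r z >= - eta * (rho / 2). The scale returned below is
   rho / 2, which leaves room for the box around z inside the box around p. *)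
pose d := Num.min (rho / 2) (eta * (rho / 2) / (eta + s)).
have es0 : 0 < eta + s by rewrite ltr_pwDl.
have d0 : 0 < d by rewrite lt_min !divr_gt0// !mulr_gt0// divr_gt0.
have d1 : d <= rho / 2 by rewrite ge_min lexx.
have d2 : d * (eta + s) <= eta * (rho / 2) by rewrite -ler_pdivlMr// ge_min lexx orbT.
have strict w w' delta : cbox p rho w -> cbox p rho w' -> 0 <= delta ->
    (forall j, N (w' 0 j - w 0 j) <= delta) ->
    `|r w' - r w - Re (form L (w' - w))| <= eta * delta.
  move=> pw pw' de0 h; apply: le_trans (C1_strict C1 pU (ltW e0) near_p pw pw' h) _.
  have -> : n%:R * (2 * e * delta) = (n%:R * 2 * e) * delta by ring.
  rewrite ler_wpM2r// /e mulrA ler_pdivrMr; last by rewrite ltr_wpDl// mulr_ge0.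
  by rewrite mulrC ler_pM2l//; lra.
have pp : cbox p rho p by exact/cbox_center/ltW.
have rp : 0 <= r p.
  rewrite leNgt; apply/negP => rp; apply: nDp.
  by have : (D `&` U) p by [rewrite DU; split => //; exact: nU.2]; case.
exists (rho / 2), d; split => //; first by apply/andP; split; lra.
move=> z w Dz zp Dw wz.
have pz : cbox p rho z by apply: near_cbox => j; apply: lt_le_trans (zp j) _; lra.
have pw : cbox p rho w.
  apply: near_cbox => j; have := ND (w 0 j - z 0 j) (z 0 j - p 0 j).
  rewrite addrA subrK => /le_lt_trans; apply.
  have := wz j; have := zp j; lra.
have rw : r w < 0.
  by have : (D `&` U) w by [split => //; exact: pU]; rewrite DU; case.
have hzw : `|r w - r z - Re (form L (w - z))| <= eta * (rho / 2).
  by apply: strict => //; [lra|move=> j; exact: ltW].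
have hpz : `|r z - r p - Re (form L (z - p))| <= eta * d.
  by apply: strict => //; [exact: ltW|move=> j; exact: ltW].
have hL : `|Re (form L (z - p))| <= s * d.
  by apply: le_trans (Re_le _) _; apply: form_le => j; rewrite !mxE; exact/ltW/zp.
move: hzw hpz hL d2; rewrite !ler_norml.
move=> /andP[a1 a2] /andP[a3 a4] /andP[a5 a6]; rewrite mulrDr [d * eta]mulrC [d * s]mulrC.
clear -rw rp a1 a2 a3 a4 a5 a6 => a7; lra.
Qed.

End boundary_geometry.

(** * The Green function from below *)

Section green_candidate.
Context {R : realType} {n : nat}.
Local Notation C := (R[i]).
Local Notation Cn := ('rV[C]_n).
Local Notation N := (@ComplexField.Normc.normc R).
Local Notation Re := (@complex.Re R).
Local Notation Im := (@complex.Im R).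
Implicit Types (D : set Cn) (z w v L : Cn).

(** On each complex line, [snorm (w - z)] is a maximum of moduli of affine functions, hence
    supported by holomorphic functions; this is why the maximum norm is preferred to [enorm]. *)
Definition snorm v : R := \big[Order.max/0]_j N (v 0 j).

Lemma snorm_ge0 v : 0 <= snorm v. Proof. exact: bigmax_ge_id. Qed.

Lemma N_le_snorm v j : N (v 0 j) <= snorm v.
Proof. exact: le_bigmax. Qed.

Lemma snorm_le v B : 0 <= B -> (forall j, N (v 0 j) <= B) -> snorm v <= B.
Proof. by move=> B0 vB; apply: bigmax_le. Qed.

Lemma snorm_eq v : snorm v = 0 \/ exists j, snorm v = N (v 0 j).
Proof.
have [no|/existsNP[j _]] := pselect (forall j : 'I_n, False).
  by left; apply/eqP; rewrite eq_le snorm_ge0 snorm_le// => j; case: (no j).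
right; rewrite /snorm; have [k _ ->] := @eq_bigmax _ _ _ 0 j xpredT (fun j => N (v 0 j)) isT (fun j _ => N_ge0 _).
by exists k.
Qed.

Lemma snorm_le_enorm v : snorm v <= enorm v.
Proof.
apply: snorm_le => [|j]; first exact: sqrtr_ge0.
rewrite -(ger0_norm (N_ge0 (v 0 j))) -sqrtr_sqr ler_wsqrtr// (bigD1 j)//= lerDl.
by rewrite sumr_ge0// => k _; exact: sqr_ge0.
Qed.

Lemma snorm_dist v w e : 0 <= e -> (forall j, N (v 0 j - w 0 j) <= e) -> snorm v <= snorm w + e.
Proof.
move=> e0 vw; apply: snorm_le => [|j]; first by rewrite addr_ge0 ?snorm_ge0.
have := ND (v 0 j - w 0 j) (w 0 j); rewrite subrK => /le_trans; apply.
by rewrite addrC lerD ?N_le_snorm.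
Qed.

Lemma continuous_snorm z : continuous (fun w => snorm (w - z)).
Proof.
move=> w; apply/(@cvgrPdist_le _ _ _ _ (nbhs_filter w)) => e e0; apply/nbhs_rVP; exists e => // v vw.
have e0' := ltW e0.
have h1 : snorm (v - z) <= snorm (w - z) + e.
  apply: snorm_dist => // j; rewrite !mxE opprB addrA subrK; exact/ltW/vw.
have h2 : snorm (w - z) <= snorm (v - z) + e.
  apply: snorm_dist => // j; rewrite !mxE opprB addrA subrK Ndist; exact/ltW/vw.
by rewrite ler_norml; apply/andP; split; lra.
Qed.

Lemma formD L v w : form L (v + w) = form L v + form L w.
Proof. by rewrite /form -big_split; apply: eq_bigr => j _; rewrite mxE mulrDr. Qed.

Lemma formZ L v (c : C) : form L (c *: v) = c * form L v.
Proof. by rewrite /form mulr_sumr; apply: eq_bigr => j _; rewrite mxE mulrCA. Qed.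

Lemma formB L v w : form L (v - w) = form L v - form L w.
Proof. by rewrite formD -scaleN1r formZ mulN1r. Qed.

Lemma continuous_form L z : continuous (fun w => form L (w - z)).
Proof.
move=> w; apply/(@cvgrPdist_le _ _ _ _ (nbhs_filter w)) => e e0; apply/nbhs_rVP.
pose s := 1 + \sum_j N (L 0 j).
have s0 : 0 < s by rewrite ltr_pwDl// sumr_ge0// => j _; exact: N_ge0.
have Ree0 : 0 < Re e by move: e0; rewrite ltcE => /andP[].
exists (Re e / s); first by rewrite divr_gt0.
move=> v vw; rewrite -formB opprB addrA subrK normrcE -(RRe_real (gtr0_real e0)) lecR.
have := @form_le _ _ L (w - v) (Re e / s); move=> /(_ _)/le_trans; apply.
  by move=> j; rewrite !mxE Ndist; exact/ltW/vw.
by rewrite mulrA ler_pdivrMr// mulrC ler_pM2l// /s lerDr.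
Qed.

(** Competitors are handled through their exponentials E: the value -oo becomes E = 0, and the
    logarithmic pole becomes a linear bound on E. *)
Lemma green_ge D z (E : Cn -> R) K :
  (forall w, D w -> {for w, continuous E}) -> (forall w, D w -> E w < 1) ->
  (forall a b x, D (a + x *: b) -> hol_supported (fun l => E (a + l *: b)) x) ->
  0 < K -> (forall w, D w -> E w <= K * enorm (w - z)) ->
  forall w, (lne (E w)%:E <= green D z w)%E.
Proof.
move=> cE E1 sE K0 EK w; apply: ereal_sup_ubound; exists (fun w => lne (E w)%:E) => //.
have lt0 x : D x -> (lne (E x)%:E < 0)%E by move=> /E1 Ex; rewrite lne_lt0 lte_fin.
split.
- split.
  + by move=> x /lt0 /lt_trans; apply; rewrite ltry.
  + by move=> x /cE cx a; exact: near_lne_lt.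
  + move=> a b; apply: (@subharmonic_lne _ _ (fun l => E (a + l *: b))).
      by move=> x Dx; split; [apply: continuous_line_comp; exact: cE|exact: sE].
    by move=> x /E1.
- exact: lt0.
(* The added 1 makes the inequality strict. *)
- exists (ln K + 1) => x Dx xz.
  have e0 : 0 < enorm (x - z).
    rewrite lt_neqAle sqrtr_ge0 andbT eq_sym; apply: contra xz => /eqP e0.
    rewrite -subr_eq0; apply/eqP/rowP => j; rewrite [RHS]mxE; apply/eqP.
    rewrite -N_eq0 eq_le N_ge0 andbT -e0 (le_trans (N_le_snorm _ _))//.
    exact: snorm_le_enorm.
  have [Ex|Ex] := leP (E x) 0; first by rewrite le0_lneNy// ltNyr.
  rewrite lne_EFin// lte_fin.
  have : ln (E x) <= ln (K * enorm (x - z)).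
    by rewrite ler_ln ?posrE ?mulr_gt0// EK.
  by rewrite lnM ?posrE//; lra.
Qed.

End green_candidate.

(** * The glued competitor and the position of the indicatrix *)

Section glued_candidate.
Context {R : realType} {n : nat}.
Local Notation C := (R[i]).
Local Notation Cn := ('rV[C]_n).
Local Notation N := (@ComplexField.Normc.normc R).
Local Notation Re := (@complex.Re R).
Local Notation Im := (@complex.Im R).
Implicit Types (w v : Cn).
Variables (D : set Cn) (z L : Cn) (eta rho RR : R).
Hypotheses (oD : open D) (eta0 : 0 < eta) (rho0 : 0 < rho) (RR0 : 0 < RR)
  (rRR : rho <= RR).
Hypothesis DRR : forall w, D w -> snorm (w - z) < RR.
Hypothesis DL : forall w, D w -> snorm (w - z) < rho -> Re (form L (w - z)) < 2 * eta * rho.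

(* The factor [M] makes [N (F w) <= 3 * M < rho / (2 * RR)], so that [T] takes over before
   the sphere [snorm (w - z) = rho] is reached and [glue] is continuous. *)
Let den w : C := (4 * eta * rho)%:C - form L (w - z).
Let M := rho / (8 * RR).
Let F w : C := M%:C * form L (w - z) / den w.
Let T w : R := snorm (w - z) / RR.
Let glue w := if snorm (w - z) < rho then Num.max (N (F w)) (T w) else T w.

Let M0 : 0 < M. Proof. by rewrite divr_gt0// mulr_gt0. Qed.

Let er0 : 0 < eta * rho. Proof. exact: mulr_gt0. Qed.

Let den_ge w : D w -> snorm (w - z) < rho -> 2 * (eta * rho) <= N (den w).
Proof.
move=> Dw /(DL Dw) h; apply: le_trans (Re_le _); apply: le_trans (ler_norm _).
by move: h; rewrite raddfB/= -!mulrA => h; lra.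
Qed.

Let den_gt0 w : D w -> snorm (w - z) < rho -> 0 < N (den w).
Proof. by move=> Dw /(den_ge Dw); apply: lt_le_trans; rewrite mulr_gt0. Qed.

Let N_F w : N (F w) = M * N (form L (w - z)) / N (den w).
Proof. by rewrite /F NM NV NM Nreal gtr0_norm. Qed.

(** The half-space condition gives |den| >= 2 eta rho; as L (w - z) = 4 eta rho - den, it follows
    that |L (w - z)| <= 4 eta rho + |den| <= 3 |den|. *)
Let F_le w : D w -> snorm (w - z) < rho -> N (F w) <= 3 * M.
Proof.
move=> Dw wr; rewrite N_F ler_pdivrMr ?den_gt0//.
rewrite (_ : 3 * M * _ = M * (3 * N (den w))); last by rewrite [RHS]mulrCA [RHS]mulrA.
rewrite ler_pM2l//.
have -> : form L (w - z) = (4 * eta * rho)%:C - den w by rewrite /den opprB addrCA subrr addr0.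
have := NB (- den w) (- (4 * eta * rho)%:C).
have := ND (4 * eta * rho)%:C (- den w); rewrite !NN Nreal gtr0_norm -?mulrA ?mulr_gt0//.
by have := den_ge Dw wr; lra.
Qed.

Let T_ge0 w : 0 <= T w. Proof. by rewrite divr_ge0 ?snorm_ge0// ltW. Qed.

Let glue_far w : D w -> rho / 2 <= snorm (w - z) -> glue w = T w.
Proof.
move=> Dw rw; rewrite /glue; case: ifP => // wr; apply/max_idPr.
apply: le_trans (F_le Dw wr) _; rewrite ler_pdivlMr//.
have -> : 3 * M * RR = 3 / 8 * rho by rewrite /M; field; rewrite gt_eqF.
lra.
Qed.

Let continuous_T : continuous T.
Proof.
move=> w; apply: (@continuousM _ _ (fun w => snorm (w - z)) (fun=> RR^-1)).
  exact: continuous_snorm.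
exact: cst_continuous.
Qed.

Let continuous_glue w : D w -> {for w, continuous glue}.
Proof.
move=> Dw; have nD : nbhs w D by exact: open_nbhs_nbhs.
have [wr|wr] := ltP (snorm (w - z)) rho.
  have : {for w, continuous (fun w => Num.max (N (F w)) (T w))}.
    apply: continuous_max2; last exact: continuous_T.
    rewrite (_ : (fun _ => _) = fun w => M * N (form L (w - z)) * (N (den w))^-1); last first.
      by apply/funext => x; exact: N_F.
    apply: (@continuousM _ _ (fun w => M * N (form L (w - z))) (fun w => (N (den w))^-1)).
      apply: (@continuousM _ _ (fun=> M) (fun w => N (form L (w - z)))).
        exact: cst_continuous.
      apply: (@continuous_comp _ _ _ (fun w => form L (w - z)) N); first exact: continuous_form.
      exact: continuous_N.
    apply: continuousV; first by rewrite gt_eqF ?den_gt0.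
    apply: (@continuous_comp _ _ _ (fun w => form L (w - z)) (fun c => N ((4 * eta * rho)%:C - c))).
      exact: continuous_form.
    apply: continuous_N_lipschitz => x y; set k := _%:C.
    have := NB (k - x) (k - y); have := NB (k - y) (k - x).
    have -> : k - x - (k - y) = y - x by ring.
    have -> : k - y - (k - x) = x - y by ring.
    by rewrite [N (x - y)]Ndist ler_norml => *; apply/andP; split; lra.
  have near_r : \forall y \near w, snorm (y - z) < rho.
    have := @continuous_snorm _ _ z w.
    move=> /(@cvgrPdist_lt _ _ _ _ (nbhs_filter w))/(_ (rho - snorm (w - z))).
    rewrite subr_gt0 => /(_ wr); apply: filterS => y; rewrite ltr_norml => /andP[h _].
    by move: h; lra.
  have gw : glue w = Num.max (N (F w)) (T w) by rewrite /glue wr.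
  move=> cm; change (glue y @[y --> w] --> glue w); rewrite gw.
  have ev : \forall y \near w, Num.max (N (F y)) (T y) = glue y.
    by move: near_r; apply: filterS => y yr; rewrite /glue yr.
  by apply: cvg_trans cm; apply: (near_eq_cvg ev).
have near_r : \forall y \near w, rho / 2 < snorm (y - z).
  have := @continuous_snorm _ _ z w.
  move=> /(@cvgrPdist_lt _ _ _ _ (nbhs_filter w))/(_ (rho / 2)).
  rewrite divr_gt0// => /(_ isT); apply: filterS => y; rewrite ltr_norml => /andP[_ h].
  by move: h; lra.
have rw : rho / 2 <= snorm (w - z).
  by apply: le_trans wr; rewrite ler_pdivrMr// ler_peMr ?ltW//; lra.
change (glue y @[y --> w] --> glue w); rewrite glue_far//.
have ev : \forall y \near w, T y = glue y.
  by move: nD near_r; apply: filterS2 => y Dy yr; apply/esym/glue_far => //; exact: ltW.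
by apply: cvg_trans (@continuous_T w); apply: (near_eq_cvg ev).
Qed.

Let T_glue w : T w <= glue w.
Proof. by rewrite /glue; case: ifP => // _; rewrite le_max lexx orbT. Qed.

Let F_glue w : snorm (w - z) < rho -> N (F w) <= glue w.
Proof. by rewrite /glue => ->; rewrite le_max lexx. Qed.

Let glue_lt1 w : D w -> glue w < 1.
Proof.
move=> Dw; have T1 : T w < 1 by rewrite ltr_pdivrMr// mul1r DRR.
have [wr|wr] := ltP (snorm (w - z)) (rho / 2); last by rewrite glue_far.
rewrite /glue; case: ifP => // wr'; rewrite gt_max T1 andbT.
apply: le_lt_trans (F_le Dw wr') _.
rewrite /M mulrA ltr_pdivrMr ?mulr_gt0//; have := rRR; have := RR0; lra.
Qed.

Let supported_glue (a b : Cn) (x : C) : D (a + x *: b) ->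
  hol_supported (fun l => glue (a + l *: b)) x.
Proof.
move=> Dx; set w := a + x *: b.
(* Where [glue] equals [T], a coordinate of largest modulus supports it, also across the gluing
   sphere because T <= glue everywhere. Otherwise [glue] equals |F|, and snorm (w - z) < rho
   persists nearby. *)
have [FT|FT] := eqVneq (glue w) (T w).
  have [s0|[j sj]] := snorm_eq (w - z).
    exists (fun=> 0), 1; split => //.
      by rewrite N0 -/w FT /T s0 mul0r.
    by move=> y _; rewrite N0 (le_trans (T_ge0 _) (T_glue _)); split=> //; exact: cdiff_cst.
  exists (fun l => (a 0 j + b 0 j * l - z 0 j) * (RR^-1)%:C), 1; split => //.
    rewrite -/w FT /T sj NM Nreal gtr0_norm ?invr_gt0//; congr (N _ * _).
    by rewrite !mxE mulrC.
  move=> y _; split.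
    apply: cdiffM; last exact: cdiff_cst.
    apply: cdiffB; last exact: cdiff_cst.
    apply: cdiffD; first exact: cdiff_cst.
    by apply: cdiffM; [exact: cdiff_cst|exact: cdiff_id].
  apply: le_trans (T_glue _); rewrite NM Nreal gtr0_norm ?invr_gt0// ler_pM2r ?invr_gt0//.
  by have := N_le_snorm (a + y *: b - z) j; rewrite !mxE mulrC.
have wr : snorm (w - z) < rho by move: FT; rewrite /glue; case: ifP => //; rewrite eqxx.
have Fw : N (F w) = glue w.
  by move: FT; rewrite /glue wr; case: leP => //; rewrite eqxx.
have nD : nbhs w (D `&` [set y | snorm (y - z) < rho]).
  apply: filterI; first exact: open_nbhs_nbhs.
  have := @continuous_snorm _ _ z w.
  move=> /(@cvgrPdist_lt _ _ _ _ (nbhs_filter w))/(_ (rho - snorm (w - z))).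
  rewrite subr_gt0 => /(_ wr); apply: filterS => y; rewrite ltr_norml => /andP[h _].
  by rewrite /=; lra.
have /nbhs_NP[d d0 H] := continuous_line nD.
exists (fun l => F (a + l *: b)), d; split => // y /H[Dy yr]; split; last exact: F_glue.
have cform k : cdiff (fun l => form L (a + l *: b - z)) k.
  rewrite (_ : (fun _ => _) = fun l => form L a + l * form L b - form L z).
    apply: cdiffB; last exact: cdiff_cst.
    apply: cdiffD; first exact: cdiff_cst.
    by apply: cdiffM; [exact: cdiff_id|exact: cdiff_cst].
  by apply/funext => l; rewrite formB formD formZ.
apply: (@cdiffM _ (fun l => M%:C * form L (a + l *: b - z)) (fun l => (den (a + l *: b))^-1)).
  by apply: cdiffM; [exact: cdiff_cst|exact: cform].
apply: (@cdiffV _ (fun l => den (a + l *: b))); first by rewrite -N_gt0 den_gt0.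
by apply: cdiffB; [exact: cdiff_cst|exact: cform].
Qed.

(** Both pieces vanish at least linearly at z, which is the logarithmic pole demanded of a
    competitor. *)
Let glue_bound : exists2 K, 0 < K & forall w, D w -> glue w <= K * enorm (w - z).
Proof.
pose s := \sum_j N (L 0 j).
have s0 : 0 <= s by rewrite sumr_ge0// => j _; exact: N_ge0.
pose k := M * s / (2 * (eta * rho)).
have k0 : 0 <= k by apply: divr_ge0; apply: mulr_ge0 => //; exact: ltW.
exists (RR^-1 + k); first by rewrite ltr_pwDl// invr_gt0.
move=> w Dw; apply: le_trans (_ : (RR^-1 + k) * snorm (w - z) <= _); last first.
  by rewrite ler_wpM2l ?snorm_le_enorm// addr_ge0// invr_ge0 ltW.
have TK : T w <= (RR^-1 + k) * snorm (w - z).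
  by rewrite /T mulrC ler_wpM2r ?snorm_ge0// lerDl.
rewrite /glue; case: ifP => // wr; rewrite ge_max TK andbT N_F.
rewrite ler_pdivrMr ?den_gt0//.
have h1 : N (form L (w - z)) <= s * snorm (w - z) by apply: form_le => j; exact: N_le_snorm.
have h2 := den_ge Dw wr.
have h3 : k * snorm (w - z) * (2 * (eta * rho)) = M * (s * snorm (w - z)).
  by rewrite /k; field; rewrite !gt_eqF.
have h4 : M * N (form L (w - z)) <= k * snorm (w - z) * (2 * (eta * rho)).
  by rewrite h3 ler_pM2l.
apply: le_trans h4 _; apply: ler_pM h2.
- by rewrite mulr_ge0// snorm_ge0.
- by rewrite mulr_ge0// ltW.
- by rewrite ler_wpM2r ?snorm_ge0// lerDr invr_ge0 ltW.
Qed.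

Let glue_le_green w : (lne (glue w)%:E <= green D z w)%E.
Proof. by have [K K0 gK] := glue_bound; apply: green_ge K0 gK w. Qed.

(** An upper limit below 1 forces glue (z + l X) < |l| for all small l, and one small real l = m is
    exploited. [T] gives |X_j| < RR; [F] gives M |L X| < |den| <= 8 eta rho, and M = rho / (8 RR)
    turns this into 64 eta RR, free of rho. *)
Lemma azukawa_indicatrix X : (azukawa D z X < 1)%E ->
  (forall j, N (X 0 j) <= RR) /\ N (form L X) <= 64 * eta * RR.
Proof.
rewrite /azukawa /limf_esup => /ereal_inf_lt[_ [V nV <-] supV].
have [d0 d00 H0] : exists2 d : R, 0 < d & forall l, N l < d -> l != 0 -> V l.
  move: nV; rewrite /dnbhs /within /= => /nbhs_NP[d d0 H]; exists d => // l ld l0.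
  by apply: H; rewrite ?subr0.
have small l : N l < d0 -> l != 0 -> glue (z + l *: X) < N l.
  move=> ld l0; have Nl : 0 < N l by rewrite N_gt0.
  have : (expeR (green D z (z + l *: X)) * ((N l)^-1)%:E < 1)%E.
    by apply: le_lt_trans supV; apply: ereal_sup_ubound; exists l => //; exact: H0.
  have gE : ((glue (z + l *: X))%:E <= expeR (green D z (z + l *: X)))%E.
    rewrite -[leLHS]lneK ?lee_expeR//.
    by rewrite in_itv/= lee_fin leey (le_trans (T_ge0 _) (T_glue _)).
  move=> h; have : ((glue (z + l *: X))%:E * ((N l)^-1)%:E < 1)%E.
    by apply: le_lt_trans h; apply: lee_wpmul2r => //; rewrite lee_fin invr_ge0 N_ge0.
  by rewrite -EFinM lte_fin ltr_pdivrMr// mul1r.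
pose s := 1 + snorm X + N (form L X).
have X0 := snorm_ge0 X; have LX0 := N_ge0 (form L X).
have s0 : 0 < s by rewrite /s; lra.
(* The second term keeps z + m X in the ball where [F] enters the maximum; the third gives m |L X|
   <= 2 eta rho, so that [den] stays comparable with 4 eta rho. *)
pose m := Num.min (d0 / 2) (Num.min (rho / (2 * s)) (2 * (eta * rho) / s)).
have m0 : 0 < m by rewrite !lt_min !divr_gt0// ?mulr_gt0// mulr_gt0.
have m1 : m <= d0 / 2 by rewrite ge_min lexx.
have m2 : m * s <= rho / 2.
  by rewrite -ler_pdivlMr// -mulrA -invfM !ge_min lexx !orbT.
have m3 : m * s <= 2 * (eta * rho) by rewrite -ler_pdivlMr// !ge_min lexx !orbT.
have Nm : N m%:C = m by rewrite Nreal gtr0_norm.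
have m_neq0 : m%:C != 0 by rewrite -N_gt0 Nm.
have := small m%:C; rewrite Nm => /(_ _ m_neq0) g_lt.
have {}g_lt : glue (z + m%:C *: X) < m by apply: g_lt; lra.
have zX : z + m%:C *: X - z = m%:C *: X by rewrite addrAC subrr add0r.
have snormZ : snorm (m%:C *: X) <= m * snorm X.
  apply: snorm_le => [|j]; first by rewrite mulr_ge0// ltW.
  by rewrite mxE NM Nm ler_pM2l// N_le_snorm.
split.
  move=> j; have := le_lt_trans (T_glue _) g_lt; rewrite /T zX ltr_pdivrMr// => h.
  have : N ((m%:C *: X) 0 j) < m * RR by apply: le_lt_trans h; exact: N_le_snorm.
  by rewrite mxE NM Nm ltr_pM2l// => /ltW.
have wr : snorm (z + m%:C *: X - z) < rho.
  rewrite zX; apply: le_lt_trans snormZ _; apply: le_lt_trans (_ : m * s < rho).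
    by rewrite ler_pM2l// /s; lra.
  by apply: le_lt_trans m2 _; rewrite ltr_pdivrMr// ltr_pMr//; lra.
have Ng : N (den (z + m%:C *: X)) <= 8 * (eta * rho).
  rewrite /den zX formZ; apply: le_trans (ND _ _) _.
  rewrite NN NM Nm Nreal gtr0_norm -?mulrA ?mulr_gt0//.
  have : m * N (form L X) <= m * s by rewrite ler_pM2l// /s; lra.
  by move: m3 er0; lra.
have den0 : 0 < N (den (z + m%:C *: X)).
  have := NB (4 * eta * rho)%:C (m%:C * form L X).
  rewrite /den zX formZ NM Nm Nreal gtr0_norm -?mulrA ?mulr_gt0//.
  have : m * N (form L X) <= m * s by rewrite ler_pM2l// /s; lra.
  by move: m3 er0; lra.
have := le_lt_trans (F_glue wr) g_lt.
rewrite N_F ltr_pdivrMr// zX formZ NM Nm mulrCA ltr_pM2l// => h.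
have : M * N (form L X) <= 8 * (eta * rho) by apply: ltW; apply: lt_le_trans h _.
rewrite -ler_pdivlMl// /M; congr (_ <= _); field.
by rewrite !gt_eqF.
Qed.

End glued_candidate.

(** * The volume of the indicatrix near the boundary *)

Section boundary_volume.
Context {R : realType} {n : nat}.
Local Notation C := (R[i]).
Local Notation Cn := ('rV[C]_n).
Local Notation N := (@ComplexField.Normc.normc R).
Local Notation Re := (@complex.Re R).

Lemma azukawa_volume_ge0 (D : set Cn) z : (0 <= azukawa_volume D z)%E.
Proof. exact: mu_ext_ge0. Qed.

Lemma azukawa_volume_boundary (D : set Cn) p (e : R) : open D -> bounded_set D ->
  C1_boundary D -> closure D p -> ~ D p -> 0 < e ->
  exists2 d : R, 0 < d & forall z, D z -> near_box p d z -> (azukawa_volume D z <= e%:E)%E.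
Proof.
move=> oD /bounded_coord[B B0 DB] C1D cDp nDp e0.
have [L [i Li] H] := boundary_halfspace oD C1D cDp nDp.
(* This exceeds the diameter of D in the maximum norm, and the 1 ensures rho <= RR. *)
pose RR := 2 * B + 1.
have RR0 : 0 < RR by rewrite /RR; lra.
pose K := 4 * (2 * (64 * RR) / N (L 0 i)) ^+ 2 * (4 * RR ^+ 2) ^+ n.-1.
have K0 : 0 <= K.
  by apply: mulr_ge0; [rewrite mulr_ge0// sqr_ge0|rewrite exprn_ge0// mulr_ge0// sqr_ge0].
(* The volume is at most eta ^ 2 K with [K] independent of rho; as eta <= 1, this is at most eta (K
   + 1) <= e. *)
pose eta := Num.min 1 (e / (K + 1)).
have eta0 : 0 < eta by rewrite lt_min ltr01 divr_gt0// ltr_wpDl.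
have eta1 : eta <= 1 by rewrite ge_min lexx.
have etaK : eta * (K + 1) <= e by rewrite -ler_pdivlMr ?ltr_wpDl// ge_min lexx orbT.
have [rho [d [/andP[rho0 rho1] d0 Hd]]] := H eta eta0.
exists d => // z Dz zp.
have DRR w : D w -> snorm (w - z) < RR.
  move=> Dw; apply: le_lt_trans (_ : 2 * B < RR); last by rewrite /RR; lra.
  apply: snorm_le => [|j]; first by rewrite mulr_ge0// ltW.
  rewrite !mxE; have := ND (w 0 j) (- z 0 j); rewrite NN.
  by have := DB _ j Dw; have := DB _ j Dz; lra.
have rRR : rho <= RR by rewrite /RR; lra.
have DL w : D w -> snorm (w - z) < rho -> Re (form L (w - z)) < 2 * eta * rho.
  move=> Dw wr; apply: Hd => // j; apply: le_lt_trans wr.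
  by have := N_le_snorm (w - z) j; rewrite !mxE.
have a0 : 0 <= 64 * eta * RR by rewrite !mulr_ge0// ltW.
apply: le_trans (volume_slab a0 (ltW RR0) Li _) _.
  move=> X /(azukawa_indicatrix oD eta0 rho0 RR0 rRR DRR DL)[h1 h2].
  by split.
rewrite lee_fin.
have -> : 4 * (2 * (64 * eta * RR) / N (L 0 i)) ^+ 2 * (4 * RR ^+ 2) ^+ n.-1 = eta ^+ 2 * K.
  rewrite /K; move: ((4 * RR ^+ 2) ^+ n.-1) => Q; field.
  by rewrite gt_eqF ?N_gt0.
apply: le_trans etaK; rewrite expr2 -mulrA ler_pM2l//.
apply: le_trans (_ : K <= _); last by rewrite lerDl.
by rewrite ler_piMl.
Qed.

End boundary_volume.

Close Scope complex_scope.

Theorem proposition2 (R : realType) (n : nat) (D : set 'rV[R[i]]_n)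
    (domD : domain D) (bndD : bounded_set D) (C1D : C1_boundary D)
    (npcD : ~ pseudoconvex D) :
  exists z_ : nat -> 'rV[R[i]]_n,
    (forall j, D (z_ j)) /\
    (fun j => bergman_kernel D (z_ j) * azukawa_volume D (z_ j))%E @ \oo --> 0%E.
Proof.
have [oD _ _] := domD.
have KV0 z : D z -> (0 <= bergman_kernel D z * azukawa_volume D z)%E.
  move=> Dz; rewrite bergman_funE// mule_ge0 ?azukawa_volume_ge0//.
  by rewrite lee_fin bergman_fun_ge0.
(* Either K V takes arbitrarily small values on D, and points with K V < 1 / (j + 1) form the
   sequence, or K V >= c > 0 throughout D. *)
have [small|/existsNP[c /not_implyP[c0 large]]] := pselect (forall c : R, 0 < c ->
    exists2 z, D z & (bergman_kernel D z * azukawa_volume D z < c%:E)%E).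
  have h j : exists z, D z /\ (bergman_kernel D z * azukawa_volume D z < (j.+1%:R^-1)%:E)%E.
    by have [|z Dz zj] := small j.+1%:R^-1; [rewrite invr_gt0|exists z].
  have [z_ zP] := choice h; exists z_; split; first by move=> j; have [] := zP j.
  have le_h : \forall j \near \oo, (0 <= bergman_kernel D (z_ j) * azukawa_volume D (z_ j)
      <= (EFin \o @harmonic R) j)%E.
    by apply: nearW => j; have [Dz /ltW zj] := zP j; rewrite KV0.
  by apply: (squeeze_cvge le_h); [exact: cvg_cst|exact: cvge_harmonic].
exfalso; apply: npcD; apply: pseudoconvex_of_bergman_exhaustion => // p cDp nDp M.
(* From V <= e and K V >= c it follows that K >= c / e = |M| + 1. *)
pose e := c / (`|M| + 1).
have e0 : 0 < e by rewrite divr_gt0// ltr_wpDl.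
have [d d0 Hd] := azukawa_volume_boundary oD bndD C1D cDp nDp e0.
exists d => // z Dz zp; have V := Hd z Dz zp.
have : (c%:E <= bergman_kernel D z * azukawa_volume D z)%E.
  by rewrite leNgt; apply/negP => zc; apply: large; exists z.
rewrite bergman_funE// => cKV.
have K0 := bergman_fun_ge0 oD Dz.
have : (c%:E <= (bergman_fun D z * e)%:E)%E.
  by apply: le_trans cKV _; rewrite EFinM; apply: lee_wpmul2l.
rewrite lee_fin /e mulrA ler_pdivlMr ?ltr_wpDl// [leRHS]mulrC ler_pM2l// => h.
by have := ler_norm M; lra.
Qed.
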